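(* Let $(\mathcal{S}_1\times\mathcal{S}_2,\mathbb{W}_{S_1S_2})$ be a pair of finite-alphabet sources and $(\mathcal{X}_1\times\mathcal{X}_2,\mathcal{Y},\mathbb{W}_{Y|X_1X_2})$ a discrete memoryless MAC. Suppose there exist (i) finite sets $\mathcal{K},\mathcal{U},\mathcal{V}_1,\mathcal{V}_2$; (ii) maps $f_j:\mathcal{S}_j\to\mathcal{K}$ with $K_j=f_j(S_j)$; (iii) $\alpha,\beta\ge0$, $\rho>0$, $\delta>0$; (iv) an integer $l\ge l^*(\mathcal{U},\mathcal{Y},\rho)$; (v) a pmf $p_Up_{V_1}p_{V_2}p_{X_1|UV_1}p_{X_2|UV_2}\mathbb{W}_{Y|X_1X_2}$ with $p_U$ a type of sequences in $\mathcal{U}^l$, such that for some $a\in\{1,2\}$, $$(1+\delta)H(K_a)<\alpha+\beta,$$ $$H(S_j\mid S_{\bar j},K_a)+\mathcal{L}_l(\phi,|\mathcal{S}_j|)<I(V_j;Y\mid U,V_{\bar j})-\mathcal{L}(\phi,|\mathcal{V}_j|)\quad(j\in\{1,2\}),$$ $$\beta+H(S_1,S_2\mid K_a)+\mathcal{L}_l(\phi,|\mathcal{S}_1||\mathcal{S}_2|)<I(V_1,V_2;Y\mid U)-\mathcal{L}(\phi,|\mathcal{V}_1||\mathcal{V}_2|),$$ and $\phi\in[0,0.5)$, where $\phi:=g(\alpha+\rho,l)+\xi^{[l]}(K_1,K_2)+\tau_{l,\delta}(K_a)$, $g(R,l):=(l+1)^{2|\mathcal{U}||\mathcal{Y}|}\exp\{-lE_r(R,p_U,p_{Y|U})\}$.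 Then $(S_1,S_2)$ is transmissible over the MAC.
   Context: $\bar j$ is the other index. Source entropies under $\mathbb{W}_{S_1S_2}$; mutual informations and $p_{Y|U}$ under the pmf in (v). Logs/exps share a base; $h_b$ is binary entropy. Transmissibility over the MAC: for every $\epsilon>0$ there is $N_\epsilon$ such that for every $n\ge N_\epsilon$ there exist encoders $e_j:\mathcal{S}_j^n\to\mathcal{X}_j^n$ and a decoder $d:\mathcal{Y}^n\to\mathcal{S}_1^n\times\mathcal{S}_2^n$ with $P(d(Y^n)\ne(S_1^n,S_2^n))\le\epsilon$, where $(S_1^n,S_2^n)\sim\mathbb{W}^n_{S_1S_2}$ and $Y^n$ is the memoryless MAC output for inputs $e_1(S_1^n),e_2(S_2^n)$. Definitions: $l^*(\mathcal{A},\mathcal{B},\rho):=\min\{l\in\mathbb{N}:\exp(l\rho/2)\ge2(l+1)^{2|\mathcal{A}|+2|\mathcal{A}||\mathcal{B}|}\}$; $p_U$ is a type in $\mathcal{U}^l$ if $lp_U(u)\in\mathbb{Z}$ for all $u$; $E_r(R,p_U,W_{Y|U}):=\min_{V_{Y|U}}\{D(V_{Y|U}\|W_{Y|U}|p_U)+|I(p_U;V_{Y|U})-R|^+\}$; $\mathcal{L}_l(\mu,N):=\frac1lh_b(\mu)+\mu\log N$, $\mathcal{L}=\mathcal{L}_1$; $\xi^{[l]}(K_1,K_2):=1-(1-P(K_1\ne K_2))^l$; $\tau_{l,\delta}(K_a):=2|\mathcal{K}|\exp\{-2\delta^2p_{K_a}(b^* )^2l\}$, $b^*$ a symbol of least positive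 probability under $p_{K_a}$. *)

(* Defs.v *)
From HB Require Import structures.
From mathcomp Require Import all_boot all_order all_algebra.
From mathcomp Require Import all_classical all_reals all_analysis.
Set Implicit Arguments. Unset Strict Implicit. Unset Printing Implicit Defensive.
Import Order.TTheory GRing.Theory Num.Theory.
Local Open Scope ring_scope.
Local Open Scope classical_set_scope.

Section InfoTheory.
Variable R : realType.

Definition is_pmf (T : finType) (p : {ffun T -> R}) : Prop :=
  (forall t, 0 <= p t) /\ \sum_t p t = 1.

Definition is_type (T : finType) (l : nat) (p : {ffun T -> R}) : Prop :=
  forall t, exists k : nat, l%:R * p t = k%:R.

Definition xlnx (x : R) : R := if x == 0 then 0 else x * ln x.

Definition entropy (T : finType) (p : {ffun T -> R}) : R := - \sum_t xlnx (p t).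

Definition dist (O T : finType) (P : {ffun O -> R}) (X : O -> T) : {ffun T -> R} :=
  [ffun t => \sum_(w | X w == t) P w].

Definition Ent (O T : finType) (P : {ffun O -> R}) (X : O -> T) : R :=
  entropy (dist P X).

Definition condEnt (O T T' : finType) (P : {ffun O -> R}) (X : O -> T) (Z : O -> T') : R :=
  Ent P (fun w => (X w, Z w)) - Ent P Z.

Definition condMI (O T1 T2 T3 : finType) (P : {ffun O -> R})
  (X : O -> T1) (Y : O -> T2) (Z : O -> T3) : R :=
  condEnt P X Z - condEnt P X (fun w => (Y w, Z w)).

Definition MI (O T1 T2 : finType) (P : {ffun O -> R}) (X : O -> T1) (Y : O -> T2) : R :=
  condMI P X Y (fun _ => tt).

Definition hb (mu : R) : R := - xlnx mu - xlnx (1 - mu).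

Definition Ll (l : nat) (mu N : R) : R := (l%:R)^-1 * hb mu + mu * ln N.
Definition L1 (mu N : R) : R := Ll 1 mu N.

Definition lstar_cond (A B : finType) (rho : R) (l : nat) : bool :=
  (2 * (l.+1)%:R ^+ (2 * #|A| + 2 * #|A| * #|B|) <= expR (l%:R * rho / 2)).

Definition lstar (A B : finType) (rho : R) : nat :=
  match pselect (exists l, lstar_cond A B rho l) with
  | left H => ex_minn H
  | right _ => 0%N
  end.

Definition condDiv (A B : finType) (V Wm : A -> {ffun B -> R}) (p : {ffun A -> R}) : R :=
  \sum_a p a * \sum_b (if V a b == 0 then 0 else V a b * ln (V a b / Wm a b)).

Definition jointpmf (A B : finType) (p : {ffun A -> R}) (V : A -> {ffun B -> R})
  : {ffun A * B -> R} := [ffun w => p w.1 * V w.1 w.2].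

Definition MIpV (A B : finType) (p : {ffun A -> R}) (V : A -> {ffun B -> R}) : R :=
  MI (jointpmf p V) fst snd.

(* random-coding exponent
   E_r(Rt, p, W) = min_V { D(V||W|p) + |I(p;V) - Rt|^+ }.
   V ranging over stochastic matrices; those V with D(V||W|p) = +oo
   (not absolutely continuous w.r.t. W on the support of p) are excluded,
   as they never attain the minimum; the minimum is written as an infimum. *)
Definition Er (A B : finType) (Rt : R) (p : {ffun A -> R}) (Wm : A -> {ffun B -> R}) : R :=
  inf [set x | exists V : A -> {ffun B -> R},
        (forall a, is_pmf (V a)) /\
        (forall a b, 0 < p a -> Wm a b = 0 -> V a b = 0) /\
        x = condDiv V Wm p + Num.max (MIpV p V - Rt) 0].

Definition gfun (A B : finType) (Rt : R) (l : nat) (p : {ffun A -> R})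
  (Wm : A -> {ffun B -> R}) : R :=
  (l.+1)%:R ^+ (2 * #|A| * #|B|) * expR (- (l%:R * Er Rt p Wm)).

Definition chanpmf (U V1 V2 X1 X2 Y : finType) (pU : {ffun U -> R})
  (pV1 : {ffun V1 -> R}) (pV2 : {ffun V2 -> R})
  (pX1 : U -> V1 -> {ffun X1 -> R}) (pX2 : U -> V2 -> {ffun X2 -> R})
  (Wc : X1 -> X2 -> {ffun Y -> R}) : {ffun U * V1 * V2 * X1 * X2 * Y -> R} :=
  [ffun w => let: (u, v1, v2, x1, x2, y) := w in
     pU u * pV1 v1 * pV2 v2 * pX1 u v1 x1 * pX2 u v2 x2 * Wc x1 x2 y].

(* conditional pmf p_{Y|U}(y|u) = p_{UY}(u,y) / p_U(u) under a pmf P;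
   (rows with p_U(u) = 0 are irrelevant for E_r and set to 0) *)
Definition condpmf (O A B : finType) (P : {ffun O -> R}) (XU : O -> A) (XY : O -> B)
  : A -> {ffun B -> R} :=
  fun a => [ffun b => if dist P XU a == 0 then 0
                      else dist P (fun w => (XU w, XY w)) (a, b) / dist P XU a].

Definition xi (S1 S2 K : finType) (l : nat) (W : {ffun S1 * S2 -> R})
  (f1 : S1 -> K) (f2 : S2 -> K) : R :=
  1 - (1 - \sum_(s | f1 s.1 != f2 s.2) W s) ^+ l.

(* least positive probability of a pmf (the pmf being a pmf, some entry is positive
   and all are <= 1) *)
Definition minpos (T : finType) (p : {ffun T -> R}) : R :=
  \big[Num.min/1]_(t | 0 < p t) p t.

Definition tau (K : finType) (l : nat) (delta : R) (pK : {ffun K -> R}) : R :=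
  2 * #|K|%:R * expR (- (2 * delta ^+ 2 * minpos pK ^+ 2 * l%:R)).

Definition err_prob (S1 S2 X1 X2 Y : finType) (n : nat) (W : {ffun S1 * S2 -> R})
  (Wc : X1 -> X2 -> {ffun Y -> R})
  (e1 : {ffun 'I_n -> S1} -> {ffun 'I_n -> X1})
  (e2 : {ffun 'I_n -> S2} -> {ffun 'I_n -> X2})
  (d : {ffun 'I_n -> Y} -> {ffun 'I_n -> S1} * {ffun 'I_n -> S2}) : R :=
  \sum_(s1 : {ffun 'I_n -> S1}) \sum_(s2 : {ffun 'I_n -> S2})
     (\prod_(i < n) W (s1 i, s2 i)) *
     \sum_(y : {ffun 'I_n -> Y} | d y != (s1, s2))
        \prod_(i < n) Wc (e1 s1 i) (e2 s2 i) (y i).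

Definition transmissible (S1 S2 X1 X2 Y : finType) (W : {ffun S1 * S2 -> R})
  (Wc : X1 -> X2 -> {ffun Y -> R}) : Prop :=
  forall eps : R, 0 < eps -> exists N : nat, forall n : nat, (N <= n)%N ->
    exists (e1 : {ffun 'I_n -> S1} -> {ffun 'I_n -> X1})
           (e2 : {ffun 'I_n -> S2} -> {ffun 'I_n -> X2})
           (d : {ffun 'I_n -> Y} -> {ffun 'I_n -> S1} * {ffun 'I_n -> S2}),
      err_prob W Wc e1 e2 d <= eps.

End InfoTheory.

Definition cU {U V1 V2 X1 X2 Y : Type} (w : U * V1 * V2 * X1 * X2 * Y) : U := w.1.1.1.1.1.
Definition cV1 {U V1 V2 X1 X2 Y : Type} (w : U * V1 * V2 * X1 * X2 * Y) : V1 := w.1.1.1.1.2.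
Definition cV2 {U V1 V2 X1 X2 Y : Type} (w : U * V1 * V2 * X1 * X2 * Y) : V2 := w.1.1.1.2.
Definition cY {U V1 V2 X1 X2 Y : Type} (w : U * V1 * V2 * X1 * X2 * Y) : Y := w.2.

Definition Ka {S1 S2 K : Type} (a : bool) (f1 : S1 -> K) (f2 : S2 -> K) (s : S1 * S2) : K :=
  if a then f1 s.1 else f2 s.2.

(* Main.v *)
Require Import Defs.
From HB Require Import structures.
From mathcomp Require Import all_boot all_order all_algebra.
From mathcomp Require Import all_classical all_reals all_analysis.
From mathcomp Require Import ring lra zify.
Set Implicit Arguments. Unset Strict Implicit. Unset Printing Implicit Defensive.
Import Order.TTheory GRing.Theory Num.Theory.
Local Open Scope ring_scope.

(** Every encoder adds to its fixed inner code, which sends the common part [K] blockwise through a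
    constant-composition code of length [l], an outer random code in [V_j] over many blocks.  The
    outer code is analysed once, for arbitrary superletter sources: the receiver accepts a pair of
    messages when likelihood ratios [q / (pV1 pV2)], for any three subnormalised kernels [q], exceed
    a constant, and the scheme works as soon as the mean of each [ln (q / (pV1 pV2))] is positive
    (Markov's inequality for wrong pairs, a moment generating function for the true one).

    No entropy inequality is then needed on the blocks.  The kernels are mixtures
    [(1 - phi) g + phi / N], where [g] is a product of single-letter conditional laws which is
    correct unless the inner code failed, and [1 / N] is uniform: as a failure has probability at
    most [phi < 1/2], the mixture costs [hb phi + phi ln N], which the terms [Ll] and [L1] pay for.
    On correct blocks both [U]-words agree and have type [pU], hence the letters of [g] average to
    the single-letter conditional entropies.  In the third kernel [g] also guesses the inner message
    word uniformly in its bin of at most [exp (l beta)] typical words.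

    A failure is either a disagreement of the two [K]-words ([xi]), an atypical word ([tau],
    Hoeffding's inequality), or a decoding error of the inner code ([gfun]), whose codewords are
    drawn uniformly in the type class of [pU] and decoded by maximal empirical mutual
    information. *)

(** * Random coding *)

(** The obstacle is that a block is not memoryless: one inner failure spoils all its letters, and
    single-letter kernels may then give the true pair weight 0, which a logarithm cannot bear. The
    uniform part puts the floor [phi / N] under the kernel, and [phi < 1/2] makes the resulting cost
    nondecreasing in the failure probability, so that an upper bound on the latter is enough. Blocks
    are independent of each other: with [l] fixed a positive mean suffices, and only the number of
    blocks grows. Exact composition lets averages along a codeword equal averages under [pU] for
    every message, without any concentration in [l]. Bins are needed because the inner code carries
    rate about [alpha], while typical words may need [alpha + beta]; the missing [beta] is paid in
    the third rate condition. The condition in [lstar] pays for type counting in the inner code and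
    for a factor 2 from rounding the bin size. The left-over letters beyond the last full block take
    boundedly many values: they join the messages carried by the outer codebooks, at the price of a
    larger constant threshold. *)

Section RandomCoding.
Variable R : realType.

Lemma sum_prod_ffun (I T : finType) (F : I -> T -> R) :
  \sum_(f : {ffun I -> T}) \prod_i F i (f i) = \prod_i \sum_t F i t.
Proof. by rewrite bigA_distr_bigA. Qed.

(** Positive weight is retained along with the bound: in [max_score_code] it forces every codeword
    of the chosen code into the support of the drawing law, hence into the type class. *)
Lemma exists_le_mean (T : finType) (mu F : T -> R) (c : R) :
  (forall t, 0 <= mu t) -> \sum_t mu t = 1 -> \sum_t mu t * F t <= c ->
  exists2 t, 0 < mu t & F t <= c.
Proof.
move=> mu0 mu1 hc; apply: contrapT => hn.
have hF t : 0 < mu t -> c < F t.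
  by move=> ht; rewrite ltNge; apply/negP => h; apply: hn; exists t.
have h0 : \sum_t mu t * (F t - c) <= 0.
  under eq_bigr do rewrite mulrBr.
  by rewrite sumrB -mulr_suml mu1 mul1r subr_le0.
have h1 t : 0 <= mu t * (F t - c).
  have := mu0 t; rewrite le_eqVlt => /orP[/eqP <-|/[dup] ht /hF h]; first by rewrite mul0r.
  by rewrite mulr_ge0 // subr_ge0 ltW.
have h2 : \sum_t mu t * (F t - c) = 0 by apply/le_anti; rewrite h0 sumr_ge0.
have h3 : \sum_t mu t = 0.
  apply: big1 => t _; move/eqP: h2; rewrite psumr_eq0 // => /allP /(_ t).
  rewrite mem_index_enum => /(_ isT) /=; rewrite mulf_eq0 subr_eq0.
  have := mu0 t; rewrite le_eqVlt => /orP[/eqP <- //|/[dup] ht /hF h].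
  by rewrite (gt_eqF h) ?orbF => /eqP.
by move: mu1; rewrite h3 => /eqP; rewrite eq_sym oner_eq0.
Qed.

(** The law of a codeword may depend on its message: outer codewords are drawn conditionally on the
    inner codeword that the message determines. *)
Definition codebook_mean (A T : finType) (p : A -> T -> R) (F : {ffun A -> T} -> R) : R :=
  \sum_(g : {ffun A -> T}) (\prod_a p a (g a)) * F g.

Section Mean.
Variables (A T : finType) (p : A -> T -> R).
Hypotheses (p0 : forall a t, 0 <= p a t) (p1 : forall a, \sum_t p a t = 1).

Lemma codebook_weight_ge0 (g : {ffun A -> T}) : 0 <= \prod_a p a (g a).
Proof. by apply: prodr_ge0. Qed.

Lemma codebook_weight_sum : \sum_(g : {ffun A -> T}) \prod_a p a (g a) = 1.
Proof. by rewrite sum_prod_ffun; apply: big1. Qed.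

Lemma codebook_mean_le F G : (forall g, F g <= G g) -> codebook_mean p F <= codebook_mean p G.
Proof.
by move=> h; apply: ler_sum => g _; apply: ler_wpM2l => //; apply: codebook_weight_ge0.
Qed.

Lemma codebook_meanD F G :
  codebook_mean p (fun g => F g + G g) = codebook_mean p F + codebook_mean p G.
Proof. by rewrite -big_split /=; apply: eq_bigr => g _; rewrite mulrDr. Qed.

Lemma codebook_mean_sum (J : finType) (P : pred J) (F : J -> {ffun A -> T} -> R) :
  codebook_mean p (fun g => \sum_(j | P j) F j g) = \sum_(j | P j) codebook_mean p (F j).
Proof. by rewrite exchange_big /=; apply: eq_bigr => g _; rewrite mulr_sumr. Qed.

Lemma codebook_meanZ c F :
  codebook_mean p (fun g => c * F g) = c * codebook_mean p F.
Proof. by rewrite mulr_sumr; apply: eq_bigr => g _; rewrite mulrCA. Qed.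

Lemma codebook_mean1 a0 F : codebook_mean p (fun g => F (g a0)) = \sum_t p a0 t * F t.
Proof.
rewrite /codebook_mean.
transitivity (\sum_(g : {ffun A -> T})
    \prod_a (p a (g a) * (if a == a0 then F (g a) else 1))).
  apply: eq_bigr => g _; rewrite big_split /=; congr (_ * _).
  by rewrite -big_mkcond big_pred1_eq.
rewrite (sum_prod_ffun (fun a t => p a t * (if a == a0 then F t else 1))).
rewrite (bigD1 a0) //= eqxx [X in _ * X]big1 ?mulr1 // => a /negbTE ->.
by under eq_bigr do rewrite mulr1.
Qed.

(** Random coding uses nothing beyond this pairwise independence of the true codeword and one wrong
    codeword. *)
Lemma codebook_mean2 a0 a1 F : a1 != a0 ->
  codebook_mean p (fun g => F (g a0) (g a1)) = \sum_t p a0 t * \sum_t' p a1 t' * F t t'.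
Proof.
move=> a01.
(* Fixing the value of [g a0] by an indicator turns the integrand into a product over messages. *)
transitivity (codebook_mean p (fun g => \sum_t (g a0 == t)%:R * F t (g a1))).
  apply: eq_bigr => g _; congr (_ * _).
  by rewrite (bigD1 (g a0)) //= eqxx mul1r big1 ?addr0 // => t /negbTE;
     rewrite eq_sym => ->; rewrite mul0r.
rewrite codebook_mean_sum; apply: eq_bigr => t _; rewrite /codebook_mean.
transitivity (\sum_(g : {ffun A -> T})
    \prod_a (p a (g a) * (if a == a0 then (g a == t)%:R
                          else if a == a1 then F t (g a) else 1))).
  apply: eq_bigr => g _; rewrite big_split /=; congr (_ * _).
  rewrite (bigD1 a0) //= eqxx; congr (_ * _).
  by rewrite (bigD1 a1) //= (negbTE a01) eqxx big1 ?mulr1 // => a /andP[/negbTE -> /negbTE ->].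
rewrite (sum_prod_ffun (fun a s => p a s * (if a == a0 then (s == t)%:R
                          else if a == a1 then F t s else 1))).
rewrite (bigD1 a0) //= eqxx (bigD1 t) //= eqxx mulr1 big1 ?addr0; last first.
  by move=> s /negbTE ->; rewrite mulr0.
congr (_ * _); rewrite (bigD1 a1) //= (negbTE a01) eqxx.
rewrite [X in _ * X]big1 ?mulr1 // => a /andP[/negbTE -> /negbTE ->].
by under eq_bigr do rewrite mulr1.
Qed.

End Mean.

(** A single use of a channel with arbitrary alphabets, so that superletters and sequences of
    superletters fall under one notion. *)
Definition achievable (A1 A2 X1 X2 Y : finType) (Q : A1 -> A2 -> R)
    (Wc : X1 -> X2 -> Y -> R) (eps : R) : Prop :=
  exists (e1 : A1 -> X1) (e2 : A2 -> X2) (d : Y -> A1 * A2),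
    \sum_a1 \sum_a2 Q a1 a2 * \sum_(y | d y != (a1, a2)) Wc (e1 a1) (e2 a2) y <= eps.

(** * One-shot random coding for a multiple-access channel *)

Section OneShot.
Variables (A1 A2 T1 T2 X1 X2 Y : finType) (Q : A1 -> A2 -> R).
Variables (p1 : A1 -> T1 -> R) (p2 : A2 -> T2 -> R) (z1 : T1 -> X1) (z2 : T2 -> X2).
Variables (Wc : X1 -> X2 -> Y -> R) (acc : A1 -> T1 -> A2 -> T2 -> Y -> bool) (eta : R).
Hypotheses (Q0 : forall a1 a2, 0 <= Q a1 a2) (Q1 : \sum_a1 \sum_a2 Q a1 a2 = 1).
Hypotheses (p10 : forall a t, 0 <= p1 a t) (p11 : forall a, \sum_t p1 a t = 1).
Hypotheses (p20 : forall a t, 0 <= p2 a t) (p21 : forall a, \sum_t p2 a t = 1).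
Hypotheses (W0 : forall x1 x2 y, 0 <= Wc x1 x2 y) (W1 : forall x1 x2, \sum_y Wc x1 x2 y = 1).
Hypothesis acc1 : forall a2 t2 y, \sum_a1 \sum_t1 p1 a1 t1 * (acc a1 t1 a2 t2 y)%:R <= eta.
Hypothesis acc2 : forall a1 t1 y, \sum_a2 \sum_t2 p2 a2 t2 * (acc a1 t1 a2 t2 y)%:R <= eta.
Hypothesis acc12 : forall y,
  \sum_a1 \sum_a2 \sum_t1 \sum_t2 p1 a1 t1 * (p2 a2 t2 * (acc a1 t1 a2 t2 y)%:R) <= eta.

Let accg (g : {ffun A1 -> T1}) (h : {ffun A2 -> T2}) a y :=
  acc a.1 (g a.1) a.2 (h a.2) y.

(** Only a uniquely accepted pair is decoded. The default [x0] is arbitrary, since the union bound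
    below already charges the cases of no or several accepted pairs. *)
Let dec (x0 : A1 * A2) g h y : A1 * A2 :=
  odflt x0 [pick x | accg g h x y && [forall x', accg g h x' y ==> (x' == x)]].

(** A wrong accepted pair is sorted by its wrong coordinates: a correct coordinate carries the
    transmitted codeword, and only the wrong ones are independent of the output. *)
Let dec_union x0 g h y a1 a2 :
  ((dec x0 g h y != (a1, a2))%:R : R) <=
    (~~ acc a1 (g a1) a2 (h a2) y)%:R
    + \sum_(b1 | b1 != a1) (acc b1 (g b1) a2 (h a2) y)%:R
    + \sum_(b2 | b2 != a2) (acc a1 (g a1) b2 (h b2) y)%:R
    + \sum_(b1 | b1 != a1) \sum_(b2 | b2 != a2) (acc b1 (g b1) b2 (h b2) y)%:R.
Proof.
have s1 : 0 <= \sum_(b1 | b1 != a1) (acc b1 (g b1) a2 (h a2) y)%:R :> R.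
  by apply: sumr_ge0.
have s2 : 0 <= \sum_(b2 | b2 != a2) (acc a1 (g a1) b2 (h b2) y)%:R :> R.
  by apply: sumr_ge0.
have s3 : 0 <= \sum_(b1 | b1 != a1) \sum_(b2 | b2 != a2)
                 (acc b1 (g b1) b2 (h b2) y)%:R :> R.
  by apply: sumr_ge0 => b _; apply: sumr_ge0.
have [ha|] := boolP (acc a1 (g a1) a2 (h a2) y); last first.
  by move=> _ /=; case: (_ != _); rewrite /= ?mulr1n ?mulr0n; lra.
rewrite /= mulr0n add0r.
have [|hd] := boolP (dec x0 g h y != (a1, a2)); last by rewrite mulr0n; lra.
rewrite /dec; case: pickP => [x /andP[_ /forallP /(_ (a1, a2))]|].
  by rewrite /accg /= ha /= => /eqP ->; rewrite eqxx.
move=> /(_ (a1, a2)); rewrite /accg /= ha /= => /negbT; rewrite negb_forall.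
case/existsP => -[b1 b2]; rewrite negb_imply /= => /andP[hb]; rewrite xpair_eqE => hne _.
rewrite mulr1n.
have [e1|n1] := eqVneq b1 a1; [have [e2|n2] := eqVneq b2 a2 | have [e2|n2] := eqVneq b2 a2].
- by move: hne; rewrite e1 e2 !eqxx.
- have : 1 <= \sum_(b2 | b2 != a2) (acc a1 (g a1) b2 (h b2) y)%:R :> R.
    by rewrite (bigD1 b2) //= -e1 hb lerDl sumr_ge0.
  lra.
- have : 1 <= \sum_(b1 | b1 != a1) (acc b1 (g b1) a2 (h a2) y)%:R :> R.
    by rewrite (bigD1 b1) //= -e2 hb lerDl sumr_ge0.
  lra.
- have : 1 <= \sum_(b1 | b1 != a1) \sum_(b2 | b2 != a2)
                 (acc b1 (g b1) b2 (h b2) y)%:R :> R.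
    rewrite (bigD1 b1) //= (bigD1 b2) //= hb -addrA lerDl addr_ge0 ?sumr_ge0 // => b _.
    by rewrite sumr_ge0.
  lra.
Qed.

Local Notation E1 := (codebook_mean p1).
Local Notation E2 := (codebook_mean p2).

Let mix_le (F : T1 -> T2 -> Y -> R) a1 a2 : (forall t1 t2 y, F t1 t2 y <= eta) ->
  \sum_t1 p1 a1 t1 * \sum_t2 p2 a2 t2 * \sum_y Wc (z1 t1) (z2 t2) y * F t1 t2 y <= eta.
Proof.
move=> hF.
apply: (@le_trans _ _ (\sum_t1 p1 a1 t1 * eta)); last by rewrite -mulr_suml p11 mul1r.
apply: ler_sum => t1 _; apply: ler_wpM2l => //.
apply: (@le_trans _ _ (\sum_t2 p2 a2 t2 * eta)); last by rewrite -mulr_suml p21 mul1r.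
apply: ler_sum => t2 _; apply: ler_wpM2l => //.
apply: (@le_trans _ _ (\sum_y Wc (z1 t1) (z2 t2) y * eta)); last by rewrite -mulr_suml W1 mul1r.
by apply: ler_sum => y _; apply: ler_wpM2l.
Qed.

(** A wrong codeword is independent of the transmitted ones, hence of [y]; averaging over it first,
    with [y] frozen, gives at most [eta] for each of the three error patterns. A good pair of
    codebooks is then fixed one encoder at a time. *)
Lemma one_shot :
  achievable Q Wc
    (\sum_a1 \sum_a2 Q a1 a2 * (\sum_t1 p1 a1 t1 * \sum_t2 p2 a2 t2 *
        \sum_y Wc (z1 t1) (z2 t2) y * (~~ acc a1 t1 a2 t2 y)%:R) + 3 * eta).
Proof.
have [x0 _] : exists x : A1 * A2, True.
  apply: contrapT => hn; move: Q1; rewrite big1 => [/eqP|a1 _].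
    by rewrite eq_sym oner_eq0.
  by rewrite big1 // => a2 _; case: hn; exists (a1, a2).
pose err g h := \sum_a1 \sum_a2 Q a1 a2 *
  \sum_(y | dec x0 g h y != (a1, a2)) Wc (z1 (g a1)) (z2 (h a2)) y.
set rhs := (X in achievable _ _ X).
suff H : E1 (fun g => E2 (fun h => err g h)) <= rhs.
  have [g _ hg] := exists_le_mean (codebook_weight_ge0 p10) (codebook_weight_sum p11) H.
  have [h _ hh] := exists_le_mean (codebook_weight_ge0 p20) (codebook_weight_sum p21) hg.
  by exists (fun a => z1 (g a)), (fun a => z2 (h a)), (dec x0 g h).
pose f0 a1 a2 t1 t2 := \sum_y Wc (z1 t1) (z2 t2) y * (~~ acc a1 t1 a2 t2 y)%:R.
pose f1 a2 b1 t1 s1 t2 := \sum_y Wc (z1 t1) (z2 t2) y * (acc b1 s1 a2 t2 y)%:R.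
pose f2 a1 b2 t1 t2 s2 := \sum_y Wc (z1 t1) (z2 t2) y * (acc a1 t1 b2 s2 y)%:R.
pose f3 b1 b2 t1 s1 t2 s2 := \sum_y Wc (z1 t1) (z2 t2) y * (acc b1 s1 b2 s2 y)%:R.
have err_le g h : err g h <= \sum_a1 \sum_a2 Q a1 a2 *
   (f0 a1 a2 (g a1) (h a2)
    + \sum_(b1 | b1 != a1) f1 a2 b1 (g a1) (g b1) (h a2)
    + \sum_(b2 | b2 != a2) f2 a1 b2 (g a1) (h a2) (h b2)
    + \sum_(b1 | b1 != a1) \sum_(b2 | b2 != a2) f3 b1 b2 (g a1) (g b1) (h a2) (h b2)).
  apply: ler_sum => a1 _; apply: ler_sum => a2 _; apply: ler_wpM2l => //.
  rewrite big_mkcond /=.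
  apply: (@le_trans _ _ (\sum_y Wc (z1 (g a1)) (z2 (h a2)) y *
    ((~~ acc a1 (g a1) a2 (h a2) y)%:R
    + \sum_(b1 | b1 != a1) (acc b1 (g b1) a2 (h a2) y)%:R
    + \sum_(b2 | b2 != a2) (acc a1 (g a1) b2 (h b2) y)%:R
    + \sum_(b1 | b1 != a1) \sum_(b2 | b2 != a2) (acc b1 (g b1) b2 (h b2) y)%:R))).
    apply: ler_sum => y _; apply: le_trans (ler_wpM2l (W0 _ _ _) (dec_union x0 _ _ _ _ _)).
    by case: (_ != _); rewrite ?mulr1 ?mulr0.
  rewrite le_eqVlt; apply/orP; left; apply/eqP.
  have -> : \sum_(b1 | b1 != a1) f1 a2 b1 (g a1) (g b1) (h a2) =
     \sum_y Wc (z1 (g a1)) (z2 (h a2)) y *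
       \sum_(b1 | b1 != a1) (acc b1 (g b1) a2 (h a2) y)%:R.
    by rewrite exchange_big; apply: eq_bigr => y _; rewrite mulr_sumr.
  have -> : \sum_(b2 | b2 != a2) f2 a1 b2 (g a1) (h a2) (h b2) =
     \sum_y Wc (z1 (g a1)) (z2 (h a2)) y *
       \sum_(b2 | b2 != a2) (acc a1 (g a1) b2 (h b2) y)%:R.
    by rewrite exchange_big; apply: eq_bigr => y _; rewrite mulr_sumr.
  have -> : \sum_(b1 | b1 != a1) \sum_(b2 | b2 != a2) f3 b1 b2 (g a1) (g b1) (h a2) (h b2) =
     \sum_y Wc (z1 (g a1)) (z2 (h a2)) y *
       \sum_(b1 | b1 != a1) \sum_(b2 | b2 != a2) (acc b1 (g b1) b2 (h b2) y)%:R.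
    under [in RHS]eq_bigr do rewrite mulr_sumr.
    rewrite [RHS]exchange_big; apply: eq_bigr => b1 _.
    by rewrite exchange_big; apply: eq_bigr => y _; rewrite mulr_sumr.
  by rewrite -!big_split /=; apply: eq_bigr => y _; rewrite !mulrDr.
apply: (@le_trans _ _ (E1 (fun g => E2 (fun h => \sum_a1 \sum_a2 Q a1 a2 *
   (f0 a1 a2 (g a1) (h a2)
    + \sum_(b1 | b1 != a1) f1 a2 b1 (g a1) (g b1) (h a2)
    + \sum_(b2 | b2 != a2) f2 a1 b2 (g a1) (h a2) (h b2)
    + \sum_(b1 | b1 != a1) \sum_(b2 | b2 != a2)
        f3 b1 b2 (g a1) (g b1) (h a2) (h b2)))))).
  by apply: codebook_mean_le => // g; apply: codebook_mean_le => // h; apply: err_le.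
have E12sum (J : finType) (P : pred J) (F : J -> {ffun A1 -> T1} -> {ffun A2 -> T2} -> R) :
    E1 (fun g => E2 (fun h => \sum_(j | P j) F j g h)) =
    \sum_(j | P j) E1 (fun g => E2 (fun h => F j g h)).
  rewrite -codebook_mean_sum; congr codebook_mean; apply/funext => g.
  by rewrite codebook_mean_sum.
have E12D F G : E1 (fun g => E2 (fun h => F g h + G g h)) =
    E1 (fun g => E2 (fun h => F g h)) + E1 (fun g => E2 (fun h => G g h)).
  rewrite -codebook_meanD; congr codebook_mean; apply/funext => g.
  by rewrite codebook_meanD.
rewrite E12sum; under eq_bigr do rewrite E12sum.
have -> : rhs = \sum_a1 \sum_a2 Q a1 a2 * ((\sum_t1 p1 a1 t1 * \sum_t2 p2 a2 t2 *
    f0 a1 a2 t1 t2) + 3 * eta).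
  under [RHS]eq_bigr => a1 _.
    under eq_bigr do rewrite mulrDr. rewrite big_split /= -mulr_suml. over.
  by rewrite [RHS]big_split /= -mulr_suml Q1 mul1r.
apply: ler_sum => a1 _; apply: ler_sum => a2 _.
rewrite (_ : E1 _ = Q a1 a2 * E1 (fun g => E2 (fun h =>
    f0 a1 a2 (g a1) (h a2)
    + \sum_(b1 | b1 != a1) f1 a2 b1 (g a1) (g b1) (h a2)
    + \sum_(b2 | b2 != a2) f2 a1 b2 (g a1) (h a2) (h b2)
    + \sum_(b1 | b1 != a1) \sum_(b2 | b2 != a2)
        f3 b1 b2 (g a1) (g b1) (h a2) (h b2)))); last first.
  rewrite -codebook_meanZ; congr codebook_mean; apply/funext => g.
  by rewrite codebook_meanZ.
apply: ler_wpM2l => //.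
rewrite 3!E12D.
have m0 : E1 (fun g => E2 (fun h => f0 a1 a2 (g a1) (h a2))) =
    \sum_t1 p1 a1 t1 * \sum_t2 p2 a2 t2 * f0 a1 a2 t1 t2.
  rewrite (codebook_mean1 p11 a1 (fun t1 => E2 (fun h => f0 a1 a2 t1 (h a2)))).
  by apply: eq_bigr => t1 _; rewrite (codebook_mean1 p21 a2 (fun t2 => f0 a1 a2 t1 t2)).
(* The wrong codeword [s1] is averaged innermost. Adding back the term [b1 = a1] gives the sum
   bounded in [acc1], uniformly in the true codewords, which [mix_le] then averages away. *)
have m1 : E1 (fun g => E2 (fun h =>
    \sum_(b1 | b1 != a1) f1 a2 b1 (g a1) (g b1) (h a2))) <= eta.
  rewrite E12sum.
  rewrite (eq_bigr (fun b1 => \sum_t1 p1 a1 t1 * \sum_t2 p2 a2 t2 *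
      \sum_s1 p1 b1 s1 * f1 a2 b1 t1 s1 t2)); last first.
    move=> b1 b1a.
    rewrite (codebook_mean2 p11 (fun t1 s1 => E2 (fun h => f1 a2 b1 t1 s1 (h a2))) b1a).
    apply: eq_bigr => t1 _; congr (_ * _).
    under eq_bigr do rewrite (codebook_mean1 p21 a2 (fun t2 => f1 a2 b1 t1 _ t2)) mulr_sumr.
    rewrite exchange_big; apply: eq_bigr => t2 _; rewrite mulr_sumr.
    by apply: eq_bigr => s1 _; rewrite mulrCA.
  rewrite exchange_big /=; under eq_bigr do rewrite -mulr_sumr exchange_big /=.
  under eq_bigr do under eq_bigr do rewrite -mulr_sumr.
  pose F (t1 : T1) t2 y := \sum_(b1 | b1 != a1) \sum_s1 p1 b1 s1 * (acc b1 s1 a2 t2 y)%:R.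
  rewrite (eq_bigr (fun t1 => p1 a1 t1 * \sum_t2 p2 a2 t2 *
     \sum_y Wc (z1 t1) (z2 t2) y * F t1 t2 y)).
    apply: mix_le => t1 t2 y; apply: le_trans (acc1 a2 t2 y).
    rewrite [leRHS](bigD1 a1) //= lerDr sumr_ge0 // => t _.
    by rewrite mulr_ge0.
  move=> t1 _; congr (_ * _); apply: eq_bigr => t2 _; congr (_ * _).
  rewrite /F /f1.
  under [RHS]eq_bigr do rewrite mulr_sumr.
  rewrite [RHS]exchange_big; apply: eq_bigr => b1 _.
  under [LHS]eq_bigr do rewrite mulr_sumr.
  rewrite exchange_big; apply: eq_bigr => y _; rewrite mulr_sumr.
  by apply: eq_bigr => s1 _; rewrite mulrCA.
have m2 : E1 (fun g => E2 (fun h =>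
    \sum_(b2 | b2 != a2) f2 a1 b2 (g a1) (h a2) (h b2))) <= eta.
  rewrite E12sum.
  rewrite (eq_bigr (fun b2 => \sum_t1 p1 a1 t1 * \sum_t2 p2 a2 t2 *
      \sum_s2 p2 b2 s2 * f2 a1 b2 t1 t2 s2)); last first.
    move=> b2 b2a.
    rewrite (codebook_mean1 p11 a1 (fun t1 => E2 (fun h => f2 a1 b2 t1 (h a2) (h b2)))).
    apply: eq_bigr => t1 _; congr (_ * _).
    by rewrite (codebook_mean2 p21 (fun t2 s2 => f2 a1 b2 t1 t2 s2) b2a).
  rewrite exchange_big /=; under eq_bigr do rewrite -mulr_sumr exchange_big /=.
  under eq_bigr do under eq_bigr do rewrite -mulr_sumr.
  pose F t1 (t2 : T2) y := \sum_(b2 | b2 != a2) \sum_s2 p2 b2 s2 * (acc a1 t1 b2 s2 y)%:R.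
  rewrite (eq_bigr (fun t1 => p1 a1 t1 * \sum_t2 p2 a2 t2 *
     \sum_y Wc (z1 t1) (z2 t2) y * F t1 t2 y)).
    apply: mix_le => t1 t2 y; apply: le_trans (acc2 a1 t1 y).
    rewrite [leRHS](bigD1 a2) //= lerDr sumr_ge0 // => t _.
    by rewrite mulr_ge0.
  move=> t1 _; congr (_ * _); apply: eq_bigr => t2 _; congr (_ * _).
  rewrite /F /f2.
  under [RHS]eq_bigr do rewrite mulr_sumr.
  rewrite [RHS]exchange_big; apply: eq_bigr => b2 _.
  under [LHS]eq_bigr do rewrite mulr_sumr.
  rewrite exchange_big; apply: eq_bigr => y _; rewrite mulr_sumr.
  by apply: eq_bigr => s2 _; rewrite mulrCA.
have m3 : E1 (fun g => E2 (fun h => \sum_(b1 | b1 != a1) \sum_(b2 | b2 != a2)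
        f3 b1 b2 (g a1) (g b1) (h a2) (h b2))) <= eta.
  rewrite E12sum.
  pose G b1 b2 t1 t2 := \sum_s1 p1 b1 s1 * \sum_s2 p2 b2 s2 * f3 b1 b2 t1 s1 t2 s2.
  rewrite (eq_bigr (fun b1 => \sum_t1 p1 a1 t1 * \sum_t2 p2 a2 t2 *
      \sum_(b2 | b2 != a2) G b1 b2 t1 t2)); last first.
    move=> b1 b1a; rewrite E12sum.
    rewrite (eq_bigr (fun b2 => \sum_t1 p1 a1 t1 * \sum_t2 p2 a2 t2 * G b1 b2 t1 t2)).
      rewrite exchange_big /=; apply: eq_bigr => t1 _; rewrite -mulr_sumr; congr (_ * _).
      by rewrite exchange_big /=; apply: eq_bigr => t2 _; rewrite -mulr_sumr.
    move=> b2 b2a.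
    rewrite (codebook_mean2 p11 (fun t1 s1 => E2 (fun h => f3 b1 b2 t1 s1 (h a2) (h b2))) b1a).
    apply: eq_bigr => t1 _; congr (_ * _).
    under eq_bigr do rewrite (codebook_mean2 p21 (fun t2 s2 => f3 b1 b2 t1 _ t2 s2) b2a) mulr_sumr.
    rewrite exchange_big; apply: eq_bigr => t2 _; rewrite mulr_sumr.
    by apply: eq_bigr => s1 _; rewrite mulrCA.
  rewrite exchange_big /=; under eq_bigr do rewrite -mulr_sumr exchange_big /=.
  under eq_bigr do under eq_bigr do rewrite -mulr_sumr.
  pose F (t1 : T1) (t2 : T2) y := \sum_(b1 | b1 != a1) \sum_(b2 | b2 != a2)
     \sum_s1 \sum_s2 p1 b1 s1 * (p2 b2 s2 * (acc b1 s1 b2 s2 y)%:R).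
  have a0 b1 b2 s1 s2 y : 0 <= p1 b1 s1 * (p2 b2 s2 * (acc b1 s1 b2 s2 y)%:R).
    by rewrite !mulr_ge0.
  rewrite (eq_bigr (fun t1 => p1 a1 t1 * \sum_t2 p2 a2 t2 *
     \sum_y Wc (z1 t1) (z2 t2) y * F t1 t2 y)).
    apply: mix_le => t1 t2 y; apply: le_trans (acc12 y).
    rewrite [leRHS](bigD1 a1) //=; apply: ler_wpDl.
      by do 3! (apply: sumr_ge0 => ? _).
    apply: ler_sum => b1 _; rewrite [leRHS](bigD1 a2) //= lerDr.
    by do 2! (apply: sumr_ge0 => ? _).
  move=> t1 _; congr (_ * _); apply: eq_bigr => t2 _; congr (_ * _).
  rewrite /F /G /f3.
  under [RHS]eq_bigr do rewrite mulr_sumr.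
  rewrite [RHS]exchange_big; apply: eq_bigr => b1 _.
  under [RHS]eq_bigr do rewrite mulr_sumr.
  rewrite [RHS]exchange_big; apply: eq_bigr => b2 _.
  under [RHS]eq_bigr do rewrite mulr_sumr.
  rewrite [RHS]exchange_big; apply: eq_bigr => s1 _.
  under [RHS]eq_bigr do rewrite mulr_sumr.
  rewrite [RHS]exchange_big mulr_sumr; apply: eq_bigr => s2 _.
  rewrite !mulr_sumr; apply: eq_bigr => y _.
  by rewrite [RHS]mulrCA [in RHS](mulrCA (Wc _ _ _)).
rewrite m0; lra.
Qed.

End OneShot.
End RandomCoding.

(** * Averages over a multiple-access channel *)

Section MacMean.
Variable R : realType.

Lemma ler_wpM2l_gt0 (c x y : R) : 0 <= c -> (0 < c -> x <= y) -> c * x <= c * y.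
Proof.
rewrite le_eqVlt => /orP[/eqP <- _|c0 h]; first by rewrite !mul0r.
by apply: ler_wpM2l (h c0); apply: ltW.
Qed.

Lemma prodr_gt0_factor (I : finType) (F : I -> R) :
  (forall i, 0 <= F i) -> 0 < \prod_i F i -> forall i, 0 < F i.
Proof.
move=> F0 h i; rewrite lt_neqAle F0 andbT; apply/negP => /eqP hi.
by move: h; rewrite (bigD1 i) //= -hi mul0r ltxx.
Qed.

Lemma sum_prod_ffunM (I T : finType) (F G : I -> T -> R) :
  \sum_(f : {ffun I -> T}) (\prod_i F i (f i)) * \prod_i G i (f i) =
  \prod_i \sum_t F i t * G i t.
Proof. by rewrite -sum_prod_ffun; apply: eq_bigr => f _; rewrite -big_split. Qed.

Lemma sum_power_extra (I A1 A2 B1 B2 : finType) (G : I -> A1 -> A2 -> R) (Q' : B1 -> B2 -> R) :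
  \sum_(a1 : {ffun I -> A1} * B1) \sum_(a2 : {ffun I -> A2} * B2)
     (\prod_i G i (a1.1 i) (a2.1 i)) * Q' a1.2 a2.2 =
  (\prod_i \sum_a1 \sum_a2 G i a1 a2) * \sum_b1 \sum_b2 Q' b1 b2.
Proof.
rewrite -(pair_bigA _ (fun (a1 : {ffun I -> A1}) b1 => \sum_(a2 : {ffun I -> A2} * B2)
   (\prod_i G i (a1 i) (a2.1 i)) * Q' b1 a2.2)) /=.
rewrite -(sum_prod_ffun (fun i a1 => \sum_a2 G i a1 a2)) mulr_suml.
apply: eq_bigr => a1 _; rewrite -sum_prod_ffun mulr_sumr; apply: eq_bigr => b1 _.
rewrite -(pair_bigA _ (fun (a2 : {ffun I -> A2}) b2 =>
   (\prod_i G i (a1 i) (a2 i)) * Q' b1 b2)) /=.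
by rewrite mulr_suml; apply: eq_bigr => a2 _; rewrite mulr_sumr.
Qed.

Lemma ln_prod (I : finType) (F : I -> R) :
  (forall i, 0 < F i) -> ln (\prod_i F i) = \sum_i ln (F i).
Proof.
move=> F0; apply: expR_inj; rewrite expR_sum lnK; last by rewrite posrE prodr_gt0.
by apply: eq_bigr => i _; rewrite lnK // posrE.
Qed.

(** Inverting [1 - x <= expR (- x)] leaves a factor [1 - 2 * x], whose sign explains the range of
    [x]. *)
Lemma expR_le_quadratic (x : R) : x <= 1 / 2 -> expR x <= 1 + x + 2 * x ^+ 2.
Proof.
move=> hx; have h1 : 1 - x <= expR (- x) by exact: expR_ge1Dx.
have e0 : 0 < 1 - x by lra.
have h2 : expR x <= (1 - x)^-1.
  by rewrite -[x in leLHS]opprK expRN lef_pV2 ?posrE ?expR_gt0.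
apply: (le_trans h2); rewrite -[leLHS]mul1r ler_pdivrMr //.
have : 0 <= x ^+ 2 by rewrite exprn_even_ge0.
have -> : (1 + x + 2 * x ^+ 2) * (1 - x) = 1 + x ^+ 2 * (1 - 2 * x) by ring.
by move=> h; rewrite lerDl mulr_ge0 //; lra.
Qed.

Section Def.
Variables (A1 A2 T1 T2 X1 X2 Y : finType) (Q : A1 -> A2 -> R).
Variables (p1 : A1 -> T1 -> R) (p2 : A2 -> T2 -> R) (z1 : T1 -> X1) (z2 : T2 -> X2).
Variables (Wc : X1 -> X2 -> Y -> R).

(** Expectation over the whole experiment: source pair, one codeword per encoder, channel output.
    The codewords are independent given the sources, as the encoders do not cooperate. *)
Definition mac_mean (F : A1 -> T1 -> A2 -> T2 -> Y -> R) : R :=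
  \sum_a1 \sum_a2 Q a1 a2 * (\sum_t1 p1 a1 t1 * \sum_t2 p2 a2 t2 *
    \sum_y Wc (z1 t1) (z2 t2) y * F a1 t1 a2 t2 y).

Lemma mac_meanD F G : mac_mean (fun a1 t1 a2 t2 y => F a1 t1 a2 t2 y + G a1 t1 a2 t2 y) =
  mac_mean F + mac_mean G.
Proof.
rewrite /mac_mean -big_split /=; apply: eq_bigr => a1 _.
rewrite -big_split /=; apply: eq_bigr => a2 _; rewrite -mulrDr; congr (_ * _).
rewrite -big_split /=; apply: eq_bigr => t1 _; rewrite -mulrDr; congr (_ * _).
rewrite -big_split /=; apply: eq_bigr => t2 _; rewrite -mulrDr; congr (_ * _).
by rewrite -big_split /=; apply: eq_bigr => y _; rewrite mulrDr.
Qed.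

Lemma mac_meanZ c F : mac_mean (fun a1 t1 a2 t2 y => c * F a1 t1 a2 t2 y) = c * mac_mean F.
Proof.
rewrite /mac_mean mulr_sumr; apply: eq_bigr => a1 _.
rewrite mulr_sumr; apply: eq_bigr => a2 _; rewrite mulrCA; congr (_ * _).
rewrite mulr_sumr; apply: eq_bigr => t1 _; rewrite mulrCA; congr (_ * _).
rewrite mulr_sumr; apply: eq_bigr => t2 _; rewrite mulrCA; congr (_ * _).
by rewrite mulr_sumr; apply: eq_bigr => y _; rewrite mulrCA.
Qed.

Hypotheses (Q0 : forall a1 a2, 0 <= Q a1 a2) (Q1 : \sum_a1 \sum_a2 Q a1 a2 = 1).
Hypotheses (p10 : forall a t, 0 <= p1 a t) (p11 : forall a, \sum_t p1 a t = 1).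
Hypotheses (p20 : forall a t, 0 <= p2 a t) (p21 : forall a, \sum_t p2 a t = 1).
Hypotheses (W0 : forall x1 x2 y, 0 <= Wc x1 x2 y) (W1 : forall x1 x2, \sum_y Wc x1 x2 y = 1).

(** The comparison is demanded only where all factors are positive: logarithms of likelihood ratios
    are controlled nowhere else. *)
Lemma mac_mean_le F G :
  (forall a1 t1 a2 t2 y, 0 < Q a1 a2 -> 0 < p1 a1 t1 -> 0 < p2 a2 t2 ->
     0 < Wc (z1 t1) (z2 t2) y -> F a1 t1 a2 t2 y <= G a1 t1 a2 t2 y) ->
  mac_mean F <= mac_mean G.
Proof.
move=> h; apply: ler_sum => a1 _; apply: ler_sum => a2 _; apply: ler_wpM2l_gt0 => // hq.
apply: ler_sum => t1 _; apply: ler_wpM2l_gt0 => // h1.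
apply: ler_sum => t2 _; apply: ler_wpM2l_gt0 => // h2.
by apply: ler_sum => y _; apply: ler_wpM2l_gt0 => // h3; apply: h.
Qed.

Lemma mac_mean_source (F : A1 -> A2 -> R) :
  mac_mean (fun a1 _ a2 _ _ => F a1 a2) = \sum_a1 \sum_a2 Q a1 a2 * F a1 a2.
Proof.
apply: eq_bigr => a1 _; apply: eq_bigr => a2 _; congr (_ * _).
under eq_bigr => t1 _.
  under eq_bigr => t2 _ do rewrite -mulr_suml W1 mul1r.
  rewrite -mulr_suml p21 mul1r; over.
by rewrite -mulr_suml p11 mul1r.
Qed.

Lemma mac_mean_const c : mac_mean (fun _ _ _ _ _ => c) = c.
Proof.
rewrite (mac_mean_source (fun _ _ => c)).
by under eq_bigr do rewrite -mulr_suml; rewrite -mulr_suml Q1 mul1r.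
Qed.

(** Chernoff: on a finite space [F] is bounded, so for small [t] the linear term [- t * D], with [D]
    the mean, beats the quadratic remainder. *)
Lemma mac_mean_mgf_lt1 F : 0 < mac_mean F ->
  exists2 t : R, 0 < t & mac_mean (fun a1 t1 a2 t2 y => expR (- t * F a1 t1 a2 t2 y)) < 1.
Proof.
move=> D0.
pose B := 1 + \sum_(w : A1 * T1 * A2 * T2 * Y)
  `|let: (a1, t1, a2, t2, y) := w in F a1 t1 a2 t2 y|.
have hB a1 t1 a2 t2 y : `|F a1 t1 a2 t2 y| <= B.
  rewrite /B (bigD1 (a1, t1, a2, t2, y)) //= addrCA lerDl addr_ge0 //.
  by apply: sumr_ge0.
have B0 : 0 < B by rewrite /B ltr_pwDl // sumr_ge0.
have DB : mac_mean F <= B.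
  rewrite -[leRHS]mac_mean_const; apply: mac_mean_le => a1 t1 a2 t2 y _ _ _ _.
  by apply: le_trans (hB a1 t1 a2 t2 y); apply: ler_norm.
set D := mac_mean F in D0 DB *.
(* This [t] makes the remainder [2 * t ^+ 2 * B ^+ 2] equal to [t * D / 2], and [D <= B] gives
   [t * B <= 1 / 4], within the range of [expR_le_quadratic]. *)
pose t := D / (4 * B ^+ 2).
have t0 : 0 < t by rewrite divr_gt0 // mulr_gt0 // exprn_gt0.
have tB : t * B <= 1 / 4.
  rewrite /t mulrAC ler_pdivrMr ?mulr_gt0 ?exprn_gt0 //.
  by rewrite expr2; have := ler_wpM2r (ltW B0) DB; lra.
exists t => //.
apply: (@le_lt_trans _ _ (1 + (- t * D + 2 * t ^+ 2 * B ^+ 2))).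
  set c := 2 * t ^+ 2 * B ^+ 2.
  have -> : 1 + (- t * D + c) =
      mac_mean (fun a1 t1 a2 t2 y => 1 + (- t * F a1 t1 a2 t2 y + c)).
    by rewrite !mac_meanD !mac_mean_const mac_meanZ.
  rewrite /c; apply: mac_mean_le => a1 t1 a2 t2 y _ _ _ _.
  have hF := hB a1 t1 a2 t2 y; set f := F a1 t1 a2 t2 y in hF *.
  have hf : `|t * f| <= 1 / 4.
    by rewrite normrM gtr0_norm //; apply: le_trans tB; apply: ler_wpM2l => //; apply: ltW.
  apply: le_trans (expR_le_quadratic _) _.
    by move: hf; rewrite ler_norml mulNr => /andP[? ?]; lra.
  rewrite addrA lerD2l -mulrA ler_wpM2l // mulNr sqrrN exprMn ler_wpM2l ?exprn_even_ge0 //.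
  by rewrite -[f ^+ 2]real_normK ?num_real // lerXn2r // nnegrE // ltW.
have -> : 1 + (- t * D + 2 * t ^+ 2 * B ^+ 2) = 1 - t * D / 2.
  by rewrite /t; field; lra.
by rewrite ltrBlDr ltrDl divr_gt0 // mulr_gt0.
Qed.

End Def.

(** [F] does not read the extra messages in [B1] and [B2], which will hold the left-over letters, so
    their law [Q'] integrates to 1. *)
Lemma mac_mean_prod (A1 A2 T1 T2 X1 X2 Y B1 B2 I : finType) (Q : A1 -> A2 -> R)
    (Q' : B1 -> B2 -> R) (p1 : A1 -> T1 -> R) (p2 : A2 -> T2 -> R) (z1 : T1 -> X1)
    (z2 : T2 -> X2) (Wc : X1 -> X2 -> Y -> R) (F : A1 -> T1 -> A2 -> T2 -> Y -> R) :
  \sum_b1 \sum_b2 Q' b1 b2 = 1 ->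
  mac_mean (fun (a1 : {ffun I -> A1} * B1) (a2 : {ffun I -> A2} * B2) =>
              (\prod_i Q (a1.1 i) (a2.1 i)) * Q' a1.2 a2.2)
           (fun a1 (t1 : {ffun I -> T1}) => \prod_i p1 (a1.1 i) (t1 i))
           (fun a2 (t2 : {ffun I -> T2}) => \prod_i p2 (a2.1 i) (t2 i))
           (fun t1 => [ffun i => z1 (t1 i)]) (fun t2 => [ffun i => z2 (t2 i)])
           (fun (x1 : {ffun I -> X1}) (x2 : {ffun I -> X2}) (y : {ffun I -> Y}) =>
              \prod_i Wc (x1 i) (x2 i) (y i))
           (fun a1 t1 a2 t2 y => \prod_i F (a1.1 i) (t1 i) (a2.1 i) (t2 i) (y i)) =
  mac_mean Q p1 p2 z1 z2 Wc F ^+ #|I|.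
Proof.
move=> Q'1.
pose G a1 a2 := \sum_t1 p1 a1 t1 * \sum_t2 p2 a2 t2 *
    \sum_y Wc (z1 t1) (z2 t2) y * F a1 t1 a2 t2 y.
transitivity (\sum_(a1 : {ffun I -> A1} * B1) \sum_(a2 : {ffun I -> A2} * B2)
   (\prod_i (Q (a1.1 i) (a2.1 i) * G (a1.1 i) (a2.1 i))) * Q' a1.2 a2.2).
  apply: eq_bigr => a1 _; apply: eq_bigr => a2 _.
  rewrite big_split /= [RHS]mulrAC; congr (_ * _); rewrite /G.
  rewrite -(sum_prod_ffunM (fun i t => p1 (a1.1 i) t) (fun i t1 => \sum_t2 p2 (a2.1 i) t2 *
    \sum_y Wc (z1 t1) (z2 t2) y * F (a1.1 i) t1 (a2.1 i) t2 y)).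
  apply: eq_bigr => t1 _; congr (_ * _).
  rewrite -(sum_prod_ffunM (fun i t => p2 (a2.1 i) t) (fun i t2 =>
    \sum_y Wc (z1 (t1 i)) (z2 t2) y * F (a1.1 i) (t1 i) (a2.1 i) t2 y)).
  apply: eq_bigr => t2 _; congr (_ * _).
  rewrite -(sum_prod_ffunM (fun i y => Wc (z1 (t1 i)) (z2 (t2 i)) y)
     (fun i y => F (a1.1 i) (t1 i) (a2.1 i) (t2 i) y)).
  apply: eq_bigr => y _; congr (_ * _).
  by apply: eq_bigr => i _; rewrite !ffunE.
rewrite (sum_power_extra (fun (_ : I) a1 a2 => Q a1 a2 * G a1 a2)) Q'1 mulr1.
by rewrite prodr_const.
Qed.

End MacMean.

(** * Superletter coding over many blocks *)

Lemma achievable_le (R : realType) (A1 A2 X1 X2 Y : finType) (Q : A1 -> A2 -> R)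
    (Wc : X1 -> X2 -> Y -> R) (eps eps' : R) :
  achievable Q Wc eps -> eps <= eps' -> achievable Q Wc eps'.
Proof. by move=> [e1 [e2 [d h]]] he; exists e1, e2, d; apply: le_trans he. Qed.

Section Superletter.
Variables (R : realType) (A1 A2 T1 T2 X1 X2 Y : finType) (Q : A1 -> A2 -> R).
Variables (p1 : A1 -> T1 -> R) (p2 : A2 -> T2 -> R) (z1 : T1 -> X1) (z2 : T2 -> X2).
Variables (Wc : X1 -> X2 -> Y -> R).
Hypotheses (Q0 : forall a1 a2, 0 <= Q a1 a2) (Q1 : \sum_a1 \sum_a2 Q a1 a2 = 1).
Hypotheses (p10 : forall a t, 0 <= p1 a t) (p11 : forall a, \sum_t p1 a t = 1).
Hypotheses (p20 : forall a t, 0 <= p2 a t) (p21 : forall a, \sum_t p2 a t = 1).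
Hypotheses (W0 : forall x1 x2 y, 0 <= Wc x1 x2 y) (W1 : forall x1 x2, \sum_y Wc x1 x2 y = 1).

Let mean := mac_mean Q p1 p2 z1 z2 Wc.

Let powQ (I B1 B2 : finType) (Q' : B1 -> B2 -> R) (a1 : {ffun I -> A1} * B1)
  (a2 : {ffun I -> A2} * B2) := (\prod_i Q (a1.1 i) (a2.1 i)) * Q' a1.2 a2.2.
Let powp1 (I B1 : finType) (a1 : {ffun I -> A1} * B1) (t1 : {ffun I -> T1}) :=
  \prod_i p1 (a1.1 i) (t1 i).
Let powp2 (I B2 : finType) (a2 : {ffun I -> A2} * B2) (t2 : {ffun I -> T2}) :=
  \prod_i p2 (a2.1 i) (t2 i).
Let powz1 (I : finType) (t1 : {ffun I -> T1}) := [ffun i => z1 (t1 i)].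
Let powz2 (I : finType) (t2 : {ffun I -> T2}) := [ffun i => z2 (t2 i)].
Let powW (I : finType) (x1 : {ffun I -> X1}) (x2 : {ffun I -> X2}) (y : {ffun I -> Y}) :=
  \prod_i Wc (x1 i) (x2 i) (y i).
Let powS (I B1 B2 : finType) (s : A1 -> T1 -> A2 -> T2 -> Y -> R)
   (a1 : {ffun I -> A1} * B1) (t1 : {ffun I -> T1}) (a2 : {ffun I -> A2} * B2)
   (t2 : {ffun I -> T2}) (y : {ffun I -> Y}) :=
  \prod_i s (a1.1 i) (t1 i) (a2.1 i) (t2 i) (y i).

Let powQ0 (I B1 B2 : finType) (Q' : B1 -> B2 -> R) (a1 : {ffun I -> A1} * B1)
  (a2 : {ffun I -> A2} * B2) : (forall b1 b2, 0 <= Q' b1 b2) -> 0 <= powQ Q' a1 a2.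
Proof. by move=> h; rewrite mulr_ge0 // prodr_ge0. Qed.

Let powQ1 (I B1 B2 : finType) (Q' : B1 -> B2 -> R) : \sum_b1 \sum_b2 Q' b1 b2 = 1 ->
  \sum_(a1 : {ffun I -> A1} * B1) \sum_a2 powQ Q' a1 a2 = 1.
Proof.
move=> h.
by rewrite (sum_power_extra (fun (_ : I) a1 a2 => Q a1 a2)) h mulr1 big1.
Qed.

Section Reject.
Variable s : A1 -> T1 -> A2 -> T2 -> Y -> R.
Hypothesis s_gt0 : forall a1 t1 a2 t2 y, 0 < Q a1 a2 -> 0 < p1 a1 t1 -> 0 < p2 a2 t2 ->
  0 < Wc (z1 t1) (z2 t2) y -> 0 < s a1 t1 a2 t2 y.
Hypothesis drift : 0 < mean (fun a1 t1 a2 t2 y => ln (s a1 t1 a2 t2 y)).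

(** The indicator of a total ratio below [c] is at most [c ^ t] times the ratio to the power [- t],
    whose mean is the [m]-th power of [theta < 1]. [M] is chosen before [B1], [B2] and [Q'], as the
    left-over messages change with the length. *)
Lemma reject_mean_vanishes (c eps : R) : 0 < c -> 0 < eps ->
  exists M : nat, forall m, (M <= m)%N -> forall (B1 B2 : finType) (Q' : B1 -> B2 -> R),
    (forall b1 b2, 0 <= Q' b1 b2) -> \sum_b1 \sum_b2 Q' b1 b2 = 1 ->
    mac_mean (powQ Q') (@powp1 'I_m B1) (@powp2 'I_m B2) (@powz1 'I_m) (@powz2 'I_m)
      (@powW 'I_m) (fun a1 t1 a2 t2 y => (~~ (c <= powS s a1 t1 a2 t2 y))%:R) <= eps.
Proof.
move=> c0 eps0.
have [t t0] := mac_mean_mgf_lt1 Q0 Q1 p10 p11 p20 p21 W0 W1 drift.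
set theta := mac_mean _ _ _ _ _ _ _ => th1.
have th0 : 0 <= theta.
  do 2! (apply: sumr_ge0 => ? _); apply: mulr_ge0 => //.
  apply: sumr_ge0 => ? _; apply: mulr_ge0 => //.
  apply: sumr_ge0 => ? _; apply: mulr_ge0 => //.
  by apply: sumr_ge0 => ? _; apply: mulr_ge0 => //; apply: expR_ge0.
pose k := expR (t * ln c).
have k0 : 0 < k by apply: expR_gt0.
have e0 : 0 < eps / k by rewrite divr_gt0.
have hth : `|theta| < 1 by rewrite ger0_norm.
have /cvgrPdist_le /(_ _ e0) [M _ hM] := cvg_expr hth.
exists M => m Mm B1 B2 Q' Q'0 Q'1.
have {hM} := hM m Mm; rewrite sub0r normrN normrX ger0_norm // ler_pdivlMr // mulrC => hM.
apply: le_trans hM.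
rewrite -[m in leRHS]card_ord.
rewrite -(mac_mean_prod 'I_m Q p1 p2 z1 z2 Wc _ Q'1) -mac_meanZ.
apply: mac_mean_le.
- by move=> a1 a2; apply: powQ0.
- by move=> a ?; apply: prodr_ge0.
- by move=> a ?; apply: prodr_ge0.
- by move=> x1 x2 y; apply: prodr_ge0.
move=> a1 t1 a2 t2 y hQ h1 h2 hW.
have hQ' : 0 < \prod_i Q (a1.1 i) (a2.1 i).
  rewrite lt_neqAle prodr_ge0 // andbT; apply/negP => /eqP h.
  by move: hQ; rewrite /powQ -h mul0r ltxx.
have sgt i : 0 < s (a1.1 i) (t1 i) (a2.1 i) (t2 i) (y i).
  apply: s_gt0.
  - by apply: (prodr_gt0_factor _ hQ').
  - by apply: (prodr_gt0_factor _ h1).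
  - by apply: (prodr_gt0_factor _ h2).
  - by move/(prodr_gt0_factor _): hW => /(_ (fun=> W0 _ _ _) i); rewrite !ffunE.
have -> : \prod_i expR (- t * ln (s (a1.1 i) (t1 i) (a2.1 i) (t2 i) (y i))) =
    expR (- t * ln (powS s a1 t1 a2 t2 y)).
  by rewrite /powS ln_prod // mulr_sumr expR_sum.
have S0 : 0 < powS s a1 t1 a2 t2 y by apply: prodr_gt0.
case: (leP c) => hc; rewrite /= ?mulr0n ?mulr1n.
  by rewrite mulr_ge0 ?expR_ge0.
rewrite -expRD -expR0 ler_expR mulNr -mulrBr mulr_ge0 ?(ltW t0) //.
by rewrite subr_ge0 ltW // ltr_ln ?posrE.
Qed.
End Reject.

Variables s1 s2 s3 : A1 -> T1 -> A2 -> T2 -> Y -> R.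
Let support_gt0 (s : A1 -> T1 -> A2 -> T2 -> Y -> R) :=
  forall a1 t1 a2 t2 y, 0 < Q a1 a2 -> 0 < p1 a1 t1 -> 0 < p2 a2 t2 ->
  0 < Wc (z1 t1) (z2 t2) y -> 0 < s a1 t1 a2 t2 y.
Hypotheses (s1_ge0 : forall a1 t1 a2 t2 y, 0 <= s1 a1 t1 a2 t2 y)
  (s2_ge0 : forall a1 t1 a2 t2 y, 0 <= s2 a1 t1 a2 t2 y)
  (s3_ge0 : forall a1 t1 a2 t2 y, 0 <= s3 a1 t1 a2 t2 y).
Hypotheses (s1_gt0 : support_gt0 s1) (s2_gt0 : support_gt0 s2) (s3_gt0 : support_gt0 s3).
Hypothesis s1_sum : forall a2 t2 y, \sum_a1 \sum_t1 p1 a1 t1 * s1 a1 t1 a2 t2 y <= 1.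
Hypothesis s2_sum : forall a1 t1 y, \sum_a2 \sum_t2 p2 a2 t2 * s2 a1 t1 a2 t2 y <= 1.
Hypothesis s3_sum : forall y,
  \sum_a1 \sum_a2 \sum_t1 \sum_t2 p1 a1 t1 * (p2 a2 t2 * s3 a1 t1 a2 t2 y) <= 1.
Hypotheses (drift1 : 0 < mean (fun a1 t1 a2 t2 y => ln (s1 a1 t1 a2 t2 y)))
  (drift2 : 0 < mean (fun a1 t1 a2 t2 y => ln (s2 a1 t1 a2 t2 y)))
  (drift3 : 0 < mean (fun a1 t1 a2 t2 y => ln (s3 a1 t1 a2 t2 y))).

Let markov_ind (c x : R) (b : bool) : 0 < c -> 0 <= x -> (b -> c <= x) -> b%:R <= x / c.
Proof.
move=> c0 x0; case: b => [/(_ isT) h|_]; last by rewrite mulr0n divr_ge0 // ltW.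
by rewrite mulr1n ler_pdivlMr // mul1r.
Qed.

(** Positive drift brings the true pair above any fixed threshold, while Markov's inequality bounds
    the wrong pairs by the number of extra messages divided by [c]; at most [C] of these therefore
    need only a constant [c]. *)
Lemma superletter_coding (C : nat) (eps : R) : 0 < eps ->
  exists M : nat, forall m, (M <= m)%N -> forall (B1 B2 : finType) (Q' : B1 -> B2 -> R),
    (forall b1 b2, 0 <= Q' b1 b2) -> \sum_b1 \sum_b2 Q' b1 b2 = 1 ->
    (#|B1| <= C)%N -> (#|B2| <= C)%N -> (#|B1| * #|B2| <= C)%N ->
    achievable (fun (a1 : {ffun 'I_m -> A1} * B1) (a2 : {ffun 'I_m -> A2} * B2) =>
                  (\prod_i Q (a1.1 i) (a2.1 i)) * Q' a1.2 a2.2)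
      (fun (x1 : {ffun 'I_m -> X1}) (x2 : {ffun 'I_m -> X2}) (y : {ffun 'I_m -> Y}) =>
         \prod_i Wc (x1 i) (x2 i) (y i)) eps.
Proof.
move=> eps0.
(* Half of [eps] goes to the three wrong-pair terms, [C / c <= eps / 6] each, and half to the three
   rejection terms. *)
pose c : R := 6 * C.+1%:R / eps.
have c0 : 0 < c by rewrite divr_gt0 // mulr_gt0.
have e0 : 0 < eps / 6 by rewrite divr_gt0.
have [M1 h1] := reject_mean_vanishes s1_gt0 drift1 c0 e0.
have [M2 h2] := reject_mean_vanishes s2_gt0 drift2 c0 e0.
have [M3 h3] := reject_mean_vanishes s3_gt0 drift3 c0 e0.
exists (maxn M1 (maxn M2 M3)) => m; rewrite !geq_max => /and3P[m1 m2 m3].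
move=> B1 B2 Q' Q'0 Q'1 cB1 cB2 cB12.
pose I := 'I_m : finType.
pose acc a1 t1 a2 t2 y := [&& c <= @powS I B1 B2 s1 a1 t1 a2 t2 y,
  c <= @powS I B1 B2 s2 a1 t1 a2 t2 y & c <= @powS I B1 B2 s3 a1 t1 a2 t2 y].
have c_ge (n : nat) : (n <= C)%N -> n%:R / c <= eps / 6.
  move=> nC; rewrite ler_pdivrMr // /c.
  have -> : eps / 6 * (6 * C.+1%:R / eps) = C.+1%:R by field; lra.
  by rewrite ler_nat ltnW // ltnS.
have sumB (B : finType) : \sum_(b : B) 1 = #|B|%:R :> R by rewrite sumr_const.
eapply achievable_le; [eapply (@one_shot R _ _ _ _ _ _ _ (powQ Q') (@powp1 I B1) (@powp2 I B2)
  (@powz1 I) (@powz2 I) (@powW I) acc (eps / 6))|].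
- by move=> a1 a2; apply: powQ0.
- exact: powQ1.
- by move=> a ?; apply: prodr_ge0.
- by move=> a; rewrite /powp1 (sum_prod_ffun (fun i t => p1 (a.1 i) t)) big1.
- by move=> a ?; apply: prodr_ge0.
- by move=> a; rewrite /powp2 (sum_prod_ffun (fun i t => p2 (a.1 i) t)) big1.
- by move=> x1 x2 y; apply: prodr_ge0.
- by move=> x1 x2; rewrite /powW (sum_prod_ffun (fun i t => Wc (x1 i) (x2 i) t)) big1.
- move=> a2 t2 y; apply: le_trans (c_ge _ cB1).
  rewrite -sumB mulr_suml.
  apply: (@le_trans _ _ (\sum_(a1 : {ffun I -> A1} * B1) \sum_t1
      powp1 a1 t1 * (powS s1 a1 t1 a2 t2 y / c))).
    apply: ler_sum => a1 _; apply: ler_sum => t1 _; apply: ler_wpM2l; first exact: prodr_ge0.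
    by apply: markov_ind => // [|/and3P[]//]; apply: prodr_ge0.
  (* For each value of the extra message the remaining sum factorises over the blocks, and [s1_sum]
     bounds every factor by 1. *)
  rewrite -(pair_bigA _ (fun a1 b1 => \sum_(t1 : {ffun I -> T1})
     powp1 (a1, b1) t1 * (powS s1 (a1, b1) t1 a2 t2 y / c))) /= exchange_big /=.
  apply: ler_sum => b1 _.
  rewrite (eq_bigr (fun a1 : {ffun I -> A1} => (\prod_i \sum_t1 p1 (a1 i) t1 *
    s1 (a1 i) t1 (a2.1 i) (t2 i) (y i)) * c^-1)); last first.
    move=> a1 _; rewrite -sum_prod_ffunM mulr_suml.
    by apply: eq_bigr => t1 _; rewrite mulrA.
  rewrite -mulr_suml (sum_prod_ffun (fun i a1 => \sum_t1 p1 a1 t1 *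
    s1 a1 t1 (a2.1 i) (t2 i) (y i))).
  rewrite ler_wpM2r ?invr_ge0 ?(ltW c0) //; apply: prodr_ile1 => i _.
  by rewrite s1_sum andbT; apply: sumr_ge0 => ? _; apply: sumr_ge0 => ? _; rewrite mulr_ge0.
- move=> a1 t1 y; apply: le_trans (c_ge _ cB2).
  rewrite -sumB mulr_suml.
  apply: (@le_trans _ _ (\sum_(a2 : {ffun I -> A2} * B2) \sum_t2
      powp2 a2 t2 * (powS s2 a1 t1 a2 t2 y / c))).
    apply: ler_sum => a2 _; apply: ler_sum => t2 _; apply: ler_wpM2l; first exact: prodr_ge0.
    by apply: markov_ind => // [|/and3P[]//]; apply: prodr_ge0.
  rewrite -(pair_bigA _ (fun a2 b2 => \sum_(t2 : {ffun I -> T2})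
     powp2 (a2, b2) t2 * (powS s2 a1 t1 (a2, b2) t2 y / c))) /= exchange_big /=.
  apply: ler_sum => b2 _.
  rewrite (eq_bigr (fun a2 : {ffun I -> A2} => (\prod_i \sum_t2 p2 (a2 i) t2 *
    s2 (a1.1 i) (t1 i) (a2 i) t2 (y i)) * c^-1)); last first.
    move=> a2 _; rewrite -sum_prod_ffunM mulr_suml.
    by apply: eq_bigr => t2 _; rewrite mulrA.
  rewrite -mulr_suml (sum_prod_ffun (fun i a2 => \sum_t2 p2 a2 t2 *
    s2 (a1.1 i) (t1 i) a2 t2 (y i))).
  rewrite ler_wpM2r ?invr_ge0 ?(ltW c0) //; apply: prodr_ile1 => i _.
  by rewrite s2_sum andbT; apply: sumr_ge0 => ? _; apply: sumr_ge0 => ? _; rewrite mulr_ge0.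
- move=> y; apply: le_trans (c_ge _ cB12).
  apply: (@le_trans _ _ (\sum_(a1 : {ffun I -> A1} * B1) \sum_(a2 : {ffun I -> A2} * B2)
      \sum_t1 \sum_t2 powp1 a1 t1 * (powp2 a2 t2 * (powS s3 a1 t1 a2 t2 y / c)))).
    apply: ler_sum => a1 _; apply: ler_sum => a2 _; apply: ler_sum => t1 _.
    apply: ler_sum => t2 _; apply: ler_wpM2l; first exact: prodr_ge0.
    apply: ler_wpM2l; first exact: prodr_ge0.
    by apply: markov_ind => // [|/and3P[]//]; apply: prodr_ge0.
  pose G i a1 a2 := \sum_t1 p1 a1 t1 * \sum_t2 p2 a2 t2 * s3 a1 t1 a2 t2 (y i).
  rewrite (eq_bigr (fun a1 : {ffun I -> A1} * B1 => \sum_(a2 : {ffun I -> A2} * B2)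
    (\prod_i G i (a1.1 i) (a2.1 i)) * c^-1)); last first.
    move=> a1 _; apply: eq_bigr => a2 _; rewrite /G.
    rewrite -(sum_prod_ffunM (fun i t => p1 (a1.1 i) t) (fun i t1 => \sum_t2 p2 (a2.1 i) t2 *
       s3 (a1.1 i) t1 (a2.1 i) t2 (y i))) mulr_suml; apply: eq_bigr => t1 _.
    rewrite -(sum_prod_ffunM (fun i t => p2 (a2.1 i) t) (fun i t2 =>
       s3 (a1.1 i) (t1 i) (a2.1 i) t2 (y i))) -mulrA -mulr_sumr; congr (_ * _).
    by rewrite mulr_suml; apply: eq_bigr => t2 _; rewrite mulrA.
  rewrite (sum_power_extra G (fun (_ : B1) (_ : B2) => c^-1)).
  have -> : \sum_(b1 : B1) \sum_(b2 : B2) c^-1 = (#|B1| * #|B2|)%:R / c.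
    by under eq_bigr do rewrite sumr_const; rewrite sumr_const -mulrnA mulnC mulr_natl.
  rewrite -[leRHS]mul1r; apply: ler_wpM2r;
    first by rewrite divr_ge0 // (ltW c0). apply: prodr_ile1 => i _.
  apply/andP; split.
    by do 2! (apply: sumr_ge0 => ? _); do 2! (apply: sumr_ge0 => ? _; apply: mulr_ge0 => //).
  apply: le_trans (s3_sum (y i)); apply: ler_sum => a1 _; apply: ler_sum => a2 _.
  apply: ler_sum => t1 _.
  by rewrite mulr_sumr.
-   rewrite -[X in X + _]/(mac_mean (powQ Q') (@powp1 I B1) (@powp2 I B2) (@powz1 I) (@powz2 I)
    (@powW I) (fun a1 t1 a2 t2 y => (~~ acc a1 t1 a2 t2 y)%:R)).
  have eqe : (eps / 6 + (eps / 6 + eps / 6)) + 3 * (eps / 6) = eps by field.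
  rewrite -[leRHS]eqe.
  rewrite lerD2r.
  apply: le_trans (lerD (h1 m m1 B1 B2 Q' Q'0 Q'1)
    (lerD (h2 m m2 B1 B2 Q' Q'0 Q'1) (h3 m m3 B1 B2 Q' Q'0 Q'1))).
  rewrite -!mac_meanD; apply: mac_mean_le.
  + by move=> a1 a2; apply: powQ0.
  + by move=> a ?; apply: prodr_ge0.
  + by move=> a ?; apply: prodr_ge0.
  + by move=> x1 x2 y; apply: prodr_ge0.
  move=> a1 t1 a2 t2 y _ _ _ _; rewrite -!natrD ler_nat /acc.
  by case: (c <= _); case: (c <= _); case: (c <= _).
Qed.

End Superletter.

(** * Maximum-score decoding *)

Section MaxScore.
Variables (R : realType) (M T Y : finType) (w : M -> R) (q : T -> R).
Variables (W : T -> Y -> R) (score : T -> Y -> R).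
Hypotheses (w0 : forall m, 0 <= w m) (w1 : \sum_m w m <= 1).
Hypotheses (q0 : forall t, 0 <= q t) (q1 : \sum_t q t = 1) (W0 : forall t y, 0 <= W t y).

(** Union bound over the competitors whose score reaches that of the true codeword, ties included.
    The cap at 1 stays inside the expectation, because it becomes the positive part in the error
    exponent. *)
Lemma max_score_code (m0 : M) :
  exists (c : M -> T) (d : Y -> M), (forall m, 0 < q (c m)) /\
    \sum_m w m * \sum_(y | d y != m) W (c m) y <=
    \sum_t q t * \sum_y W t y *
      Num.min 1 ((#|M|.-1)%:R * \sum_t' q t' * (score t y <= score t' y)%R%:R).
Proof.
pose d (c : {ffun M -> T}) y := [arg max_(m > m0) score (c m) y]%O.
pose p (_ : M) := q.
have p0 m t : 0 <= p m t by apply: q0.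
have p1 m : \sum_t p m t = 1 by apply: q1.
pose pi t y := \sum_t' q t' * (score t y <= score t' y)%R%:R.
have pi0 t y : 0 <= pi t y by apply: sumr_ge0 => t' _; rewrite mulr_ge0.
pose err (c : {ffun M -> T}) := \sum_m w m * \sum_(y | d c y != m) W (c m) y.
pose rhs := \sum_t q t * \sum_y W t y * Num.min 1 ((#|M|.-1)%:R * pi t y).
suff H : codebook_mean p err <= rhs.
  have [c c0 hc] := exists_le_mean (codebook_weight_ge0 p0) (codebook_weight_sum p1) H.
  exists c, (d c); split => // m.
  by apply: (prodr_gt0_factor _ c0).
have point m t y : codebook_mean p (fun c => (c m == t)%:R * (d c y != m)%:R) <=
    q t * Num.min 1 ((#|M|.-1)%:R * pi t y).
  (* Where the cap is active the decoding event is dropped and only the law of the true codeword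
     remains. *)
  rewrite /Num.min; case: ifP => _.
    rewrite mulr1; apply: (@le_trans _ _ (codebook_mean p (fun c => (c m == t)%:R))).
      apply: codebook_mean_le => // c; rewrite -[leRHS]mulr1 ler_wpM2l //.
      by case: (_ != _).
    rewrite (codebook_mean1 p1 m (fun s => (s == t)%:R)) (bigD1 t) //= eqxx mulr1.
    by rewrite big1 ?addr0 // => s /negbTE ->; rewrite mulr0.
  apply: (@le_trans _ _ (codebook_mean p (fun c => \sum_(m' | m' != m)
      (c m == t)%:R * (score t y <= score (c m') y)%R%:R))).
    apply: codebook_mean_le => // c; rewrite -mulr_sumr.
    case: eqP => [ct|_]; last by rewrite !mul0r.
    rewrite !mul1r; have [hd|_] := boolP (d c y != m); last first.
      by apply: sumr_ge0 => *.
    rewrite (bigD1 (d c y)) //=.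
    have -> : score t y <= score (c (d c y)) y.
      rewrite -ct /d; case: arg_maxP => //= m' _ hm'; exact: hm'.
    by rewrite lerDl; apply: sumr_ge0.
  rewrite codebook_mean_sum (eq_bigr (fun _ => q t * pi t y)).
    by rewrite sumr_const cardC1 -[leLHS]mulr_natl mulrCA.
  move=> m' hm.
  rewrite (codebook_mean2 p1 (fun s s' => (s == t)%:R * (score t y <= score s' y)%R%:R) hm).
  rewrite (bigD1 t) //= eqxx [X in _ + X]big1 ?addr0.
    by congr (_ * _); apply: eq_bigr => s _; rewrite mul1r.
  by move=> s /negbTE ->; rewrite big1 ?mulr0 // => s' _; rewrite mul0r mulr0.
have rhs0 : 0 <= rhs.
  apply: sumr_ge0 => t _; apply: mulr_ge0 => //; apply: sumr_ge0 => y _; apply: mulr_ge0 => //.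
  by rewrite le_min ler01 mulr_ge0.
apply: (@le_trans _ _ (\sum_m w m * rhs)); last by rewrite -mulr_suml ler_piMl.
rewrite codebook_mean_sum; apply: ler_sum => m _.
rewrite codebook_meanZ; apply: ler_wpM2l => //.
rewrite (_ : codebook_mean _ _ = \sum_t \sum_y W t y *
    codebook_mean p (fun c => (c m == t)%:R * (d c y != m)%:R)).
  apply: ler_sum => t _; rewrite mulr_sumr; apply: ler_sum => y _.
  by rewrite mulrCA; apply: ler_wpM2l.
transitivity (codebook_mean p (fun c => \sum_t \sum_y W t y *
    ((c m == t)%:R * (d c y != m)%:R))).
  congr codebook_mean; apply/funext => c.
  rewrite [RHS](bigD1 (c m)) //= eqxx [X in _ + X]big1 ?addr0.
    by rewrite big_mkcond; apply: eq_bigr => y _; rewrite mul1r; case: (_ != _);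
       rewrite ?mulr1 ?mulr0.
  by move=> t /negbTE; rewrite eq_sym => ->; rewrite big1 // => y _; rewrite mul0r mulr0.
rewrite codebook_mean_sum; apply: eq_bigr => t _; rewrite codebook_mean_sum.
by apply: eq_bigr => y _; rewrite codebook_meanZ.
Qed.

End MaxScore.

(** * Types *)

Section Occurrences.
Variables (l : nat) (T : finType).
Implicit Types s : {ffun 'I_l -> T}.

Definition occ s t : nat := #|[pred i | s i == t]|.

Lemma prod_occ (R : comPzSemiRingType) (F : T -> R) s :
  \prod_i F (s i) = \prod_t F t ^+ occ s t.
Proof.
rewrite (partition_big (fun i => s i) predT) //=; apply: eq_bigr => t _.
by rewrite (eq_bigr (fun=> F t)) ?prodr_const // => i /eqP ->.
Qed.

Lemma sum_occ (R : nmodType) (F : T -> R) s :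
  \sum_i F (s i) = \sum_t F t *+ occ s t.
Proof.
rewrite (partition_big (fun i => s i) predT) //=; apply: eq_bigr => t _.
by rewrite (eq_bigr (fun=> F t)) ?sumr_const // => i /eqP ->.
Qed.

Lemma occ_total s : (\sum_t occ s t = l)%N.
Proof.
rewrite -[RHS](card_ord l) -sum1_card (partition_big s predT) //=.
by apply: eq_bigr => t _; rewrite sum1_card.
Qed.

Lemma occ_le s t : (occ s t < l.+1)%N.
Proof. by rewrite ltnS -[X in (_ <= X)%N]card_ord max_card. Qed.

Lemma occ_gt0 s i : (0 < occ s (s i))%N.
Proof. by apply/card_gt0P; exists i; rewrite inE. Qed.

Lemma occ_count s t : occ s t = count_mem t (codom s).
Proof.
rewrite codomE count_map /occ cardE size_filter -enumT; apply: eq_count => i.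
by rewrite /= inE.
Qed.

End Occurrences.

(** Multinomial coefficient, by induction on the length: a permutation is a first letter followed by
    a permutation of the rest, and the multiplicities of the distinct letters add up to the
    length. *)
Lemma size_permutations_prod (T : finType) (s : seq T) :
  (size (permutations s) * \prod_(t : T) (count_mem t s)`! = (size s)`!)%N.
Proof.
move: {2}(size s) (erefl (size s)) => n; elim: n s => [|n IH] s hs.
  by move/size0nil: (hs) => ->; rewrite big1 // muln1.
rewrite (perm_size (permutationsE _)) ?hs // size_allpairs_dep sumnE big_map big_distrl /=.
rewrite (eq_big_seq (fun x => count_mem x s * n`!)%N); last first.
  move=> x; rewrite mem_undup => xs.
  have sx : size (rem x s) = n by rewrite size_rem // hs.
  rewrite -[X in (_ = _ * X`!)%N]sx -IH // mulnCA; congr (_ * _)%N.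
  have cx : count_mem x s = (count_mem x (rem x s)).+1.
    by rewrite (permP (perm_to_rem xs)) /= eqxx.
  rewrite [LHS](bigD1 x) //= [in RHS](bigD1 x) //= cx factS -mulnA; congr (_ * (_ * _))%N.
  apply: eq_bigr => t tx; congr (_`!)%N.
  by rewrite (permP (perm_to_rem xs)) /= eq_sym (negbTE tx).
rewrite -big_distrl /= factS -hs; congr (_ * _)%N.
rewrite -sum1_size -[RHS]big_undup_iterop_count; apply: eq_bigr => i _.
by rewrite Monoid.iteropE iter_addn_0 mul1n.
Qed.

(** * Sizes of type classes *)

Section TypeClass.
Variables (l : nat) (T : finType).
Implicit Types s : {ffun 'I_l -> T}.

Definition type_class s : {set {ffun 'I_l -> T}} :=
  [set s' | [forall t, occ s' t == occ s t]].

Lemma type_classP s s' : reflect (occ s' =1 occ s) (s' \in type_class s).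
Proof. by rewrite inE; apply: (iffP forallP) => h t; apply/eqP. Qed.

Lemma card_type_class s : (#|type_class s| * \prod_t (occ s t)`! = l`!)%N.
Proof.
have <- : size (permutations (codom s)) = #|type_class s|.
  rewrite cardE -(size_map (fun s' : {ffun 'I_l -> T} => codom s')).
  apply/perm_size/uniq_perm; first exact: permutations_uniq.
    rewrite map_inj_uniq ?enum_uniq // => s1 s2; rewrite !codomE => /eq_in_map h.
    by apply/ffunP => i; apply: h; rewrite mem_enum.
  move=> r; rewrite mem_permutations; apply/idP/mapP => [hp|[s' + ->]].
    have sz : size r = l by rewrite (perm_size hp) size_codom card_ord.
    pose t := Tuple (introT eqP sz); pose s' := [ffun i => tnth t i].
    have hr : codom s' = r.
      rewrite codomE -[RHS]/(tval t) -[RHS]map_tnth_enum.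
      by apply: eq_map => i; rewrite ffunE.
    exists s'; last by rewrite hr.
    rewrite mem_enum; apply/type_classP => x.
    by rewrite !occ_count hr; apply/permP.
  rewrite mem_enum => /type_classP h; rewrite /perm_eq; apply/allP => t _ /=.
  by rewrite -!occ_count h.
under eq_bigr do rewrite occ_count.
by rewrite size_permutations_prod size_codom card_ord.
Qed.

(** As a function of [n], the ratio [m ^ n / n!] peaks at [n = m]. *)
Lemma fact_mode (m n : nat) : (m`! * m ^ n <= n`! * m ^ m)%N.
Proof.
have [mn|nm] := leqP m n.
  elim: n mn => [|n IH]; first by rewrite leqn0 => /eqP ->.
  rewrite leq_eqVlt => /orP[/eqP <- //|]; rewrite ltnS => mn.
  rewrite expnS factS mulnCA -mulnA leq_mul //; first exact: leqW.
  exact: IH.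
have {nm} [d ->] : exists d, m = (n + d)%N by exists (m - n)%N; rewrite subnKC // ltnW.
rewrite [in leqRHS]expnD [leqRHS]mulnCA [leqRHS]mulnC leq_mul //.
elim: d => [|d IH]; first by rewrite addn0 expn0 muln1.
rewrite addnS factS expnS [leqRHS]mulnCA leq_mul //; apply: leq_trans IH _.
by rewrite leq_mul //; case: (d) => // k; rewrite leq_exp2r.
Qed.

(** Under the i.i.d. law with the type of [s], the class of [s] is the most likely one; letter by
    letter this is [fact_mode]. Denominators [l ^ l] are cleared to stay in the natural numbers. *)
Lemma type_class_mode s s' :
  (#|type_class s'| * \prod_t occ s t ^ occ s' t <=
   #|type_class s| * \prod_t occ s t ^ occ s t)%N.
Proof.
have f0 : (0 < \prod_t (occ s' t)`!)%N by apply: prodn_gt0 => t; apply: fact_gt0.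
rewrite -(leq_pmul2r f0) mulnAC card_type_class -(card_type_class s) -!mulnA leq_mul2l.
apply/orP; right; rewrite -!big_split /=.
by apply: leq_prod => t _; rewrite [leqRHS]mulnC fact_mode.
Qed.

(** [l ^ l] is the total mass of the unnormalised i.i.d. law. At most [(l + 1) ^ #|T|] types share
    it, and none has more than the type of [s]. *)
Lemma type_class_lower_bound s :
  (l ^ l <= l.+1 ^ #|T| * (#|type_class s| * \prod_t occ s t ^ occ s t))%N.
Proof.
have -> : (l ^ l = \sum_(s' : {ffun 'I_l -> T}) \prod_t occ s t ^ occ s' t)%N.
  rewrite -{1}(occ_total s) -[X in (_ ^ X)%N]card_ord -prod_nat_const bigA_distr_bigA.
  apply: eq_bigr => s' _; exact: (prod_occ (R := nat) (fun t => occ s t) s').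
pose ty s' : {ffun T -> 'I_l.+1} := [ffun t => Ordinal (occ_le s' t)].
rewrite (partition_big ty predT) //=.
have -> : (l.+1 ^ #|T| = #|{ffun T -> 'I_l.+1}|)%N by rewrite card_ffun card_ord.
rewrite -sum_nat_const; apply: leq_sum => k _.
case: (pickP [pred s' | ty s' == k]) => [s0 /eqP h0|h]; last by rewrite big_pred0.
apply: leq_trans (type_class_mode s s0).
have hk s' : ty s' = k -> occ s' =1 occ s0.
  by move=> h t; have := congr1 (fun f : {ffun T -> 'I_l.+1} => val (f t)) (etrans h (esym h0));
     rewrite /= !ffunE.
rewrite (eq_bigr (fun=> \prod_t occ s t ^ occ s0 t)%N); last first.
  by move=> s' /eqP /hk h; apply: eq_bigr => t _; rewrite h.
rewrite sum_nat_const leq_mul2r; apply/orP; right; apply: subset_leq_card.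
by apply/fintype.subsetP => s' hs; apply/type_classP => t; apply: hk; apply/eqP.
Qed.

End TypeClass.

Section SelfLikelihood.
Variables (R : realType) (l : nat) (A B : finType).
Implicit Types (a : {ffun 'I_l -> A}) (b : {ffun 'I_l -> B}).

Definition jocc a b x y : nat := #|[pred i | (a i == x) && (b i == y)]|.

Lemma jocc_le a b x y : (jocc a b x y < l.+1)%N.
Proof. by rewrite ltnS -[X in (_ <= X)%N]card_ord max_card. Qed.

Lemma jocc_gt0 a b i : (0 < jocc a b (a i) (b i))%N.
Proof. by apply/card_gt0P; exists i; rewrite inE !eqxx. Qed.

Lemma jocc_suml a b y : (\sum_x jocc a b x y = occ b y)%N.
Proof.
rewrite /occ -sum1_card (partition_big a predT) //=; apply: eq_bigr => x _.
by rewrite sum1_card; apply: eq_card => i; rewrite !inE andbC.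
Qed.

Lemma jocc_sumr a b x : (\sum_y jocc a b x y = occ a x)%N.
Proof.
rewrite /occ -sum1_card (partition_big b predT) //=; apply: eq_bigr => y _.
by rewrite sum1_card; apply: eq_card => i; rewrite !inE.
Qed.

(* Each sequence is weighted by its probability under its own empirical conditional law, so every
   joint type contributes at most 1. *)
Lemma self_likelihood b :
  \sum_a \prod_i ((jocc a b (a i) (b i))%:R / (occ b (b i))%:R) <=
  l.+1%:R ^+ (#|A| * #|B|) :> R.
Proof.
pose ty a : {ffun A * B -> 'I_l.+1} := [ffun z => Ordinal (jocc_le a b z.1 z.2)].
rewrite (partition_big ty predT) //=.
have -> : l.+1%:R ^+ (#|A| * #|B|) = \sum_(k : {ffun A * B -> 'I_l.+1}) 1 :> R.
  by rewrite sumr_const card_ffun card_prod card_ord natrX.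
apply: ler_sum => k _.
pose S y : R := \sum_x (k (x, y))%:R.
have S0 y : 0 <= S y by apply: sumr_ge0.
apply: (@le_trans _ _ (\sum_(a : {ffun 'I_l -> A}) \prod_(i < l) ((k (a i, b i))%:R / S (b i)))).
  rewrite big_mkcond /=; apply: ler_sum => a _; case: eqP => [hk|_]; last first.
    by apply: prodr_ge0 => i _; rewrite divr_ge0.
  have hj x y : jocc a b x y = k (x, y) by rewrite -hk ffunE.
  rewrite le_eqVlt; apply/orP; left; apply/eqP; apply: eq_bigr => i _.
  rewrite hj -(jocc_suml a b) natr_sum; congr (_ / _).
  by apply: eq_bigr => x _; rewrite hj.
rewrite (sum_prod_ffun (fun i x => (k (x, b i))%:R / S (b i))).
apply: prodr_ile1 => i _; rewrite -mulr_suml mulr_ge0 ?invr_ge0 ?sumr_ge0 //=.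
have := S0 (b i); rewrite le_eqVlt => /orP[/eqP h|h].
  by rewrite -/(S (b i)) -h mul0r.
by rewrite divff // gt_eqF.
Qed.

End SelfLikelihood.

(** * Entropies as averages *)

Section Entropy.
Variable R : realType.

Lemma xlnxE (x : R) : xlnx x = x * ln x.
Proof. by rewrite /xlnx; case: eqP => // ->; rewrite mul0r. Qed.

Section Conditional.
Variables (O T T' : finType) (P : {ffun O -> R}) (X : O -> T) (Z : O -> T').
Hypothesis P0 : forall w, 0 <= P w.

Lemma dist_ge0 t : 0 <= dist P X t.
Proof. by rewrite ffunE sumr_ge0. Qed.

Lemma dist_ge w : P w <= dist P X (X w).
Proof. by rewrite ffunE (bigD1 w) //= lerDl sumr_ge0. Qed.

Lemma sum_dist (F : T -> R) : \sum_t dist P X t * F t = \sum_w P w * F (X w).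
Proof.
rewrite [RHS](partition_big X predT) //=; apply: eq_bigr => t _.
by rewrite ffunE mulr_suml; apply: eq_bigr => w /eqP ->.
Qed.

Lemma EntE : Ent P X = - \sum_w P w * ln (dist P X (X w)).
Proof.
rewrite /Ent /entropy -(sum_dist (fun t => ln (dist P X t))).
by congr (- _); apply: eq_bigr => t _; rewrite xlnxE.
Qed.

End Conditional.

(** When the conditioning event has probability 0 the quotient is 0, so these kernels are only
    subnormalised; superletter coding asks for no more. *)
Definition cprob (O T T' : finType) (P : {ffun O -> R}) (X : O -> T) (Z : O -> T') x z : R :=
  dist P (fun w => (X w, Z w)) (x, z) / dist P Z z.

Section Cprob.
Variables (O T T' : finType) (P : {ffun O -> R}) (X : O -> T) (Z : O -> T').
Hypothesis P0 : forall w, 0 <= P w.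

Lemma cprob_ge0 x z : 0 <= cprob P X Z x z.
Proof. by rewrite divr_ge0 // dist_ge0. Qed.

Lemma sum_joint_dist z : \sum_x dist P (fun w => (X w, Z w)) (x, z) = dist P Z z.
Proof.
rewrite [RHS]ffunE (partition_big X predT) //=; apply: eq_bigr => x _.
by rewrite ffunE; apply: eq_bigl => w; rewrite xpair_eqE andbC.
Qed.

Lemma cprob_sum_le1 z : \sum_x cprob P X Z x z <= 1.
Proof.
rewrite -mulr_suml sum_joint_dist.
have [->|h] := eqVneq (dist P Z z) 0; first by rewrite mul0r.
by rewrite divff.
Qed.

Lemma cprob_le1 x z : cprob P X Z x z <= 1.
Proof.
apply: le_trans (cprob_sum_le1 z); rewrite (bigD1 x) //= lerDl.
by apply: sumr_ge0 => *; apply: cprob_ge0.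
Qed.

Lemma cprob_gt0 w : 0 < P w -> 0 < cprob P X Z (X w) (Z w).
Proof.
move=> h; rewrite divr_gt0 //; apply: lt_le_trans h _; last exact: dist_ge.
exact: (dist_ge (fun w => (X w, Z w))).
Qed.

(** The mean of a log-kernel is the form in which the source and channel entropies enter the drift
    of the outer code. *)
Lemma condEntE : condEnt P X Z = \sum_w P w * - ln (cprob P X Z (X w) (Z w)).
Proof.
rewrite /condEnt !EntE // opprK addrC -sumrB; apply: eq_bigr => w _.
rewrite -mulrBr; have := P0 w; rewrite le_eqVlt => /orP[/eqP <-|h]; first by rewrite !mul0r.
congr (_ * _); rewrite ln_div ?opprB // posrE.
  exact: lt_le_trans h (dist_ge (fun w => (X w, Z w)) P0 w).
exact: lt_le_trans h (dist_ge Z P0 w).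
Qed.

End Cprob.
End Entropy.

(** * The inner constant-composition code *)

Lemma exists_occ (l : nat) (T : finType) (m : T -> nat) :
  (\sum_t m t = l)%N -> exists s : {ffun 'I_l -> T}, occ s =1 m.
Proof.
move=> ml; pose r := flatten [seq nseq (m t) t | t <- enum T].
have sz : size r == l.
  rewrite size_flatten /shape -map_comp sumnE big_map -ml big_enum /=; apply/eqP.
  by apply: eq_bigr => t _ /=; rewrite size_nseq.
exists [ffun i => tnth (Tuple sz) i] => t; rewrite occ_count codomE.
rewrite (eq_map (g := tnth (Tuple sz))); last by move=> i; rewrite ffunE.
rewrite map_tnth_enum /= count_flatten -map_comp sumnE big_map big_enum /=.
rewrite (bigD1 t) //= count_nseq /= eqxx mul1n big1 ?addn0 // => x /negbTE.
by rewrite count_nseq /= => ->.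
Qed.

Section InnerCode.
Variables (R : realType) (l : nat) (U Y : finType).
Implicit Types (u : {ffun 'I_l -> U}) (y : {ffun 'I_l -> Y}).

Lemma sum_jocc (F : U -> Y -> R) u y :
  \sum_i F (u i) (y i) = \sum_a \sum_b (jocc u y a b)%:R * F a b.
Proof.
rewrite (partition_big u predT) //=; apply: eq_bigr => a _.
rewrite (partition_big y predT) //=; apply: eq_bigr => b _.
rewrite (eq_bigr (fun=> F a b)); last by move=> i /andP[/eqP -> /eqP ->].
by rewrite sumr_const mulr_natl.
Qed.

(* [l] times the mutual information of the joint type of [u] and [y] *)
Definition score u y : R :=
  \sum_i ln ((jocc u y (u i) (y i))%:R * l%:R / ((occ u (u i))%:R * (occ y (y i))%:R)).

Lemma expR_score u y : expR (score u y) =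
  \prod_i ((jocc u y (u i) (y i))%:R * l%:R / ((occ u (u i))%:R * (occ y (y i))%:R)).
Proof.
rewrite expR_sum; apply: eq_bigr => i _; rewrite lnK // posrE.
have l0 : (0 < l)%N by apply: leq_ltn_trans (ltn_ord i).
by rewrite divr_gt0 // mulr_gt0 // ltr0n ?occ_gt0 ?jocc_gt0.
Qed.

Definition uniform_on (C : {set {ffun 'I_l -> U}}) u : R := (u \in C)%:R / #|C|%:R.

(** Passing from a uniform draw in the class to i.i.d. letters of the same type costs only the
    polynomial of [type_class_lower_bound]; a product law is what the change of measure in
    [score_tail] needs. *)
Lemma uniform_type_class_le u0 u : u \in type_class u0 ->
  uniform_on (type_class u0) u <=
  l.+1%:R ^+ #|U| * \prod_i ((occ u (u i))%:R / l%:R).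
Proof.
move=> hu; have /type_classP ho := hu.
rewrite /uniform_on hu mul1r.
have C0 : 0 < #|type_class u0|%:R :> R by rewrite ltr0n; apply/card_gt0P; exists u.
have l0 : (0 < l ^ l)%N by rewrite expn_gt0; case: (l).
rewrite big_split /= prodr_const card_ord exprVn (prod_occ (fun t => (occ u t)%:R) u).
rewrite (eq_bigr (fun t => (occ u t ^ occ u t)%:R)); last by move=> t _; rewrite natrX.
rewrite -natr_prod -!natrX mulrA ler_pdivlMr ?ltr0n // mulrC ler_pdivrMr //.
rewrite -!natrM ler_nat -mulnA [X in (_ <= _ * X)%N]mulnC.
have := type_class_lower_bound u0.
by under eq_bigr do rewrite -!ho.
Qed.

(** Change of measure: the i.i.d. weight of [u] is [expR (- score u y)] times its weight under its
    own empirical conditional law given [y], and these latter weights sum to a polynomial by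
    [self_likelihood]. *)
Lemma score_tail u0 y theta :
  \sum_u uniform_on (type_class u0) u * (theta <= score u y)%R%:R <=
  l.+1%:R ^+ (#|U| + #|U| * #|Y|) * expR (- theta).
Proof.
rewrite exprD [leRHS]mulrAC.
apply: le_trans (ler_wpM2l _ (self_likelihood R U y)); last first.
  by rewrite mulr_ge0 ?expR_ge0 ?exprn_ge0.
rewrite mulr_sumr; apply: ler_sum => u _.
have V0 : 0 <= \prod_i ((jocc u y (u i) (y i))%:R / (occ y (y i))%:R) :> R.
  by apply: prodr_ge0 => i _; rewrite divr_ge0.
have [hu|hu] := boolP (u \in type_class u0); last first.
  by rewrite /uniform_on (negbTE hu) !mul0r !mulr_ge0 ?expR_ge0 ?exprn_ge0.
have [hs|_] := leP theta (score u y); last first.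
  by rewrite mulr0 !mulr_ge0 ?expR_ge0 ?exprn_ge0.
rewrite mulr1; apply: le_trans (uniform_type_class_le hu) _.
rewrite -mulrA ler_wpM2l ?exprn_ge0 //.
apply: (@le_trans _ _ (expR (- score u y) *
    \prod_i ((jocc u y (u i) (y i))%:R / (occ y (y i))%:R))); last first.
  by rewrite ler_wpM2r // ler_expR lerN2.
rewrite expRN mulrC ler_pdivlMr ?expR_gt0 // expR_score -big_split /=.
rewrite le_eqVlt; apply/orP; left; apply/eqP; apply: eq_bigr => i _.
have l0 : l%:R != 0 :> R by rewrite pnatr_eq0 -lt0n; apply: leq_ltn_trans (ltn_ord i).
have o1 : (occ u (u i))%:R != 0 :> R by rewrite pnatr_eq0 -lt0n occ_gt0.
have o2 : (occ y (y i))%:R != 0 :> R by rewrite pnatr_eq0 -lt0n occ_gt0.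
by field; rewrite l0 o1 o2.
Qed.

(** Mutual information as the mean of log posterior minus log prior: on the joint type of two words
    it becomes a sum over positions, which is [score]. *)
Lemma MIpVE (p : {ffun U -> R}) (V : U -> {ffun Y -> R}) :
  is_pmf p -> (forall a, is_pmf (V a)) ->
  MIpV p V = \sum_a \sum_b p a * V a b *
     (ln (cprob (jointpmf p V) fst (fun w => (w.2, tt)) a (b, tt)) - ln (p a)).
Proof.
move=> [p0 p1] hV; rewrite /MIpV /MI /condMI.
have J0 w : 0 <= jointpmf p V w by rewrite ffunE mulr_ge0 //; have [] := hV w.1.
rewrite !condEntE // -sumrB pair_bigA.
apply: eq_bigr => -[a b] _ /=; rewrite !ffunE /= -mulrBr; congr (_ * _).
rewrite opprK addrC; congr (_ - ln _).
rewrite /cprob; have -> : dist (jointpmf p V) (fun=> tt) tt = 1.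
  rewrite ffunE; transitivity (\sum_(w : U * Y) p w.1 * V w.1 w.2).
    by apply: eq_big => w //; rewrite ffunE.
  rewrite -(pair_bigA _ (fun a b => p a * V a b)) /= -[RHS]p1.
  by apply: eq_bigr => x _; rewrite -mulr_sumr; have [_ ->] := hV x; rewrite mulr1.
rewrite divr1 ffunE.
transitivity (\sum_(w : U * Y | (w.1 == a) && true) p w.1 * V w.1 w.2).
  by apply: eq_big => w; rewrite ?xpair_eqE ?eqxx // => _; rewrite ffunE.
rewrite -(pair_big (fun x => x == a) predT (fun x z => p x * V x z)) /= big_pred1_eq.
by rewrite -mulr_sumr; have [_ ->] := hV a; rewrite mulr1.
Qed.

(** From [ln x <= x - 1]. [Er] is an infimum of real numbers, and it lies below its members only
    once the set is known to be bounded below. *)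
Lemma condDiv_ge0 (V Wm : U -> {ffun Y -> R}) (p : {ffun U -> R}) :
  (forall a, 0 <= p a) -> (forall a, is_pmf (V a)) ->
  (forall a, 0 < p a -> is_pmf (Wm a)) ->
  (forall a b, 0 < p a -> Wm a b = 0 -> V a b = 0) -> 0 <= condDiv V Wm p.
Proof.
move=> p0 hV hW ac; apply: sumr_ge0 => a _.
have := p0 a; rewrite le_eqVlt => /orP[/eqP <-|pa]; first by rewrite mul0r.
apply: mulr_ge0; first exact: ltW.
have [V0 V1] := hV a; have [W0 W1] := hW a pa.
apply: (@le_trans _ _ (\sum_b (V a b - Wm a b))); first by rewrite sumrB V1 W1 subrr.
apply: ler_sum => b _.
have [->|vb] := eqVneq (V a b) 0; first by rewrite sub0r oppr_le0.
have vb0 : 0 < V a b by rewrite lt_neqAle eq_sym vb V0.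
have wb0 : 0 < Wm a b.
  by rewrite lt_neqAle W0 andbT; apply: contra vb => /eqP h; rewrite ac.
have h : ln (Wm a b / V a b) <= Wm a b / V a b - 1.
  have {1}-> : Wm a b / V a b = 1 + (Wm a b / V a b - 1) by rewrite addrC subrK.
  by apply: le_ln1Dx; rewrite ltrBrDl subrr divr_gt0.
have -> : ln (V a b / Wm a b) = - ln (Wm a b / V a b).
  by rewrite -lnV ?posrE ?divr_gt0 // invf_div.
have -> : V a b - Wm a b = V a b * - (Wm a b / V a b - 1) by field.
by rewrite ler_wpM2l // lerN2.
Qed.

(** * Likelihood of a word under the channel and the exponent [Er] *)

Section Exponent.
Variables (pU : {ffun U -> R}) (Wm : U -> {ffun Y -> R}) (u : {ffun 'I_l -> U}).
Hypotheses (HpU : is_pmf pU) (W0 : forall a b, 0 <= Wm a b).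
Hypothesis W1 : forall a, 0 < pU a -> is_pmf (Wm a).
Hypothesis pU_occ : forall a, l%:R * pU a = (occ u a)%:R.
Hypothesis l0 : (0 < l)%N.

Let lR0 : 0 < l%:R :> R. Proof. by rewrite ltr0n. Qed.

Let pU_eq a : pU a = (occ u a)%:R / l%:R.
Proof. by rewrite -pU_occ mulrC mulKf // gt_eqF. Qed.

Section Pair.
Variable y : {ffun 'I_l -> Y}.

(** The conditional type of [y] given [u]. Letters absent from [u] get a point mass at the first
    output letter, so that [V] is a stochastic matrix and competes in [Er]. *)
Let V (a : U) : {ffun Y -> R} :=
  [ffun b => if occ u a == 0%N then (b == y (Ordinal l0))%:R
             else (jocc u y a b)%:R / (occ u a)%:R].

Let V_pmf a : is_pmf (V a).
Proof.
split=> [b|]; first by rewrite ffunE; case: ifP => // _; rewrite divr_ge0.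
have [oc|oc] := eqVneq (occ u a) 0%N.
  rewrite (bigD1 (y (Ordinal l0))) //= big1 ?addr0 ?ffunE ?oc ?eqxx // => b /negbTE hb.
  by rewrite ffunE oc eqxx hb.
under eq_bigr do rewrite ffunE (negbTE oc).
by rewrite -mulr_suml -natr_sum jocc_sumr divff // pnatr_eq0.
Qed.

Let jocc_occ0 a b : occ u a = 0%N -> jocc u y a b = 0%N.
Proof.
by move=> o; apply/eqP; rewrite -leqn0 -o -(jocc_sumr u y a) (bigD1 b) //= leq_addr.
Qed.

Let joint_eq a b : l%:R * (pU a * V a b) = (jocc u y a b)%:R.
Proof.
rewrite mulrA pU_occ ffunE; case: eqP => [oc|/eqP oc]; first by rewrite oc jocc_occ0 // mul0r.
by rewrite mulrC divfK // pnatr_eq0.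
Qed.

Let V_at i : V (u i) (y i) = (jocc u y (u i) (y i))%:R / (occ u (u i))%:R.
Proof. by rewrite ffunE ifF // gtn_eqF ?occ_gt0. Qed.

Let joint_gt0 i : 0 < V (u i) (y i).
Proof. by rewrite V_at divr_gt0 // ltr0n ?jocc_gt0 ?occ_gt0. Qed.

Lemma score_MIpV : score u y = l%:R * MIpV pU V.
Proof.
rewrite MIpVE // mulr_sumr.
under [RHS]eq_bigr => a _.
  rewrite mulr_sumr.
  under eq_bigr => b _ do rewrite mulrA joint_eq.
  over.
rewrite -(sum_jocc (fun a b => ln (cprob (jointpmf pU V) fst (fun w => (w.2, tt)) a (b, tt))
  - ln (pU a))); apply: eq_bigr => i _.
have o1 : 0 < (occ u (u i))%:R :> R by rewrite ltr0n occ_gt0.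
have o2 : 0 < (occ y (y i))%:R :> R by rewrite ltr0n occ_gt0.
have o3 : 0 < (jocc u y (u i) (y i))%:R :> R by rewrite ltr0n jocc_gt0.
have -> : cprob (jointpmf pU V) fst (fun w => (w.2, tt)) (u i) (y i, tt) =
    (jocc u y (u i) (y i))%:R / (occ y (y i))%:R.
  have E a b : pU a * V a b = (jocc u y a b)%:R / l%:R.
    by rewrite -joint_eq [RHS]mulrC mulKf // gt_eqF.
  rewrite /cprob !ffunE (big_pred1 (u i, y i)); last first.
    by move=> [a b]; rewrite /= !xpair_eqE /= eqxx andbT.
  rewrite ffunE /= E.
  have -> : \sum_(w | (w.2, tt) == (y i, tt)) jointpmf pU V w = (occ y (y i))%:R / l%:R.
    transitivity (\sum_(w : U * Y | true && (w.2 == y i)) (jocc u y w.1 w.2)%:R / l%:R : R).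
      by apply: eq_big => w; rewrite ?xpair_eqE ?eqxx ?andbT // => _; rewrite ffunE E.
    rewrite -(pair_big predT (fun b => b == y i) (fun a b => (jocc u y a b)%:R / l%:R)) /=.
    under eq_bigr do rewrite big_pred1_eq.
    by rewrite -mulr_suml -natr_sum jocc_suml.
  by rewrite invf_div mulrA divfK // gt_eqF.
rewrite pU_eq -ln_div ?posrE ?divr_gt0 //; congr (ln _).
by field; rewrite !gt_eqF.
Qed.

(** The divergence of the conditional type is the empirical mean of [ln (V / Wm)] along the words,
    so this step of the method of types is an identity. *)
Lemma likelihood_condDiv : (forall i, 0 < Wm (u i) (y i)) ->
  \prod_i Wm (u i) (y i) =
  expR (- (l%:R * condDiv V Wm pU)) * \prod_i ((jocc u y (u i) (y i))%:R / (occ u (u i))%:R).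
Proof.
move=> Wy.
have -> : l%:R * condDiv V Wm pU = \sum_i ln (V (u i) (y i) / Wm (u i) (y i)).
  rewrite (sum_jocc (fun a b => ln (V a b / Wm a b))) mulr_sumr; apply: eq_bigr => a _.
  rewrite mulrA mulr_sumr; apply: eq_bigr => b _.
  rewrite -joint_eq -!mulrA; case: eqP => [->|_]; last by [].
  by rewrite !mul0r.
rewrite -sumrN expR_sum -big_split /=; apply: eq_bigr => i _.
by rewrite -V_at expRN lnK ?posrE ?divr_gt0 // invf_div divfK // gt_eqF.
Qed.

(** [V] is a member of the set whose infimum is [Er], and the cap at 1 on the competitors becomes
    the positive part of [MIpV pU V - Rt]. The product left over sums to a polynomial over all
    [y]. *)
Lemma likelihood_exponent (Rt c : R) : 0 <= c ->
  c <= expR (l%:R * Rt) * expR (- score u y) ->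
  \prod_i Wm (u i) (y i) * Num.min 1 c <=
  expR (- (l%:R * Er Rt pU Wm)) * \prod_i ((jocc u y (u i) (y i))%:R / (occ u (u i))%:R).
Proof.
move=> c0 hc.
have P0 : 0 <= \prod_i ((jocc u y (u i) (y i))%:R / (occ u (u i))%:R) :> R.
  by apply: prodr_ge0 => i _; rewrite divr_ge0.
(* A forbidden letter pair makes the left side vanish; otherwise [V] is absolutely continuous with
   respect to [Wm], as membership in the set of [Er] requires. *)
have [[i hi]|hW] := pselect (exists i, Wm (u i) (y i) = 0).
  by rewrite (bigD1 i) //= hi !mul0r mulr_ge0 ?expR_ge0.
have Wy i : 0 < Wm (u i) (y i).
  by rewrite lt_neqAle W0 andbT; apply/negP => /eqP h; apply: hW; exists i.
rewrite likelihood_condDiv // -mulrA [X in _ * X]mulrC mulrA ler_wpM2r //.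
have pU0 a : 0 <= pU a by case: HpU.
have ErV : Er Rt pU Wm <= condDiv V Wm pU + Num.max (MIpV pU V - Rt) 0.
  apply: ge_inf.
    exists 0 => _ [V' [hV' [ac ->]]].
    by rewrite addr_ge0 ?condDiv_ge0 // le_max lexx orbT.
  exists V; split => //; split => // a b pa hW0.
  rewrite ffunE ifF; last by apply/negbTE; move: pa; rewrite pU_eq; case: (occ u a) => //;
    rewrite mul0r ltxx.
  have [->|] := posnP (jocc u y a b); first by rewrite mul0r.
  by case/card_gt0P => i; rewrite inE => /andP[/eqP ua /eqP yb]; case: hW; exists i; rewrite ua yb.
apply: (@le_trans _ _ (expR (- (l%:R * (condDiv V Wm pU + Num.max (MIpV pU V - Rt) 0)))));
  last first.
  by rewrite ler_expR lerN2 ler_wpM2l // ltW.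
rewrite mulrDr opprD expRD ler_wpM2l ?expR_ge0 // /Num.max; case: ifP => _.
  by rewrite mulr0 oppr0 expR0 ge_min lexx.
rewrite ge_min; apply/orP; right; apply: le_trans hc _.
by rewrite -expRD ler_expR score_MIpV [in leRHS]mulrBr opprB.
Qed.

End Pair.
End Exponent.

(** The polynomial of [score_tail] is charged to the code size by the last hypothesis, so the error
    bound keeps only the polynomial from the sum over outputs. *)
Lemma inner_code (pU : {ffun U -> R}) (Wm : U -> {ffun Y -> R}) (M : finType) (m0 : M)
    (w : M -> R) (Rt : R) :
  (0 < l)%N -> is_pmf pU -> is_type l pU -> (forall a b, 0 <= Wm a b) ->
  (forall a, 0 < pU a -> is_pmf (Wm a)) -> (forall m, 0 <= w m) -> \sum_m w m <= 1 ->
  (#|M|.-1)%:R * l.+1%:R ^+ (#|U| + #|U| * #|Y|) <= expR (l%:R * Rt) ->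
  exists (c : M -> {ffun 'I_l -> U}) (d : {ffun 'I_l -> Y} -> M),
    (forall m a, l%:R * pU a = (occ (c m) a)%:R) /\
    \sum_m w m * \sum_(y | d y != m) \prod_i Wm (c m i) (y i) <=
    l.+1%:R ^+ (#|U| * #|Y|) * expR (- (l%:R * Er Rt pU Wm)).
Proof.
move=> l0 HpU typ W0 W1 w0 w1 hM.
have lR0 : 0 < l%:R :> R by rewrite ltr0n.
have [k hk] : exists k : U -> nat, forall a, l%:R * pU a = (k a)%:R.
  exists (fun a => xget 0%N [set n | l%:R * pU a = n%:R]%classic) => a.
  by have [n hn] := typ a; apply: (xgetPex 0%N (P := [set n | l%:R * pU a = n%:R]%classic));
    exists n.
have [u0 hu0] : exists u0 : {ffun 'I_l -> U}, occ u0 =1 k.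
  apply: exists_occ; apply/eqP; rewrite -(eqr_nat R) natr_sum.
  by under eq_bigr do rewrite -hk; rewrite -mulr_sumr; have [_ ->] := HpU; rewrite mulr1.
have C0 : #|type_class u0|%:R != 0 :> R.
  by rewrite pnatr_eq0 -lt0n; apply/card_gt0P; exists u0; apply/type_classP.
have q0 u : 0 <= uniform_on (type_class u0) u by rewrite divr_ge0.
have q1 : \sum_u uniform_on (type_class u0) u = 1.
  by rewrite -mulr_suml -natr_sum -big_mkcond /= sum1_card divff.
have Wn0 (u : {ffun 'I_l -> U}) (y : {ffun 'I_l -> Y}) : 0 <= \prod_i Wm (u i) (y i).
  exact: prodr_ge0.
have [c [d [hc hd]]] := max_score_code score w0 w1 q0 q1 Wn0 m0.
exists c, d; split.
  move=> m a; rewrite hk -hu0; congr (_%:R).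
  have := hc m; rewrite /uniform_on; case: (boolP (c m \in _)) => [/type_classP -> //|_].
  by rewrite mul0r ltxx.
apply: (le_trans hd).
set E := (X in _ <= X).
apply: (@le_trans _ _ (\sum_u uniform_on (type_class u0) u * E)); last first.
  by rewrite -mulr_suml q1 mul1r.
apply: ler_sum => u _.
have [hu|hu] := boolP (u \in type_class u0); last first.
  by rewrite /uniform_on (negbTE hu) !mul0r.
apply: ler_wpM2l => //; rewrite /E [leRHS]mulrC.
(* The roles are exchanged here: [y] is weighted by its empirical conditional law given [u]. *)
have sl := self_likelihood R Y u; rewrite mulnC in sl.
have h := ler_wpM2l (expR_ge0 (- (l%:R * Er Rt pU Wm))) sl.
apply: le_trans h; rewrite mulr_sumr; apply: ler_sum => y _.
have jsym a b : jocc y u a b = jocc u y b a.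
  by apply: eq_card => i; rewrite !inE andbC.
under [X in _ <= _ * X]eq_bigr do rewrite jsym.
apply: likelihood_exponent => //.
- by move=> a; rewrite hk -hu0; congr (_%:R); move: hu => /type_classP ->.
- by rewrite mulr_ge0 // sumr_ge0 // => u' _; rewrite mulr_ge0.
- apply: le_trans (ler_wpM2l _ (score_tail u0 y (score u y))) _ => //.
  by rewrite mulrA ler_wpM2r ?expR_ge0.
Qed.

End InnerCode.

(** * Typical sequences *)

Section Hoeffding.
Import numFieldNormedType.Exports.
Variable R : realType.

Lemma ge0_derive_ge_at0 (f df : R -> R) (t : R) :
  (forall x : R, is_derive x (1 : R) f (df x)) -> (forall x, 0 <= x -> 0 <= df x) -> 0 <= t ->
    f 0 <= f t.
Proof.
move=> hf hdf t0.
have [|c] := @MVT_segment R f df 0 t t0 (fun x _ => hf x).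
  by apply: derivable_within_continuous => x _; have := hf x => -[].
rewrite in_itv /= => /andP[c0 _] h.
by rewrite -subr_ge0 h mulr_ge0 ?hdf // subr0.
Qed.

(** Hoeffding's lemma. With [q] the tilted success probability, the gap [g] of the exponents and its
    derivative [h] vanish at 0, and the second derivative is [1 / 4 - q * (1 - q) >= 0]. *)
Lemma bernoulli_mgf_le (p t : R) : 0 <= p <= 1 -> 0 <= t ->
  1 - p + p * expR t <= expR (p * t + t ^+ 2 / 8).
Proof.
move=> /andP[p0 p1] t0.
pose D x : R := 1 - p + p * expR x.
have D0 x : 0 < D x.
  have := p0; rewrite le_eqVlt => /orP[/eqP e|pp]; first by rewrite /D -e; lra.
  by rewrite /D ltr_wpDl ?subr_ge0 // mulr_gt0 ?expR_gt0.
have dD x : is_derive x (1 : R) D (p * expR x).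
  have := is_deriveD (is_derive_cst (1 - p) x 1) (is_deriveZ p (is_derive_expR x)).
  by rewrite add0r.
have dln x : is_derive x (1 : R) (fun x => ln (D x)) (p * expR x / D x).
  have := is_derive1_comp (is_derive1_ln (D0 x)) (dD x).
  by rewrite mulrC.
pose h x : R := p + x / 4 - p * expR x / D x.
pose g x : R := p * x + x ^+ 2 / 8 - ln (D x).
have dg x : is_derive x (1 : R) g (h x).
  have e1 := is_deriveZ p (is_derive_id x (1 : R)).
  have e2 := is_deriveZ (8^-1) (is_deriveX 2 (is_derive_id x (1 : R))).
  have := is_deriveB (is_deriveD e1 e2) (dln x).
  have -> : p \*: id + 8^-1 \*: id ^+ 2 - (fun x => ln (D x)) = g.
    by apply/funext => y; rewrite /g !fctE /GRing.scale /=; congr (_ + _ - _); rewrite mulrC.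
  move=> H; apply: (is_derive_eq H); rewrite /h /GRing.scale /=; field.
  exact: lt0r_neq0.
have dh x : is_derive x (1 : R) h (1 / 4 - (p * expR x / D x) * (1 - p * expR x / D x)).
  have e1 := is_deriveZ (4^-1) (is_derive_id x (1 : R)).
  have e2 := is_deriveM (is_deriveZ p (is_derive_expR x)) (is_deriveV (lt0r_neq0 (D0 x)) (dD x)).
  have := is_deriveB (is_deriveD (is_derive_cst p x 1) e1) e2.
  have -> : cst p + 4^-1 \*: id - p \*: expR * (fun y => (D y)^-1) = h.
    by apply/funext => y; rewrite /h !fctE /GRing.scale /=; congr (_ + _ - _); rewrite mulrC.
  move=> H; apply: (is_derive_eq H); rewrite /GRing.scale /= /GRing.scale /=; field.
  exact: lt0r_neq0.
have h0 x : 0 <= x -> 0 <= h x.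
  move=> x0; have -> : 0 = h 0 by rewrite /h /D expR0 mulr1 subrK divr1 mul0r addr0 subrr.
  apply: (ge0_derive_ge_at0 dh) => // y _.
  set q := p * expR y / D y; have := sqr_ge0 (q - 1 / 2); rewrite expr2; lra.
have g0 : 0 <= g t.
  have {1}-> : 0 = g 0 by rewrite /g /D expR0 mulr1 subrK ln1 expr2 !mulr0 !mul0r addr0 subrr.
  exact: (ge0_derive_ge_at0 dg).
by rewrite -/(D t) -ler_ln ?posrE ?expR_gt0 // expRK -subr_ge0.
Qed.

Variables (K : finType) (p : {ffun K -> R}) (l : nat) (delta : R).
Hypotheses (Hp : is_pmf p) (delta0 : 0 <= delta).

Let p0 k : 0 <= p k. Proof. by case: Hp. Qed.

Let p_le1 k : p k <= 1.
Proof. by case: Hp => _ <-; rewrite (bigD1 k) //= lerDl sumr_ge0. Qed.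

Lemma occ_tail b :
  \sum_(k : {ffun 'I_l -> K} | l%:R * ((1 + delta) * p b) < (occ k b)%:R) \prod_i p (k i) <=
  expR (- (2 * delta ^+ 2 * p b ^+ 2 * l%:R)).
Proof.
(* Minimiser of the exponent [t ^+ 2 / 8 - t * delta * p b], whose minimum is
   [- (2 * delta ^+ 2 * p b ^+ 2)]. *)
pose t := 4 * delta * p b.
have t0 : 0 <= t by rewrite !mulr_ge0.
pose G x := expR (t * ((x == b)%:R - (1 + delta) * p b)).
apply: (@le_trans _ _ (\sum_(k : {ffun 'I_l -> K}) (\prod_i p (k i)) * \prod_i G (k i))).
  rewrite big_mkcond; apply: ler_sum => k _.
  have P0 : 0 <= \prod_i p (k i) by apply: prodr_ge0.
  case: ifP => h; last by rewrite mulr_ge0 // prodr_ge0 // => i _; apply: expR_ge0.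
  rewrite -[leLHS]mulr1 ler_wpM2l // -expR_sum -[leLHS]expR0 ler_expR -mulr_sumr mulr_ge0 // sumrB.
  rewrite sumr_const card_ord -[X in _ - X]mulr_natl subr_ge0.
  rewrite (_ : \sum_i _ = (occ k b)%:R); first exact: ltW.
  by rewrite /occ -sum1_card natr_sum [RHS]big_mkcond; apply: eq_bigr => i _; rewrite inE;
    case: eqP.
rewrite (sum_prod_ffunM (fun _ x => p x) (fun _ x => G x)) prodr_const card_ord.
have -> : - (2 * delta ^+ 2 * p b ^+ 2 * l%:R) = - (2 * delta ^+ 2 * p b ^+ 2) * l%:R.
  by rewrite mulNr.
rewrite expRM_natr lerXn2r ?nnegrE ?expR_ge0 //.
  by apply: sumr_ge0 => x _; rewrite mulr_ge0 ?expR_ge0.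
have -> : \sum_x p x * G x = (1 - p b + p b * expR t) * expR (- t * ((1 + delta) * p b)).
  set E := expR (- t * _).
  have Gb : G b = expR t * E by rewrite /G eqxx mulrBr mulr1 expRD /E mulNr.
  have Gn x : x != b -> G x = E.
    by move=> /negbTE h; rewrite /G h mulrBr mulr0 sub0r /E mulNr.
  rewrite (bigD1 b) //= Gb (eq_bigr (fun x => p x * E)); last by move=> x /Gn ->.
  rewrite -mulr_suml (_ : \sum_(x | x != b) p x = 1 - p b); first by ring.
  by case: Hp => _ <-; rewrite [in RHS](bigD1 b) //= addrC addrK.
apply: le_trans (ler_wpM2r (expR_ge0 _) (bernoulli_mgf_le _ t0)) _.
  by rewrite p0 p_le1.
rewrite -expRD ler_expR le_eqVlt; apply/orP; left; apply/eqP.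
by rewrite /t; field.
Qed.

(** A probability floor rather than a condition on letter counts: the floor yields the size bound
    directly, and counts serve to bound the mass outside. *)
Definition typical : {set {ffun 'I_l -> K}} :=
  [set k : {ffun 'I_l -> K} | expR (- (l%:R * ((1 + delta) * entropy p))) <= \prod_i p (k i)].

Lemma minpos_ge0 : 0 <= minpos p.
Proof. by rewrite /minpos; elim/big_ind: _ => [|x y hx hy|i hi];
  rewrite ?ler01 ?le_min ?hx ?hy // ltW. Qed.

Lemma entropyE : entropy p = \sum_x p x * - ln (p x).
Proof. by rewrite /entropy -sumrN; apply: eq_bigr => x _; rewrite xlnxE mulrN. Qed.

(** As [- ln (p b) >= 0], a word in which no letter [b] exceeds [l * (1 + delta) * p b] occurrences
    meets the floor. An atypical word of positive probability thus has an overrepresented letter of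
    positive probability, and [minpos] makes the union bound uniform. *)
Lemma typical_mass : \sum_(k : {ffun 'I_l -> K} | k \notin typical) \prod_i p (k i) <=
  #|K|%:R * expR (- (2 * delta ^+ 2 * minpos p ^+ 2 * l%:R)).
Proof.
pose bad b (k : {ffun 'I_l -> K}) := l%:R * ((1 + delta) * p b) < (occ k b)%:R.
have P0 (k : {ffun 'I_l -> K}) : 0 <= \prod_i p (k i) by apply: prodr_ge0.
apply: (@le_trans _ _ (\sum_(b | 0 < p b) \sum_(k : {ffun 'I_l ->
  K} | bad b k) \prod_i p (k i))); last first.
  apply: (@le_trans _ _ (\sum_(b | 0 < p b) expR (- (2 * delta ^+ 2 * minpos p ^+ 2 * l%:R)))).
    apply: ler_sum => b pb; apply: le_trans (occ_tail b) _.
    rewrite ler_expR lerN2 ler_wpM2r // ler_wpM2l ?mulr_ge0 ?exprn_ge0 //.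
    by rewrite lerXn2r ?nnegrE ?minpos_ge0 // /minpos bigmin_le_cond.
  by rewrite sumr_const -[leLHS]mulr_natl ler_wpM2r ?expR_ge0 // ler_nat max_card.
rewrite big_mkcond /=.
under [leRHS]eq_bigr do rewrite big_mkcond /=.
rewrite exchange_big /=; apply: ler_sum => k _.
have rhs0 : 0 <= \sum_(b | 0 < p b) (if bad b k then \prod_i p (k i) else 0).
  by apply: sumr_ge0 => b _; case: ifP.
case: ifP => // kt; have := P0 k; rewrite le_eqVlt => /orP[/eqP e|kp].
  by apply: le_trans rhs0; rewrite -e.
have pk i : 0 < p (k i) by apply: (prodr_gt0_factor _ kp).
suff [b pb hb] : exists2 b, 0 < p b & bad b k.
  by rewrite (bigD1 b) //= hb lerDl sumr_ge0 // => b' _; case: ifP.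
apply: contrapT => hn; move: kt; rewrite inE => /negP; apply.
have -> : \prod_i p (k i) = expR (\sum_i ln (p (k i))).
  by rewrite expR_sum; apply: eq_bigr => i _; rewrite lnK ?posrE.
rewrite ler_expR lerNl -sumrN (sum_occ (fun x => - ln (p x))) entropyE !mulr_sumr.
apply: ler_sum => b _; rewrite -[leLHS]mulr_natl !mulrA.
have lnp : 0 <= - ln (p b) by rewrite oppr_ge0 ln_le0.
rewrite -!mulrA [X in _ <= X](_ : _ = l%:R * ((1 + delta) * p b) * - ln (p b)); last by ring.
apply: ler_wpM2r => //.
have := p0 b; rewrite le_eqVlt => /orP[/eqP pb|pb]; last first.
  by rewrite leNgt; apply/negP => hb; apply: hn; exists b.
rewrite -pb !mulr0 (_ : occ k b = 0%N) //; apply/eqP; rewrite -leqn0 leqNgt.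
apply/negP => /card_gt0P[i]; rewrite inE => /eqP kb.
by have := pk i; rewrite kb -pb ltxx.
Qed.

Lemma card_typical : #|typical|%:R <= expR (l%:R * ((1 + delta) * entropy p)).
Proof.
rewrite -[leRHS]mul1r -[expR _]invrK -expRN ler_pdivlMr ?expR_gt0 //.
have tot : \sum_(k : {ffun 'I_l -> K}) \prod_i p (k i) = 1.
  by rewrite (sum_prod_ffun (fun _ x => p x)) big1 // => i _; case: Hp.
apply: (@le_trans _ _ (\sum_(k : {ffun 'I_l -> K} | k \in typical) \prod_i p (k i))).
  rewrite [leLHS]mulr_natl -sumr_const; apply: ler_sum => k; by rewrite inE.
rewrite -[leRHS]tot [leRHS](bigID (fun k => k \in typical)) /= lerDl sumr_ge0 // => k _.
exact: prodr_ge0.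
Qed.

End Hoeffding.

(** * One block *)

Section Mixture.
Variables (R : realType) (A1 A2 T1 T2 X1 X2 Y : finType) (Q : A1 -> A2 -> R).
Variables (p1 : A1 -> T1 -> R) (p2 : A2 -> T2 -> R) (z1 : T1 -> X1) (z2 : T2 -> X2).
Variables (Wc : X1 -> X2 -> Y -> R).
Hypotheses (Q0 : forall a1 a2, 0 <= Q a1 a2) (Q1 : \sum_a1 \sum_a2 Q a1 a2 = 1).
Hypotheses (p10 : forall a t, 0 <= p1 a t) (p11 : forall a, \sum_t p1 a t = 1).
Hypotheses (p20 : forall a t, 0 <= p2 a t) (p21 : forall a, \sum_t p2 a t = 1).
Hypotheses (W0 : forall x1 x2 y, 0 <= Wc x1 x2 y) (W1 : forall x1 x2, \sum_y Wc x1 x2 y = 1).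

Let mean := mac_mean Q p1 p2 z1 z2 Wc.

Definition on_support (H : A1 -> T1 -> A2 -> T2 -> Y -> Prop) :=
  forall a1 t1 a2 t2 y, 0 < Q a1 a2 -> 0 < p1 a1 t1 -> 0 < p2 a2 t2 ->
  0 < Wc (z1 t1) (z2 t2) y -> H a1 t1 a2 t2 y.

Lemma mac_mean_le0_support F : (forall a1 t1 a2 t2 y, 0 <= F a1 t1 a2 t2 y) ->
  mean F <= 0 -> on_support (fun a1 t1 a2 t2 y => F a1 t1 a2 t2 y = 0).
Proof.
move=> F0 mF a1 t1 a2 t2 y hQ h1 h2 hW; apply/le_anti; rewrite F0 andbT.
rewrite leNgt; apply/negP => hF; move: mF; apply/negP; rewrite -ltNge.
have S0 a1' a2' t1' t2' : 0 <= \sum_y' Wc (z1 t1') (z2 t2') y' * F a1' t1' a2' t2' y'.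
  by apply: sumr_ge0 => y' _; rewrite mulr_ge0.
have S1 a1' a2' t1' : 0 <= \sum_t2' p2 a2' t2' *
    \sum_y' Wc (z1 t1') (z2 t2') y' * F a1' t1' a2' t2' y'.
  by apply: sumr_ge0 => t2' _; rewrite mulr_ge0.
have S2 a1' a2' : 0 <= \sum_t1' p1 a1' t1' * \sum_t2' p2 a2' t2' *
    \sum_y' Wc (z1 t1') (z2 t2') y' * F a1' t1' a2' t2' y'.
  by apply: sumr_ge0 => t1' _; rewrite mulr_ge0.
rewrite /mean /mac_mean (bigD1 a1) //= ltr_pwDl //; last first.
  by apply: sumr_ge0 => ? _; apply: sumr_ge0 => ? _; rewrite mulr_ge0.
rewrite (bigD1 a2) //= ltr_pwDl //; last by apply: sumr_ge0 => ? _; rewrite mulr_ge0.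
rewrite mulr_gt0 // (bigD1 t1) //= ltr_pwDl //; last by apply: sumr_ge0 => ? _; rewrite mulr_ge0.
rewrite mulr_gt0 // (bigD1 t2) //= ltr_pwDl //; last by apply: sumr_ge0 => ? _; rewrite mulr_ge0.
rewrite mulr_gt0 // (bigD1 y) //= ltr_pwDl ?mulr_gt0 //.
by apply: sumr_ge0 => ? _; rewrite mulr_ge0.
Qed.

Variables (g : A1 -> T1 -> A2 -> T2 -> Y -> R) (G : A1 -> T1 -> A2 -> T2 -> Y -> bool).
Variables (phi N : R).
Hypotheses (phi_bd : 0 <= phi < 1 / 2) (N1 : 1 <= N).
Hypothesis g0 : forall a1 t1 a2 t2 y, 0 <= g a1 t1 a2 t2 y.
Hypothesis g_gt0 : on_support (fun a1 t1 a2 t2 y => G a1 t1 a2 t2 y -> 0 < g a1 t1 a2 t2 y).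
Hypothesis Gphi : mean (fun a1 t1 a2 t2 y => (~~ G a1 t1 a2 t2 y)%:R) <= phi.

Let q a1 t1 a2 t2 y := (1 - phi) * g a1 t1 a2 t2 y + phi / N.

Let N0 : 0 < N. Proof. exact: lt_le_trans N1. Qed.

(** For [phi = 0] the mixture has no floor, but then failures have probability 0 and correctness
    holds on the whole support. *)
Let phi0_good : phi = 0 -> on_support (fun a1 t1 a2 t2 y => G a1 t1 a2 t2 y).
Proof.
move=> h a1 t1 a2 t2 y hQ h1 h2 hW; have := Gphi; rewrite h => h0.
have := mac_mean_le0_support (fun _ _ _ _ _ => ler0n _ _) h0 hQ h1 h2 hW.
by case: (G _ _ _ _ _) => //= /eqP; rewrite oner_eq0.
Qed.

Lemma mixture_gt0 : on_support (fun a1 t1 a2 t2 y => 0 < q a1 t1 a2 t2 y).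
Proof.
move=> a1 t1 a2 t2 y hQ h1 h2 hW; move/andP: phi_bd => [p0 p1'].
have gg : 0 <= (1 - phi) * g a1 t1 a2 t2 y by rewrite mulr_ge0 //; lra.
move: p0; rewrite le_eqVlt => /orP[/eqP/esym e|p0]; last by rewrite ltr_wpDl // divr_gt0.
have hg := g_gt0 hQ h1 h2 hW (phi0_good e hQ h1 h2 hW).
by rewrite /q e mul0r addr0 subr0 mul1r.
Qed.

(** The mixture is at least [(1 - phi) * g] on a correct outcome and [phi / N] on a failure. With
    failure probability [e] this costs [u + (v - u) * e], which at [e = phi] equals
    [hb phi + phi * ln N]. *)
Lemma mixture_bound :
  mean (fun a1 t1 a2 t2 y => - ln (q a1 t1 a2 t2 y)) <=
  hb phi + phi * ln N + mean (fun a1 t1 a2 t2 y => (G a1 t1 a2 t2 y)%:R * - ln (g a1 t1 a2 t2 y)).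
Proof.
move/andP: (phi_bd) => [p0 p1'].
have Gp := Gphi; set e := mean _ in Gp; pose u := - ln (1 - phi); pose v := - ln phi + ln N.
have e0 : 0 <= e.
  rewrite -(mac_mean_const z1 z2 Q1 p11 p21 W1 0).
  by apply: mac_mean_le => // *; exact: ler0n.
apply: (@le_trans _ _ (mean (fun a1 t1 a2 t2 y => u + ((v - u) * (~~ G a1 t1 a2 t2 y)%:R +
    (G a1 t1 a2 t2 y)%:R * - ln (g a1 t1 a2 t2 y))))).
  apply: mac_mean_le => // a1 t1 a2 t2 y hQ h1 h2 hW.
  have q0 := mixture_gt0 hQ h1 h2 hW.
  case: (boolP (G a1 t1 a2 t2 y)) => hG /=.
    rewrite mulr0 add0r mul1r /u -opprD lerN2.
    have gg := g_gt0 hQ h1 h2 hW hG; have p2' : 0 < 1 - phi by lra.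
    rewrite -lnM ?posrE // ler_ln ?posrE ?mulr_gt0 // /q lerDl.
    by rewrite divr_ge0 // ltW.
  rewrite mulr1 mul0r addr0 addrC subrK /v.
  have pp : 0 < phi.
    rewrite lt_neqAle p0 andbT; apply: contra hG => /eqP/esym h; exact: (phi0_good h hQ h1 h2 hW).
  rewrite lerNl opprD opprK -ln_div ?posrE // ler_ln ?posrE ?divr_gt0 // /q lerDr.
  by rewrite mulr_ge0 //; lra.
rewrite /mean mac_meanD mac_mean_const // mac_meanD mac_meanZ -/mean -/e addrA lerD2r.
rewrite /hb !xlnxE.
move: p0; rewrite le_eqVlt => /orP[/eqP/esym h|pp].
  have -> : e = 0 by apply/le_anti; rewrite e0 andbT -h.
  by rewrite /u h subr0 ln1 !(mul0r, mulr0, oppr0, addr0).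
(* [phi < 1 / 2] and [N >= 1] make [v - u] nonnegative, so [e] may be replaced by its bound. *)
have h : (v - u) * e <= (v - u) * phi.
  apply: ler_wpM2l => //; rewrite /v /u opprK addrAC; apply: addr_ge0; last exact: ln_ge0.
  by rewrite addrC subr_ge0 ler_ln ?posrE //; lra.
apply: le_trans (lerD (lexx u) h) _.
by rewrite le_eqVlt; apply/orP; left; apply/eqP; rewrite /u /v; ring.
Qed.

End Mixture.

(** * Letters and words inside a block *)

Section Block.
Variables (R : realType) (l : nat) (S1 S2 V1 V2 X1 X2 Y U : finType).
Variables (W : {ffun S1 * S2 -> R}) (Wc : X1 -> X2 -> {ffun Y -> R}).
Variables (pV1 : {ffun V1 -> R}) (pV2 : {ffun V2 -> R}).
Variables (pX1 : U -> V1 -> {ffun X1 -> R}) (pX2 : U -> V2 -> {ffun X2 -> R}).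
Hypotheses (HW : is_pmf W) (HWc : forall x1 x2, is_pmf (Wc x1 x2)).
Hypotheses (HpV1 : is_pmf pV1) (HpV2 : is_pmf pV2).
Hypotheses (HpX1 : forall u v, is_pmf (pX1 u v)) (HpX2 : forall u v, is_pmf (pX2 u v)).

(** The channel input is drawn with the auxiliary letter and stored in the codeword: fixing the
    codebook also derandomises [pX], so the encoders are deterministic. *)
Definition strategy (V X : finType) (pV : {ffun V -> R}) (pX : U -> V -> {ffun X -> R})
  (u : U) (t : V * X) : R := pV t.1 * pX u t.1 t.2.

Lemma strategy_ge0 (V X : finType) (pV : {ffun V -> R}) (pX : U -> V -> {ffun X -> R}) u t :
  is_pmf pV -> (forall u v, is_pmf (pX u v)) -> 0 <= strategy pV pX u t.
Proof. by move=> [h _] h'; rewrite mulr_ge0 //; have [] := h' u t.1. Qed.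

Lemma sum_strategy (V X : finType) (pV : {ffun V -> R}) (pX : U -> V -> {ffun X -> R}) u
    (F : V -> R) : (forall u v, is_pmf (pX u v)) ->
  \sum_t strategy pV pX u t * F t.1 = \sum_v pV v * F v.
Proof.
move=> h; rewrite -(pair_bigA _ (fun v x => strategy pV pX u (v, x) * F v)) /=.
apply: eq_bigr => v _; rewrite /strategy /=.
under eq_bigr do rewrite mulrAC.
by rewrite -mulr_sumr; have [_ ->] := h u v; rewrite mulr1.
Qed.

Lemma strategy_sum1 (V X : finType) (pV : {ffun V -> R}) (pX : U -> V -> {ffun X -> R}) u :
  is_pmf pV -> (forall u v, is_pmf (pX u v)) -> \sum_t strategy pV pX u t = 1.
Proof.
move=> [_ h] h'; have := sum_strategy pV u (fun=> 1) h'.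
by under eq_bigr do rewrite mulr1; move=> ->; under eq_bigr do rewrite mulr1.
Qed.

Local Notation r1 := (strategy pV1 pX1).
Local Notation r2 := (strategy pV2 pX2).

(** Two letters of [U] occur because the encoders may pick different inner codewords; [chanpmf]
    corresponds to [a = b]. *)
Definition letter_mean (a b : U) (F : V1 * X1 -> V2 * X2 -> Y -> R) : R :=
  \sum_t1 r1 a t1 * \sum_t2 r2 b t2 * \sum_y Wc t1.2 t2.2 y * F t1 t2 y.

Definition word_mean (u v : {ffun 'I_l -> U})
   (F : {ffun 'I_l -> V1 * X1} -> {ffun 'I_l -> V2 * X2} -> {ffun 'I_l -> Y} -> R) : R :=
  \sum_(t1 : {ffun 'I_l -> V1 * X1}) (\prod_i r1 (u i) (t1 i)) *
    \sum_(t2 : {ffun 'I_l -> V2 * X2}) (\prod_i r2 (v i) (t2 i)) *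
    \sum_(y : {ffun 'I_l -> Y}) (\prod_i Wc (t1 i).2 (t2 i).2 (y i)) * F t1 t2 y.

Lemma word_mean_prod u v (F : 'I_l -> V1 * X1 -> V2 * X2 -> Y -> R) :
  word_mean u v (fun t1 t2 y => \prod_i F i (t1 i) (t2 i) (y i)) =
  \prod_i letter_mean (u i) (v i) (F i).
Proof.
rewrite -(sum_prod_ffunM (fun i t => r1 (u i) t) (fun i t1 => \sum_t2 r2 (v i) t2 *
  \sum_y Wc t1.2 t2.2 y * F i t1 t2 y)).
apply: eq_bigr => t1 _; congr (_ * _).
rewrite -(sum_prod_ffunM (fun i t => r2 (v i) t) (fun i t2 =>
  \sum_y Wc (t1 i).2 t2.2 y * F i (t1 i) t2 y)).
apply: eq_bigr => t2 _; congr (_ * _).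
by rewrite -(sum_prod_ffunM (fun i y => Wc (t1 i).2 (t2 i).2 y)
  (fun i y => F i (t1 i) (t2 i) y)).
Qed.

Lemma word_mean_letter u v i (F : V1 * X1 -> V2 * X2 -> Y -> R) :
  word_mean u v (fun t1 t2 y => F (t1 i) (t2 i) (y i)) = letter_mean (u i) (v i) F.
Proof.
have E1 (t1 : {ffun 'I_l -> V1 * X1}) (t2 : {ffun 'I_l -> V2 * X2}) :
  \sum_(y : {ffun 'I_l -> Y}) (\prod_i Wc (t1 i).2 (t2 i).2 (y i)) * F (t1 i) (t2 i) (y i) =
  \sum_y Wc (t1 i).2 (t2 i).2 y * F (t1 i) (t2 i) y.
  rewrite -(codebook_mean1 (p := fun i y => Wc (t1 i).2 (t2 i).2 y) _ i (F (t1 i) (t2 i))) //.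
  by move=> j; have [] := HWc (t1 j).2 (t2 j).2.
transitivity (codebook_mean (fun i t1 => r1 (u i) t1) (fun t1 =>
  \sum_t2 r2 (v i) t2 * \sum_y Wc (t1 i).2 t2.2 y * F (t1 i) t2 y)).
  apply: eq_bigr => t1 _; congr (_ * _).
  rewrite -(codebook_mean1 (p := fun i t2 => r2 (v i) t2) _ i
    (fun t2 => \sum_y Wc (t1 i).2 t2.2 y * F (t1 i) t2 y)); last first.
    by move=> j; apply: strategy_sum1.
  by apply: eq_bigr => t2 _; rewrite E1.
rewrite (codebook_mean1 (p := fun i t1 => r1 (u i) t1) _ i (fun t1 =>
  \sum_t2 r2 (v i) t2 * \sum_y Wc t1.2 t2.2 y * F t1 t2 y)) //.
by move=> j; apply: strategy_sum1.
Qed.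

Lemma source_prod (F : 'I_l -> S1 -> S2 -> R) :
  \sum_(s1 : {ffun 'I_l -> S1}) \sum_(s2 : {ffun 'I_l -> S2})
    (\prod_i W (s1 i, s2 i)) * \prod_i F i (s1 i) (s2 i) =
  \prod_i \sum_s W s * F i s.1 s.2.
Proof.
transitivity (\prod_(i < l) \sum_s1 \sum_s2 W (s1, s2) * F i s1 s2).
  rewrite -(sum_prod_ffun (fun i s1 => \sum_s2 W (s1, s2) * F i s1 s2)).
  apply: eq_bigr => s1 _.
  by rewrite -(sum_prod_ffunM (fun i s2 => W (s1 i, s2)) (fun i s2 => F i (s1 i) s2)).
apply: eq_bigr => i _; rewrite pair_bigA; by apply: eq_bigr => -[].
Qed.

Lemma source_letter i0 (F : S1 -> S2 -> R) :
  \sum_(s1 : {ffun 'I_l -> S1}) \sum_(s2 : {ffun 'I_l -> S2})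
    (\prod_i W (s1 i, s2 i)) * F (s1 i0) (s2 i0) = \sum_s W s * F s.1 s.2.
Proof.
transitivity (\prod_(i < l) \sum_s W s * (if i == i0 then F s.1 s.2 else 1)).
  rewrite -(source_prod (fun i a b => if i == i0 then F a b else 1)).
  apply: eq_bigr => s1 _; apply: eq_bigr => s2 _; congr (_ * _).
  by rewrite -big_mkcond big_pred1_eq.
rewrite (bigD1 i0) //= eqxx [X in _ * X]big1 ?mulr1 // => i /negbTE ->.
by under eq_bigr do rewrite mulr1; case: HW.
Qed.

End Block.

Section BlockMean.
Variables (R : realType) (l : nat) (S1 S2 V1 V2 X1 X2 Y U : finType).
Variables (W : {ffun S1 * S2 -> R}) (Wc : X1 -> X2 -> {ffun Y -> R}).
Variables (pV1 : {ffun V1 -> R}) (pV2 : {ffun V2 -> R}).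
Variables (pX1 : U -> V1 -> {ffun X1 -> R}) (pX2 : U -> V2 -> {ffun X2 -> R}).
Hypotheses (HW : is_pmf W) (HWc : forall x1 x2, is_pmf (Wc x1 x2)).
Hypotheses (HpV1 : is_pmf pV1) (HpV2 : is_pmf pV2).
Hypotheses (HpX1 : forall u v, is_pmf (pX1 u v)) (HpX2 : forall u v, is_pmf (pX2 u v)).

Local Notation r1 := (strategy pV1 pX1).
Local Notation r2 := (strategy pV2 pX2).
Local Notation letter_mean := (letter_mean Wc pV1 pV2 pX1 pX2).
Local Notation word_mean := (@word_mean R l V1 V2 X1 X2 Y U Wc pV1 pV2 pX1 pX2).

Lemma letter_mean_strategies a b (F : V1 -> V2 -> R) :
  letter_mean a b (fun t1 t2 _ => F t1.1 t2.1) = \sum_v1 pV1 v1 * \sum_v2 pV2 v2 * F v1 v2.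
Proof.
rewrite -(sum_strategy pV1 a (fun v1 => \sum_v2 pV2 v2 * F v1 v2) HpX1).
apply: eq_bigr => t1 _; congr (_ * _).
rewrite -(sum_strategy pV2 b (fun v2 => F t1.1 v2) HpX2).
apply: eq_bigr => t2 _; congr (_ * _).
by rewrite -mulr_suml; have [_ ->] := HWc t1.2 t2.2; rewrite mul1r.
Qed.

Lemma letter_mean_addl a b c F :
  letter_mean a b (fun t1 t2 y => c + F t1 t2 y) = c + letter_mean a b F.
Proof.
have hc : letter_mean a b (fun _ _ _ => c) = c.
  rewrite (letter_mean_strategies a b (fun _ _ => c)).
  under eq_bigr do rewrite -mulr_suml; rewrite -mulr_suml.
  by case: HpV1 => _ ->; case: HpV2 => _ ->; rewrite !mul1r.
rewrite -[X in _ = X + _]hc.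
rewrite -big_split /=; apply: eq_bigr => t1 _; rewrite -mulrDr; congr (_ * _).
rewrite -big_split /=; apply: eq_bigr => t2 _; rewrite -mulrDr; congr (_ * _).
by rewrite -big_split /=; apply: eq_bigr => y _; rewrite mulrDr.
Qed.

Lemma letter_mean_ge0 a b F : (forall t1 t2 y, 0 <= F t1 t2 y) -> 0 <= letter_mean a b F.
Proof.
move=> F0; apply: sumr_ge0 => t1 _; rewrite mulr_ge0 ?strategy_ge0 //.
apply: sumr_ge0 => t2 _; rewrite mulr_ge0 ?strategy_ge0 //.
by apply: sumr_ge0 => y _; rewrite mulr_ge0 //; case: (HWc t1.2 t2.2).
Qed.

Lemma word_mean_sum (J : finType) u v
    (F : J -> {ffun 'I_l -> V1 * X1} -> {ffun 'I_l -> V2 * X2} -> {ffun 'I_l -> Y} -> R) :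
  word_mean u v (fun t1 t2 y => \sum_j F j t1 t2 y) = \sum_j word_mean u v (F j).
Proof.
rewrite exchange_big; apply: eq_bigr => t1 _; rewrite -mulr_sumr; congr (_ * _).
rewrite exchange_big; apply: eq_bigr => t2 _; rewrite -mulr_sumr; congr (_ * _).
by rewrite exchange_big; apply: eq_bigr => y _; rewrite mulr_sumr.
Qed.

Lemma word_meanZ c u v F :
  word_mean u v (fun t1 t2 y => c * F t1 t2 y) = c * word_mean u v F.
Proof.
rewrite mulr_sumr; apply: eq_bigr => t1 _; rewrite [RHS]mulrCA; congr (_ * _).
rewrite mulr_sumr; apply: eq_bigr => t2 _; rewrite [RHS]mulrCA; congr (_ * _).
by rewrite mulr_sumr; apply: eq_bigr => y _; rewrite [RHS]mulrCA.
Qed.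

(** To the inner code the outer code is mere noise: with a common inner codeword the output letters
    are independent. [H] is expanded into indicators of output words, which are products over
    positions. *)
Lemma word_mean_output u (H : {ffun 'I_l -> Y} -> R) :
  word_mean u u (fun _ _ y => H y) =
  \sum_(y : {ffun 'I_l -> Y}) (\prod_i letter_mean (u i) (u i) (fun _ _ b => (b == y i)%:R)) * H y.
Proof.
have E (y : {ffun 'I_l -> Y}) : H y = \sum_(y' : {ffun 'I_l -> Y}) H y' * \prod_i (y i == y' i)%:R.
  rewrite (bigD1 y) //= big1 ?mulr1 => [|i _]; last by rewrite eqxx.
  rewrite big1 ?addr0 // => y' hy; suff [i /negbTE hi] : exists i, y i != y' i.
    by rewrite (bigD1 i) //= hi mul0r mulr0.
  apply/existsP; rewrite -negb_forall; apply: contra hy => /forallP h.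
  by apply/eqP/ffunP => i; apply/eqP; rewrite eq_sym.
transitivity (word_mean u u (fun _ _ y => \sum_(y' : {ffun 'I_l -> Y}) H y' *
    \prod_i (y i == y' i)%:R)).
  apply: eq_bigr => t1 _; congr (_ * _); apply: eq_bigr => t2 _; congr (_ * _).
  by apply: eq_bigr => y _; rewrite -E.
rewrite word_mean_sum; apply: eq_bigr => y _; rewrite word_meanZ mulrC; congr (_ * _).
exact: (word_mean_prod Wc pV1 pV2 pX1 pX2 u u (fun i _ _ b => (b == y i)%:R)).
Qed.

Definition block_source (s1 : {ffun 'I_l -> S1}) (s2 : {ffun 'I_l -> S2}) : R :=
  \prod_i W (s1 i, s2 i).
Definition block_strategy (V X S : finType) (pV : {ffun V -> R}) (pX : U -> V -> {ffun X -> R})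
  (e : {ffun 'I_l -> S} -> {ffun 'I_l -> U}) s (t : {ffun 'I_l -> V * X}) : R :=
  \prod_i strategy pV pX (e s i) (t i).
Definition block_input (V X : finType) (t : {ffun 'I_l -> V * X}) : {ffun 'I_l -> X} :=
  [ffun i => (t i).2].
Definition block_channel (x1 : {ffun 'I_l -> X1}) (x2 : {ffun 'I_l -> X2})
  (y : {ffun 'I_l -> Y}) : R := \prod_i Wc (x1 i) (x2 i) (y i).

Variables (e1 : {ffun 'I_l -> S1} -> {ffun 'I_l -> U}) (e2 : {ffun 'I_l -> S2} -> {ffun 'I_l -> U}).

Definition block_mean := mac_mean block_source (block_strategy pV1 pX1 e1)
  (block_strategy pV2 pX2 e2) (@block_input V1 X1) (@block_input V2 X2) block_channel.

Lemma block_meanE F : block_mean F =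
  \sum_s1 \sum_s2 block_source s1 s2 *
     word_mean (e1 s1) (e2 s2) (fun t1 t2 y => F s1 t1 s2 t2 y).
Proof.
apply: eq_bigr => s1 _; apply: eq_bigr => s2 _; congr (_ * _).
apply: eq_bigr => t1 _; congr (_ * _); apply: eq_bigr => t2 _; congr (_ * _).
apply: eq_bigr => y _; congr (_ * _); apply: eq_bigr => i _; by rewrite !ffunE.
Qed.

Lemma block_source_ge0 s1 s2 : 0 <= block_source s1 s2.
Proof. by apply: prodr_ge0 => i _; case: HW. Qed.

Lemma block_source_sum : \sum_s1 \sum_s2 block_source s1 s2 = 1.
Proof.
have := source_prod W (fun (_ : 'I_l) _ _ => 1).
rewrite [RHS]big1 => [|i _]; last by under eq_bigr do rewrite mulr1; case: HW.
move=> h; rewrite -[RHS]h; apply: eq_bigr => s1 _; apply: eq_bigr => s2 _.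
by rewrite [X in _ * X]big1 ?mulr1.
Qed.

Lemma block_strategy_ge0 (V X S : finType) (pV : {ffun V -> R}) (pX : U -> V -> {ffun X -> R})
    (e : {ffun 'I_l -> S} -> {ffun 'I_l -> U}) s t :
  is_pmf pV -> (forall u v, is_pmf (pX u v)) -> 0 <= block_strategy pV pX e s t.
Proof. by move=> h h'; apply: prodr_ge0 => i _; apply: strategy_ge0. Qed.

Lemma block_strategy_sum (V X S : finType) (pV : {ffun V -> R}) (pX : U -> V -> {ffun X -> R})
    (e : {ffun 'I_l -> S} -> {ffun 'I_l -> U}) s :
  is_pmf pV -> (forall u v, is_pmf (pX u v)) -> \sum_t block_strategy pV pX e s t = 1.
Proof.
move=> h h'; rewrite (sum_prod_ffun (fun i t => strategy pV pX (e s i) t)) big1 // => i _.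
exact: strategy_sum1.
Qed.

Lemma block_channel_ge0 x1 x2 y : 0 <= block_channel x1 x2 y.
Proof. by apply: prodr_ge0 => i _; case: (HWc (x1 i) (x2 i)). Qed.

Lemma block_channel_sum x1 x2 : \sum_y block_channel x1 x2 y = 1.
Proof.
rewrite (sum_prod_ffun (fun i y => Wc (x1 i) (x2 i) y)) big1 // => i _.
by case: (HWc (x1 i) (x2 i)).
Qed.

Variables (pU : {ffun U -> R}) (same : {ffun 'I_l -> S1} -> {ffun 'I_l -> S2} -> bool).
Hypothesis pU_occ : forall s1 a, l%:R * pU a = (occ (e1 s1) a)%:R.
Hypothesis same_eq : forall s1 s2, same s1 s2 -> e1 s1 = e2 s2.

(** On agreeing words both encoders use one codeword of exact type [pU], so the sum over positions
    regroups into [l] times a mean under [pU]. Nonnegative costs let the restriction to agreement be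
    lifted afterwards. *)
Lemma block_cost (ls : S1 -> S2 -> R) (lv : U -> V1 * X1 -> V2 * X2 -> Y -> R) :
  (forall s1 s2, 0 <= ls s1 s2) -> (forall u t1 t2 y, 0 <= lv u t1 t2 y) ->
  block_mean (fun s1 t1 s2 t2 y => (same s1 s2)%:R *
    \sum_i (ls (s1 i) (s2 i) + lv (e1 s1 i) (t1 i) (t2 i) (y i))) <=
  l%:R * (\sum_s W s * ls s.1 s.2 + \sum_u pU u * letter_mean u u (lv u)).
Proof.
move=> ls0 lv0; pose B := \sum_u pU u * letter_mean u u (lv u).
(* Nonnegativity of [pU] is read off the letter counts of a codeword, hence the search for some word
   [s]. *)
have B0 : 0 <= l%:R * B.
  have [s _] : exists s : {ffun 'I_l -> S1}, True.
    apply: contrapT => hn; have := block_source_sum; rewrite big1 => [/eqP|s1 _].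
      by rewrite eq_sym oner_eq0.
    by case: hn; exists s1.
  rewrite mulr_sumr; apply: sumr_ge0 => u _; rewrite mulrA (pU_occ s) mulr_ge0 //.
  by apply: letter_mean_ge0 => *; apply: lv0.
rewrite mulrDr -/B.
apply: (@le_trans _ _ (\sum_s1 \sum_s2 block_source s1 s2 *
    (\sum_i ls (s1 i) (s2 i) + l%:R * B))).
  rewrite block_meanE; apply: ler_sum => s1 _; apply: ler_sum => s2 _.
  apply: ler_wpM2l; first exact: block_source_ge0.
  rewrite word_meanZ; case hs: (same s1 s2); rewrite /= ?mulr1n ?mulr0n; last first.
    by rewrite mul0r addr_ge0 // sumr_ge0.
  rewrite mul1r -(same_eq hs) word_mean_sum.
  rewrite (eq_bigr (fun i => ls (s1 i) (s2 i) + letter_mean (e1 s1 i) (e1 s1 i) (lv (e1 s1 i)))).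
    rewrite big_split /= lerD2l (sum_occ (fun a => letter_mean a a (lv a)) (e1 s1)).
    rewrite mulr_sumr; apply: ler_sum => a _.
    by rewrite mulrA (pU_occ s1) mulr_natl.
  move=> i _; rewrite -letter_mean_addl.
  exact: (word_mean_letter HWc HpV1 HpV2 HpX1 HpX2 (e1 s1) (e1 s1) i
    (fun t1 t2 y => ls (s1 i) (s2 i) + lv (e1 s1 i) t1 t2 y)).
under eq_bigr => s1 _.
  under eq_bigr => s2 _ do rewrite mulrDr mulr_sumr.
  rewrite big_split /= -mulr_suml exchange_big /=; over.
rewrite big_split /= -mulr_suml block_source_sum mul1r lerD2r exchange_big /=.
rewrite (eq_bigr (fun=> \sum_s W s * ls s.1 s.2)).
  by rewrite sumr_const card_ord mulr_natl.
by move=> i _; apply: source_letter.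
Qed.

End BlockMean.

(** * The single-letter channel law and its conditional entropies *)

Lemma sum_pairE (R : nmodType) (A B : finType) (F : A * B -> R) :
  \sum_p F p = \sum_a \sum_b F (a, b).
Proof. by rewrite pair_bigA; apply: eq_bigr => -[]. Qed.

Section Channel.
Variables (R : realType) (V1 V2 X1 X2 Y U : finType).
Variable Wc : X1 -> X2 -> {ffun Y -> R}.
Variables (pV1 : {ffun V1 -> R}) (pV2 : {ffun V2 -> R}).
Variables (pX1 : U -> V1 -> {ffun X1 -> R}) (pX2 : U -> V2 -> {ffun X2 -> R}).
Hypotheses (HWc : forall x1 x2, is_pmf (Wc x1 x2)).
Hypotheses (HpV1 : is_pmf pV1) (HpV2 : is_pmf pV2).
Hypotheses (HpX1 : forall u v, is_pmf (pX1 u v)) (HpX2 : forall u v, is_pmf (pX2 u v)).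

Variable pU : {ffun U -> R}.
Hypothesis HpU : is_pmf pU.
Local Notation r1 := (strategy pV1 pX1).
Local Notation r2 := (strategy pV2 pX2).
Local Notation letter_mean := (letter_mean Wc pV1 pV2 pX1 pX2).
Local Notation P := (chanpmf pU pV1 pV2 pX1 pX2 Wc).

Let pU0 u : 0 <= pU u. Proof. by case: HpU. Qed.
Let pV10 v : 0 <= pV1 v. Proof. by case: HpV1. Qed.
Let pV20 v : 0 <= pV2 v. Proof. by case: HpV2. Qed.
Let pX10 u v x : 0 <= pX1 u v x. Proof. by case: (HpX1 u v). Qed.
Let pX20 u v x : 0 <= pX2 u v x. Proof. by case: (HpX2 u v). Qed.
Let Wc0 x1 x2 y : 0 <= Wc x1 x2 y. Proof. by case: (HWc x1 x2). Qed.

Lemma chanpmf_ge0 w : 0 <= P w.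
Proof. by move: w => [[[[[u v1] v2] x1] x2] y]; rewrite ffunE !mulr_ge0. Qed.

Lemma letter_meanE a b F : letter_mean a b F =
  \sum_v1 \sum_v2 \sum_x1 \sum_x2 \sum_y
    pV1 v1 * pV2 v2 * pX1 a v1 x1 * pX2 b v2 x2 * Wc x1 x2 y * F (v1, x1) (v2, x2) y.
Proof.
rewrite /letter_mean sum_pairE.
apply: eq_bigr => v1 _; rewrite [RHS]exchange_big /=; apply: eq_bigr => x1 _.
rewrite sum_pairE mulr_sumr; apply: eq_bigr => v2 _.
rewrite mulr_sumr; apply: eq_bigr => x2 _; rewrite mulrA mulr_sumr; apply: eq_bigr => y _.
by rewrite /strategy /=; ring.
Qed.

Lemma chanpmf_mean F : \sum_w P w * F w =
  \sum_u pU u * letter_mean u u (fun t1 t2 y => F (u, t1.1, t2.1, t1.2, t2.2, y)).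
Proof.
rewrite !sum_pairE.
apply: eq_bigr => u _; rewrite letter_meanE.
do 5! (rewrite mulr_sumr; apply: eq_bigr => ? _).
by rewrite ffunE /=; ring.
Qed.

Lemma distE (O T : finType) (p : {ffun O -> R}) (X : O -> T) t :
  dist p X t = \sum_w p w * (X w == t)%:R.
Proof. by rewrite ffunE big_mkcond; apply: eq_bigr => w _; case: eqP; rewrite ?mulr1 ?mulr0. Qed.

Lemma chanpmf_strategies (F : U -> V1 -> V2 -> R) :
  \sum_w P w * F (cU w) (cV1 w) (cV2 w) =
  \sum_u pU u * \sum_v1 pV1 v1 * \sum_v2 pV2 v2 * F u v1 v2.
Proof.
rewrite chanpmf_mean; apply: eq_bigr => u _; congr (_ * _).
exact: (letter_mean_strategies pV1 pV2 HWc HpX1 HpX2 u u (fun v1 v2 => F u v1 v2)).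
Qed.

Let delta (T : finType) (p : {ffun T -> R}) a c : \sum_x p x * ((x == a)%:R * c) = p a * c.
Proof.
by rewrite (bigD1 a) //= eqxx mul1r big1 ?addr0 // => x /negbTE ->; rewrite mul0r mulr0.
Qed.

Let const (T : finType) (p : {ffun T -> R}) c : is_pmf p -> \sum_x p x * c = c.
Proof. by move=> [_ h]; rewrite -mulr_suml h mul1r. Qed.

(** [X] is left general because the three mutual informations list these variables in different
    orders and nestings. *)
Lemma dist_UV1V2 (T : finType) (X : U * V1 * V2 * X1 * X2 * Y -> T) t u v1 v2 :
  (forall w, (X w == t) = (cU w == u) && ((cV1 w == v1) && (cV2 w == v2))) ->
  dist P X t = pU u * (pV1 v1 * pV2 v2).
Proof.
move=> h; rewrite distE.
rewrite (eq_bigr (fun w => P w * ((cU w == u)%:R * ((cV1 w == v1)%:R * ((cV2 w == v2)%:R * 1))))).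
  rewrite (chanpmf_strategies (fun a b c => (a == u)%:R * ((b == v1)%:R * ((c == v2)%:R * 1)))).
  rewrite -(delta pU u); apply: eq_bigr => a _; congr (_ * _).
  rewrite -(delta pV1 v1) mulr_sumr; apply: eq_bigr => b _; rewrite mulrCA; congr (_ * _).
  rewrite -[pV2 v2 in RHS]mulr1 -(delta pV2 v2) !mulr_sumr; apply: eq_bigr => c _; ring.
by move=> w _; rewrite h mulr1 -!natrM !mulnb.
Qed.

Lemma dist_U u : dist P cU u = pU u.
Proof.
rewrite distE (chanpmf_strategies (fun a _ _ => (a == u)%:R)) -[RHS]mulr1 -(delta pU u).
apply: eq_bigr => a _; congr (_ * _); rewrite mulr1.
by under eq_bigr do rewrite const //; rewrite const.
Qed.

Lemma dist_UV1 u v1 : dist P (fun w => (cU w, cV1 w)) (u, v1) = pU u * pV1 v1.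
Proof.
rewrite distE (eq_bigr (fun w => P w * ((cU w == u)%:R * ((cV1 w == v1)%:R * 1)))).
  rewrite (chanpmf_strategies (fun a b _ => (a == u)%:R * ((b == v1)%:R * 1))) -(delta pU u).
  apply: eq_bigr => a _; congr (_ * _); rewrite -[pV1 v1 in RHS]mulr1 -(delta pV1 v1) mulr_sumr.
  by apply: eq_bigr => b _; rewrite const // mulrCA.
by move=> w _; rewrite xpair_eqE mulr1 -natrM mulnb.
Qed.

Lemma dist_UV2 u v2 : dist P (fun w => (cU w, cV2 w)) (u, v2) = pU u * pV2 v2.
Proof.
rewrite distE (eq_bigr (fun w => P w * ((cU w == u)%:R * ((cV2 w == v2)%:R * 1)))).
  rewrite (chanpmf_strategies (fun a _ b => (a == u)%:R * ((b == v2)%:R * 1))) -(delta pU u).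
  apply: eq_bigr => a _; congr (_ * _); rewrite const // -[pV2 v2 in RHS]mulr1 -(delta pV2 v2).
  by rewrite mulr_sumr; apply: eq_bigr => b _; rewrite mulrCA.
by move=> w _; rewrite xpair_eqE mulr1 -natrM mulnb.
Qed.

Lemma chanpmf_gt0 w : 0 < P w -> [/\ 0 < pU (cU w), 0 < pV1 (cV1 w) & 0 < pV2 (cV2 w)].
Proof.
move: w => [[[[[u v1] v2] x1] x2] y]; rewrite ffunE /cU /cV1 /cV2 /= => h.
split; rewrite lt_neqAle ?pU0 ?pV10 ?pV20 andbT; apply/negP => /eqP e;
  by move: h; rewrite -e !(mul0r, mulr0) ltxx.
Qed.

Lemma condEnt_const_cprob (T T' : finType) (X : U * V1 * V2 * X1 * X2 * Y -> T)
    (Z : U * V1 * V2 * X1 * X2 * Y -> T') (F : U -> V1 -> V2 -> R) :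
  (forall w, 0 < P w -> cprob P X Z (X w) (Z w) = F (cU w) (cV1 w) (cV2 w)) ->
  condEnt P X Z = \sum_u pU u * \sum_v1 pV1 v1 * \sum_v2 pV2 v2 * - ln (F u v1 v2).
Proof.
move=> h; rewrite condEntE; last exact: chanpmf_ge0.
rewrite -(chanpmf_strategies (fun a b c => - ln (F a b c))); apply: eq_bigr => w _.
by have := chanpmf_ge0 w; rewrite le_eqVlt => /orP[/eqP <-|/h ->//]; rewrite !mul0r.
Qed.

(** [V1] is independent of [U] and [V2]. The same entropy is the mean of [- ln pV1], the
    denominator's share of the decoding ratio. *)
Lemma condEnt_V1 : condEnt P cV1 (fun w => (cU w, cV2 w)) = entropy pV1.
Proof.
rewrite (condEnt_const_cprob (F := fun _ v1 _ => pV1 v1)).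
  under eq_bigr => u _.
    under eq_bigr => v1 _ do rewrite const //.
    over.
  rewrite const // /entropy -sumrN; apply: eq_bigr => v1 _; by rewrite xlnxE mulrN.
move=> w /chanpmf_gt0 [h1 h2 h3]; rewrite /cprob dist_UV2.
rewrite (@dist_UV1V2 _ _ _ (cU w) (cV1 w) (cV2 w)).
  by field; rewrite !gt_eqF.
by move=> w'; rewrite !xpair_eqE /=; case: (cU w' == _); rewrite /= ?andbF.
Qed.

Lemma condEnt_V2 : condEnt P cV2 (fun w => (cU w, cV1 w)) = entropy pV2.
Proof.
rewrite (condEnt_const_cprob (F := fun _ _ v2 => pV2 v2)).
  under eq_bigr => u _ do rewrite const //.
  rewrite const // /entropy -sumrN; apply: eq_bigr => v1 _; by rewrite xlnxE mulrN.
move=> w /chanpmf_gt0 [h1 h2 h3]; rewrite /cprob dist_UV1.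
rewrite (@dist_UV1V2 _ _ _ (cU w) (cV1 w) (cV2 w)).
  by field; rewrite !gt_eqF.
move=> w'; rewrite !xpair_eqE /=.
by case: (cU w' == _); case: (cV1 w' == _); rewrite /= ?andbF ?andbT.
Qed.

Lemma condEnt_V12 : condEnt P (fun w => (cV1 w, cV2 w)) cU = entropy pV1 + entropy pV2.
Proof.
rewrite (condEnt_const_cprob (F := fun _ v1 v2 => pV1 v1 * pV2 v2)).
  rewrite const // /entropy -!sumrN.
  rewrite (eq_bigr (fun v1 => pV1 v1 * - ln (pV1 v1) + pV1 v1 * \sum_v2 pV2 v2 * - ln (pV2 v2))).
    rewrite big_split /= const //; congr (_ + _); apply: eq_bigr => v _; by rewrite xlnxE mulrN.
  move=> v1 _; have := pV10 v1; rewrite le_eqVlt => /orP[/eqP <-|h1]; first by rewrite !mul0r addr0.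
  rewrite -mulrDr -[X in _ = _ * (X + _)](const _ HpV2) -big_split /=; congr (_ * _).
  apply: eq_bigr => v2 _; have := pV20 v2; rewrite le_eqVlt => /orP[/eqP <-|h2].
    by rewrite !mul0r addr0.
  by rewrite -mulrDr lnM ?posrE // opprD.
move=> w /chanpmf_gt0 [h1 h2 h3]; rewrite /cprob dist_U.
rewrite (@dist_UV1V2 _ _ _ (cU w) (cV1 w) (cV2 w)).
  by field; rewrite !gt_eqF.
by move=> w'; rewrite !xpair_eqE /= andbC.
Qed.

(** Together with [word_mean_output], this identifies a wrong inner decision on an agreeing block
    with the error event of [inner_code]. *)
Lemma condpmf_letter a b : 0 < pU a ->
  condpmf P cU cY a b = letter_mean a a (fun _ _ y => (y == b)%:R).
Proof.
move=> ha; rewrite ffunE dist_U gt_eqF // distE chanpmf_mean.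
rewrite (bigD1 a) //= big1 ?addr0.
  rewrite mulrC mulKf ?gt_eqF //; apply: eq_bigr => t1 _; congr (_ * _).
  apply: eq_bigr => t2 _; congr (_ * _); apply: eq_bigr => y _; congr (_ * _).
  by rewrite /cU /cY /= xpair_eqE eqxx.
move=> u /negbTE hu; rewrite letter_meanE /cU /cY /=.
rewrite [X in _ * X](_ : _ = 0) ?mulr0 //; do 5! (apply: big1 => ? _).
by rewrite xpair_eqE hu mulr0.
Qed.

Lemma condpmf_ge0 a b : 0 <= condpmf P cU cY a b.
Proof.
by rewrite ffunE; case: ifP => // _; rewrite divr_ge0 // dist_ge0 // => w; apply: chanpmf_ge0.
Qed.

Lemma condpmf_pmf a : 0 < pU a -> is_pmf (condpmf P cU cY a).
Proof.
move=> ha; split; first exact: condpmf_ge0.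
under eq_bigr do rewrite condpmf_letter //.
rewrite -[RHS](_ : letter_mean a a (fun _ _ _ => 1) = _).
  rewrite exchange_big; apply: eq_bigr => t1 _; rewrite -mulr_sumr; congr (_ * _).
  rewrite exchange_big; apply: eq_bigr => t2 _; rewrite -mulr_sumr; congr (_ * _).
  rewrite exchange_big; apply: eq_bigr => y _; rewrite -mulr_sumr; congr (_ * _).
  by rewrite (bigD1 y) //= eqxx big1 ?addr0 // => b /negbTE; rewrite eq_sym => ->.
rewrite (letter_mean_strategies pV1 pV2 HWc HpX1 HpX2 a a (fun _ _ => 1)).
by under eq_bigr do rewrite const //; rewrite const.
Qed.

End Channel.

(** * Mean logarithm of a mixture kernel on one block *)

Section BlockMetrics.
Variables (R : realType) (l : nat) (S1 S2 V1 V2 X1 X2 Y U : finType).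
Variables (W : {ffun S1 * S2 -> R}) (Wc : X1 -> X2 -> {ffun Y -> R}).
Variables (pV1 : {ffun V1 -> R}) (pV2 : {ffun V2 -> R}).
Variables (pX1 : U -> V1 -> {ffun X1 -> R}) (pX2 : U -> V2 -> {ffun X2 -> R}).
Hypotheses (HW : is_pmf W) (HWc : forall x1 x2, is_pmf (Wc x1 x2)).
Hypotheses (HpV1 : is_pmf pV1) (HpV2 : is_pmf pV2).
Hypotheses (HpX1 : forall u v, is_pmf (pX1 u v)) (HpX2 : forall u v, is_pmf (pX2 u v)).

Variable pU : {ffun U -> R}.
Hypothesis HpU : is_pmf pU.
Local Notation r1 := (strategy pV1 pX1).
Local Notation r2 := (strategy pV2 pX2).
Local Notation letter_mean := (letter_mean Wc pV1 pV2 pX1 pX2).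
Local Notation P := (chanpmf pU pV1 pV2 pX1 pX2 Wc).
Variables (e1 : {ffun 'I_l -> S1} -> {ffun 'I_l -> U}) (e2 : {ffun 'I_l -> S2} -> {ffun 'I_l -> U}).
Local Notation mean := (block_mean W Wc pV1 pV2 pX1 pX2 e1 e2).
Local Notation source := (@block_source R l S1 S2 W).
Local Notation strat1 := (@block_strategy R l U V1 X1 S1 pV1 pX1 e1).
Local Notation strat2 := (@block_strategy R l U V2 X2 S2 pV2 pX2 e2).
Local Notation chan := (@block_channel R l X1 X2 Y Wc).
Local Notation input1 := (@block_input l V1 X1).
Local Notation input2 := (@block_input l V2 X2).
Local Notation supp := (on_support source strat1 strat2 input1 input2 chan).

Hypothesis l_gt0 : (0 < l)%N.
Hypothesis pU_occ : forall s1 a, l%:R * pU a = (occ (e1 s1) a)%:R.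
Variable same : {ffun 'I_l -> S1} -> {ffun 'I_l -> S2} -> bool.
Hypothesis same_eq : forall s1 s2, same s1 s2 -> e1 s1 = e2 s2.

Let Q0 := block_source_ge0 (l := l) HW.
Let Q1 := block_source_sum l HW.
Let st10 s t := @block_strategy_ge0 R l U V1 X1 S1 pV1 pX1 e1 s t HpV1 HpX1.
Let st11 s := @block_strategy_sum R l U V1 X1 S1 pV1 pX1 e1 s HpV1 HpX1.
Let st20 s t := @block_strategy_ge0 R l U V2 X2 S2 pV2 pX2 e2 s t HpV2 HpX2.
Let st21 s := @block_strategy_sum R l U V2 X2 S2 pV2 pX2 e2 s HpV2 HpX2.
Let ch0 := block_channel_ge0 (l := l) HWc.
Let ch1 := block_channel_sum (l := l) HWc.

Lemma block_support_source : supp (fun s1 _ s2 _ _ => forall i, 0 < W (s1 i, s2 i)).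
Proof.
move=> s1 t1 s2 t2 y h _ _ _ i; apply: (prodr_gt0_factor _ h) => j.
by case: HW.
Qed.

Lemma block_support_strategies :
  supp (fun _ t1 _ t2 _ => forall i, 0 < pV1 (t1 i).1 /\ 0 < pV2 (t2 i).1).
Proof.
move=> s1 t1 s2 t2 y _ h1 h2 _ i.
have /(_ i) := prodr_gt0_factor (fun j => strategy_ge0 (e1 s1 j) (t1 j) HpV1 HpX1) h1.
have /(_ i) := prodr_gt0_factor (fun j => strategy_ge0 (e2 s2 j) (t2 j) HpV2 HpX2) h2.
rewrite /strategy => a b; split; rewrite lt_neqAle; apply/andP; split.
- by apply: contraTneq b => <-; rewrite mul0r ltxx.
- by case: HpV1.
- by apply: contraTneq a => <-; rewrite mul0r ltxx.
- by case: HpV2.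
Qed.

(** A letter occurring in a codeword has positive probability under [pU] because the type is exact;
    the other factors are positive on the support. *)
Lemma block_support_letter : supp (fun s1 t1 s2 t2 y => same s1 s2 -> forall i,
  0 < P (e1 s1 i, (t1 i).1, (t2 i).1, (t1 i).2, (t2 i).2, y i)).
Proof.
move=> s1 t1 s2 t2 y _ h1 h2 hW hs i; rewrite ffunE.
have /(_ i) := prodr_gt0_factor (fun j => strategy_ge0 (e1 s1 j) (t1 j) HpV1 HpX1) h1.
have /(_ i) := prodr_gt0_factor (fun j => strategy_ge0 (e2 s2 j) (t2 j) HpV2 HpX2) h2.
have /(_ i) : forall j, 0 < Wc (input1 t1 j) (input2 t2 j) (y j).
  by apply: prodr_gt0_factor hW => j; case: (HWc (input1 t1 j) (input2 t2 j)).
rewrite !ffunE -(same_eq hs) /strategy => a b c.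
have d : 0 < pU (e1 s1 i).
  have : 0 < l%:R * pU (e1 s1 i) by rewrite (pU_occ s1) ltr0n occ_gt0.
  by rewrite pmulr_rgt0 // ltr0n.
have -> : pU (e1 s1 i) * pV1 (t1 i).1 * pV2 (t2 i).1 * pX1 (e1 s1 i) (t1 i).1 (t1 i).2 *
   pX2 (e1 s1 i) (t2 i).1 (t2 i).2 * Wc (t1 i).2 (t2 i).2 (y i) =
  pU (e1 s1 i) * ((pV1 (t1 i).1 * pX1 (e1 s1 i) (t1 i).1 (t1 i).2) *
   ((pV2 (t2 i).1 * pX2 (e1 s1 i) (t2 i).1 (t2 i).2) * Wc (t1 i).2 (t2 i).2 (y i))) by ring.
by do 3! (apply: mulr_gt0 => //).
Qed.

Lemma block_mean_strategies (F : V1 -> V2 -> R) :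
  mean (fun _ t1 _ t2 _ => \sum_i F (t1 i).1 (t2 i).1) =
  l%:R * \sum_v1 pV1 v1 * \sum_v2 pV2 v2 * F v1 v2.
Proof.
rewrite block_meanE.
under eq_bigr => s1 _.
  under eq_bigr => s2 _.
    rewrite word_mean_sum (eq_bigr (fun=> \sum_v1 pV1 v1 * \sum_v2 pV2 v2 * F v1 v2)).
      by rewrite sumr_const card_ord -mulr_natl; over.
    move=> i _; rewrite -(letter_mean_strategies pV1 pV2 HWc HpX1 HpX2 (e1 s1 i) (e2 s2 i)).
    exact: (word_mean_letter HWc HpV1 HpV2 HpX1 HpX2 (e1 s1) (e2 s2) i
      (fun t1 t2 y => F t1.1 t2.1)).
  rewrite -mulr_suml; over.
by rewrite -mulr_suml Q1 mul1r.
Qed.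

Section Drift.
Variables (phi N c : R) (G : {ffun 'I_l -> S1} -> {ffun 'I_l -> V1 * X1} ->
  {ffun 'I_l -> S2} -> {ffun 'I_l -> V2 * X2} -> {ffun 'I_l -> Y} -> bool).
Variable g : {ffun 'I_l -> S1} -> {ffun 'I_l -> V1 * X1} ->
  {ffun 'I_l -> S2} -> {ffun 'I_l -> V2 * X2} -> {ffun 'I_l -> Y} -> R.
Variables (cs : S1 -> S2 -> R) (cv : U -> V1 * X1 -> V2 * X2 -> Y -> R).
Hypotheses (phi_bd : 0 <= phi < 1 / 2) (N1 : 1 <= N) (c1 : 1 <= c).
Hypothesis g0 : forall s1 t1 s2 t2 y, 0 <= g s1 t1 s2 t2 y.
Hypothesis Gphi : mean (fun s1 t1 s2 t2 y => (~~ G s1 t1 s2 t2 y)%:R) <= phi.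
Hypothesis Gsame : forall s1 t1 s2 t2 y, G s1 t1 s2 t2 y -> same s1 s2.
Hypothesis gG : forall s1 t1 s2 t2 y, G s1 t1 s2 t2 y -> g s1 t1 s2 t2 y =
  c^-1 * \prod_i (cs (s1 i) (s2 i) * cv (e1 s1 i) (t1 i) (t2 i) (y i)).
Hypotheses (cs_le1 : forall s1 s2, cs s1 s2 <= 1) (cv_le1 : forall u t1 t2 y, cv u t1 t2 y <= 1).
Hypothesis cs_gt0 : forall s1 s2, 0 < W (s1, s2) -> 0 < cs s1 s2.
Hypothesis cv_gt0 : forall u t1 t2 y, 0 < P (u, t1.1, t2.1, t1.2, t2.2, y) -> 0 < cv u t1 t2 y.

Lemma block_mixture_gt0 :
  supp (fun s1 t1 s2 t2 y => 0 < (1 - phi) * g s1 t1 s2 t2 y + phi / N).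
Proof.
apply: (@mixture_gt0 _ _ _ _ _ _ _ _ _ _ _ _ _ _ Q0 st10 st20 ch0 g G) => //.
move=> s1 t1 s2 t2 y h0 h1 h2 h3 hG; rewrite gG // mulr_gt0 ?invr_gt0 ?(lt_le_trans _ c1) //.
apply: prodr_gt0 => i _; rewrite mulr_gt0 //.
  by apply: cs_gt0; apply: (block_support_source h0 h1 h2 h3).
by apply: cv_gt0; apply: (block_support_letter h0 h1 h2 h3 (Gsame hG)).
Qed.

(** [c] is the price of a guess inside the kernel: 1 for the one-sided kernels, the bin size for the
    two-sided one. *)
Lemma block_mixture_cost :
  mean (fun s1 t1 s2 t2 y => - ln ((1 - phi) * g s1 t1 s2 t2 y + phi / N)) <=
  hb phi + phi * ln N + ln c + l%:R * (\sum_s W s * - ln (cs s.1 s.2) +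
    \sum_u pU u * letter_mean u u (fun t1 t2 y => - ln (cv u t1 t2 y))).
Proof.
have c0 : 0 < c by apply: lt_le_trans c1.
have pos : supp (fun s1 t1 s2 t2 y => G s1 t1 s2 t2 y -> forall i,
    0 < cs (s1 i) (s2 i) /\ 0 < cv (e1 s1 i) (t1 i) (t2 i) (y i)).
  move=> s1 t1 s2 t2 y h0 h1 h2 h3 hG i; split.
    by apply: cs_gt0; apply: (block_support_source h0 h1 h2 h3).
  by apply: cv_gt0; apply: (block_support_letter h0 h1 h2 h3 (Gsame hG)).
have gG_gt0 : supp (fun s1 t1 s2 t2 y => G s1 t1 s2 t2 y -> 0 < g s1 t1 s2 t2 y).
  move=> s1 t1 s2 t2 y h0 h1 h2 h3 hG; rewrite gG // mulr_gt0 ?invr_gt0 //.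
  by apply: prodr_gt0 => i _; have [? ?] := pos _ _ _ _ _ h0 h1 h2 h3 hG i; rewrite mulr_gt0.
apply: le_trans (mixture_bound Q0 Q1 st10 st11 st20 st21 ch0 ch1 phi_bd N1 g0 gG_gt0 Gphi) _.
rewrite -[leRHS]addrA lerD2l.
have ls0 s1 s2 : 0 <= - ln (cs s1 s2) by rewrite oppr_ge0 ln_le0.
have lv0 u t1 t2 y : 0 <= - ln (cv u t1 t2 y) by rewrite oppr_ge0 ln_le0.
apply: le_trans (lerD (lexx _) (block_cost HW HWc HpV1 HpV2 HpX1 HpX2 pU_occ same_eq ls0 lv0)).
rewrite -[ln c](mac_mean_const input1 input2 Q1 st11 st21 ch1) -mac_meanD.
apply: mac_mean_le => // s1 t1 s2 t2 y h0 h1 h2 h3.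
have S0 : 0 <= \sum_i (- ln (cs (s1 i) (s2 i)) + - ln (cv (e1 s1 i) (t1 i) (t2 i) (y i))).
  by apply: sumr_ge0 => i _; rewrite addr_ge0.
have lnc : 0 <= ln c by apply: ln_ge0.
case: (boolP (G s1 t1 s2 t2 y)) => hG; last by rewrite mul0r addr_ge0 // mulr_ge0.
rewrite mul1r (Gsame hG) mul1r gG //.
have hpos := pos _ _ _ _ _ h0 h1 h2 h3 hG.
rewrite lnM ?posrE ?invr_gt0 //; last first.
  by apply: prodr_gt0 => i _; have [? ?] := hpos i; rewrite mulr_gt0.
rewrite lnV ?posrE // opprD opprK lerD2l ln_prod; last first.
  by move=> i; have [? ?] := hpos i; rewrite mulr_gt0.
rewrite -sumrN; apply: ler_sum => i _.
by have [? ?] := hpos i; rewrite lnM ?posrE // opprD.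
Qed.

End Drift.
End BlockMetrics.

(** * Decoding metrics *)

Section RatioSums.
Variables (R : realType) (l : nat) (U : finType).

Section OneSide.
Variables (V X : finType) (pV : {ffun V -> R}) (pX : U -> V -> {ffun X -> R}).
Hypotheses (HpV : is_pmf pV) (HpX : forall u v, is_pmf (pX u v)).

Lemma strategy_ratio_ge0 u (h : V -> R) : (forall v, 0 <= h v) ->
  0 <= \sum_t strategy pV pX u t * (h t.1 * (pV t.1)^-1).
Proof.
move=> h0; apply: sumr_ge0 => t _; rewrite mulr_ge0 ?strategy_ge0 // mulr_ge0 // invr_ge0.
by case: HpV.
Qed.

Lemma strategy_ratio_le u (h : V -> R) : (forall v, 0 <= h v) ->
  \sum_t strategy pV pX u t * (h t.1 * (pV t.1)^-1) <= \sum_v h v.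
Proof.
move=> h0; rewrite (sum_strategy pV u (fun v => h v * (pV v)^-1) HpX).
apply: ler_sum => v _; have [->|n] := eqVneq (pV v) 0; first by rewrite mul0r.
by rewrite mulrCA divff // mulr1.
Qed.

(** The drawing law cancels against [1 / pV] whatever the inner codeword [u]; letters with [pV = 0]
    drop out, hence an inequality. *)
Lemma word_strategy_ratio (u : {ffun 'I_l -> U}) (h : 'I_l -> V -> R) :
  (forall i v, 0 <= h i v) ->
  \sum_(t : {ffun 'I_l -> V * X}) (\prod_i strategy pV pX (u i) (t i)) *
    ((\prod_i h i (t i).1) * \prod_i (pV (t i).1)^-1) <= \prod_i \sum_v h i v.
Proof.
move=> h0.
rewrite (eq_bigr (fun t : {ffun 'I_l -> V * X} => (\prod_i strategy pV pX (u i) (t i)) *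
  \prod_i (h i (t i).1 * (pV (t i).1)^-1))); last by move=> t _; rewrite -big_split.
rewrite (sum_prod_ffunM (fun i t => strategy pV pX (u i) t) (fun i t => h i t.1 * (pV t.1)^-1)).
by apply: ler_prod => i _; apply/andP; split;
  [exact: (strategy_ratio_ge0 (u i) (h0 i)) | exact: (strategy_ratio_le (u i) (h0 i))].
Qed.

(** Both parts of the mixture are subnormalised: the first letter by letter, the second because its
    denominator counts the pairs of a source word and an auxiliary word. *)
Lemma one_side_sum (S : finType) (e : {ffun 'I_l -> S} -> {ffun 'I_l -> U}) (phi : R)
    (A : 'I_l -> S -> R) (h : 'I_l -> V -> R) :
  (0 < #|S|)%N -> (0 < #|V|)%N -> 0 <= phi <= 1 ->
  (forall i s, 0 <= A i s) -> (forall i v, 0 <= h i v) ->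
  (forall i, \sum_s A i s <= 1) -> (forall i, \sum_v h i v <= 1) ->
  \sum_s \sum_t block_strategy pV pX e s t *
    (((1 - phi) * ((\prod_i A i (s i)) * \prod_i h i (t i).1) + phi / ((#|S| * #|V|) ^ l)%:R) *
      \prod_i (pV (t i).1)^-1) <= 1.
Proof.
move=> S0 V0 /andP[p0 p1] A0 h0 A1 h1; set N := (_ ^ l)%:R.
have N0 : 0 < N :> R by rewrite ltr0n expn_gt0 muln_gt0 S0 V0.
apply: (@le_trans _ _ (\sum_(s : {ffun 'I_l -> S}) ((1 - phi) * (\prod_i A i (s i)) +
   phi / N * (#|V| ^ l)%:R))).
  apply: ler_sum => s _.
  rewrite (eq_bigr (fun t : {ffun 'I_l -> V * X} => (1 - phi) * (\prod_i A i (s i)) *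
     ((\prod_i strategy pV pX (e s i) (t i)) *
      ((\prod_i h i (t i).1) * \prod_i (pV (t i).1)^-1)) +
     phi / N * ((\prod_i strategy pV pX (e s i) (t i)) *
      ((\prod_(i < l) 1) * \prod_i (pV (t i).1)^-1)))); last first.
    move=> t _; rewrite /block_strategy [X in _ = _ + _ * (_ * (X * _))]big1 //; ring.
  rewrite big_split /= -!mulr_sumr lerD //.
    rewrite -[leRHS]mulr1 ler_wpM2l //.
      by rewrite mulr_ge0 ?prodr_ge0 // subr_ge0.
    apply: le_trans (word_strategy_ratio (e s) h0) _; apply: prodr_ile1 => i _.
    by rewrite h1 sumr_ge0.
  rewrite ler_wpM2l ?divr_ge0 ?(ltW N0) //.
  apply: le_trans (@word_strategy_ratio (e s) (fun _ _ => 1) _) _ => //.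
  by rewrite sumr_const prodr_const card_ord natrX.
rewrite big_split /= -mulr_sumr (sum_prod_ffun A) sumr_const card_ffun card_ord.
rewrite -[X in _ + X]mulr_natl.
have -> : (#|S| ^ l)%:R * (phi / N * (#|V| ^ l)%:R) = phi.
  rewrite mulrCA -mulrA -natrM -expnMn.
  by rewrite -[X in _ * (_^-1 * X)]/N mulVf ?mulr1 // gt_eqF.
rewrite -lerBrDr -[leRHS]mulr1 ler_wpM2l ?subr_ge0 //.
by apply: prodr_ile1 => i _; rewrite A1 sumr_ge0.
Qed.

End OneSide.

Section TwoSides.
Variables (V1 V2 X1 X2 S1 S2 : finType) (pV1 : {ffun V1 -> R}) (pV2 : {ffun V2 -> R}).
Variables (pX1 : U -> V1 -> {ffun X1 -> R}) (pX2 : U -> V2 -> {ffun X2 -> R}).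
Hypotheses (HpV1 : is_pmf pV1) (HpV2 : is_pmf pV2).
Hypotheses (HpX1 : forall u v, is_pmf (pX1 u v)) (HpX2 : forall u v, is_pmf (pX2 u v)).

Lemma word_strategies_ratio (u v : {ffun 'I_l -> U}) (h : 'I_l -> V1 -> V2 -> R) :
  (forall i v1 v2, 0 <= h i v1 v2) ->
  \sum_(t1 : {ffun 'I_l -> V1 * X1}) \sum_(t2 : {ffun 'I_l -> V2 * X2})
   (\prod_i strategy pV1 pX1 (u i) (t1 i)) * ((\prod_i strategy pV2 pX2 (v i) (t2 i)) *
    ((\prod_i h i (t1 i).1 (t2 i).1) *
     ((\prod_i (pV1 (t1 i).1)^-1) * \prod_i (pV2 (t2 i).1)^-1)))
  <= \prod_i \sum_v1 \sum_v2 h i v1 v2.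
Proof.
move=> h0.
pose H i v1 := \sum_t2 strategy pV2 pX2 (v i) t2 * (h i v1 t2.1 * (pV2 t2.1)^-1).
have H0 i v1 : 0 <= H i v1 by apply: strategy_ratio_ge0.
apply: (@le_trans _ _ (\prod_i \sum_v1 H i v1)); last first.
  apply: ler_prod => i _; rewrite sumr_ge0 //=; apply: ler_sum => v1 _.
  exact: strategy_ratio_le.
apply: le_trans (word_strategy_ratio HpV1 HpX1 u H0).
rewrite le_eqVlt; apply/orP; left; apply/eqP; apply: eq_bigr => t1 _.
rewrite -mulr_sumr; congr (_ * _); rewrite /H.
rewrite -(sum_prod_ffunM (fun i t2 => strategy pV2 pX2 (v i) t2)
  (fun i t2 => h i (t1 i).1 t2.1 * (pV2 t2.1)^-1)) mulr_suml.
apply: eq_bigr => t2 _; rewrite [X in _ = _ * X * _]big_split /=; ring.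
Qed.

(** [A] is not a product over letters, since it will test a whole word for membership in the decoded
    bin; only its total mass is bounded. *)
Lemma two_sides_sum (e1 : {ffun 'I_l -> S1} -> {ffun 'I_l -> U})
    (e2 : {ffun 'I_l -> S2} -> {ffun 'I_l -> U}) (phi : R)
    (A : {ffun 'I_l -> S1} -> {ffun 'I_l -> S2} -> R) (h : 'I_l -> V1 -> V2 -> R) :
  (0 < #|S1|)%N -> (0 < #|S2|)%N -> (0 < #|V1|)%N -> (0 < #|V2|)%N -> 0 <= phi <= 1 ->
  (forall s1 s2, 0 <= A s1 s2) -> (forall i v1 v2, 0 <= h i v1 v2) ->
  \sum_s1 \sum_s2 A s1 s2 <= 1 -> (forall i, \sum_v1 \sum_v2 h i v1 v2 <= 1) ->
  \sum_s1 \sum_s2 \sum_t1 \sum_t2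
    block_strategy pV1 pX1 e1 s1 t1 * (block_strategy pV2 pX2 e2 s2 t2 *
    (((1 - phi) * (A s1 s2 * \prod_i h i (t1 i).1 (t2 i).1) +
       phi / (((#|S1| * #|S2|) * (#|V1| * #|V2|)) ^ l)%:R) *
      ((\prod_i (pV1 (t1 i).1)^-1) * \prod_i (pV2 (t2 i).1)^-1))) <= 1.
Proof.
move=> S10 S20 V10 V20 /andP[p0 p1] A0 h0 A1 h1; set N := (_ ^ l)%:R.
have N0 : 0 < N :> R by rewrite ltr0n expn_gt0 !muln_gt0 S10 S20 V10 V20.
apply: (@le_trans _ _ (\sum_s1 \sum_s2 ((1 - phi) * A s1 s2 +
   phi / N * ((#|V1| * #|V2|) ^ l)%:R))).
  apply: ler_sum => s1 _; apply: ler_sum => s2 _.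
  pose D (t1 : {ffun 'I_l -> V1 * X1}) (t2 : {ffun 'I_l -> V2 * X2}) (x : R) :=
    (\prod_i strategy pV1 pX1 (e1 s1 i) (t1 i)) *
    ((\prod_i strategy pV2 pX2 (e2 s2 i) (t2 i)) * (x *
     ((\prod_i (pV1 (t1 i).1)^-1) * \prod_i (pV2 (t2 i).1)^-1))).
  rewrite (eq_bigr (fun t1 : {ffun 'I_l -> V1 * X1} =>
    (1 - phi) * A s1 s2 * \sum_t2 D t1 t2 (\prod_i h i (t1 i).1 (t2 i).1) +
    phi / N * \sum_t2 D t1 t2 (\prod_(i < l) 1))); last first.
    move=> t1 _; rewrite !mulr_sumr -big_split /=; apply: eq_bigr => t2 _.
    have one : \prod_(i < l) 1 = 1 :> R by rewrite big1.
    by rewrite /D /block_strategy one; ring.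
  rewrite big_split /= -!mulr_sumr lerD //.
    rewrite -[leRHS]mulr1 ler_wpM2l //.
      by rewrite mulr_ge0 // subr_ge0.
    apply: le_trans (word_strategies_ratio (e1 s1) (e2 s2) h0) _; apply: prodr_ile1 => i _.
    by rewrite h1 sumr_ge0 // => v1 _; rewrite sumr_ge0.
  rewrite ler_wpM2l ?divr_ge0 ?(ltW N0) //.
  apply: le_trans (@word_strategies_ratio (e1 s1) (e2 s2) (fun _ _ _ => 1) _) _ => //.
  under eq_bigr do under eq_bigr do rewrite sumr_const.
  by under eq_bigr do rewrite sumr_const -mulrnA; rewrite prodr_const card_ord -natrX mulnC.
under eq_bigr do rewrite big_split /= -mulr_sumr sumr_const.
rewrite big_split /= -mulr_sumr sumr_const !card_ffun !card_ord -mulrnA.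
rewrite -[X in _ + X]mulr_natl.
have -> : (#|S2| ^ l * #|S1| ^ l)%:R * (phi / N * ((#|V1| * #|V2|) ^ l)%:R) = phi.
  rewrite mulrCA -mulrA -natrM -!expnMn.
  rewrite [(#|S2| * _)%N]mulnC.
  by rewrite -[X in _ * (_^-1 * X)]/N mulVf ?mulr1 // gt_eqF.
by rewrite -lerBrDr -[leRHS]mulr1 ler_wpM2l ?subr_ge0.
Qed.

End TwoSides.
End RatioSums.

Lemma pmf_card_gt0 (R : realType) (T : finType) (p : {ffun T -> R}) : is_pmf p -> (0 < #|T|)%N.
Proof.
move=> [_ h]; rewrite lt0n; apply/eqP => /card0_eq T0; move: h; rewrite big1 => [/eqP|t _].
  by rewrite eq_sym oner_eq0.
by have := T0 t; rewrite inE.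
Qed.

(** * The three decoding metrics and the resulting code *)

Section BlockCoding.
Variables (R : realType) (l : nat) (S1 S2 V1 V2 X1 X2 Y U : finType).
Variables (W : {ffun S1 * S2 -> R}) (Wc : X1 -> X2 -> {ffun Y -> R}).
Variables (pV1 : {ffun V1 -> R}) (pV2 : {ffun V2 -> R}).
Variables (pX1 : U -> V1 -> {ffun X1 -> R}) (pX2 : U -> V2 -> {ffun X2 -> R}).
Hypotheses (HW : is_pmf W) (HWc : forall x1 x2, is_pmf (Wc x1 x2)).
Hypotheses (HpV1 : is_pmf pV1) (HpV2 : is_pmf pV2).
Hypotheses (HpX1 : forall u v, is_pmf (pX1 u v)) (HpX2 : forall u v, is_pmf (pX2 u v)).

Variable pU : {ffun U -> R}.
Hypothesis HpU : is_pmf pU.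
Local Notation letter_mean := (letter_mean Wc pV1 pV2 pX1 pX2).
Local Notation P := (chanpmf pU pV1 pV2 pX1 pX2 Wc).
Variables (K M : finType) (f1 : S1 -> K) (f2 : S2 -> K) (a : bool).
Variables (c : M -> {ffun 'I_l -> U}) (msg : {ffun 'I_l -> K} -> M).
Variables (d : {ffun 'I_l -> Y} -> M) (B : nat) (good : {set {ffun 'I_l -> K}}).
Hypotheses (l_gt0 : (0 < l)%N) (B_gt0 : (0 < B)%N).
Hypothesis c_occ : forall m u, l%:R * pU u = (occ (c m) u)%:R.
Hypothesis bin_le : forall m, (#|[set k in good | msg k == m]| <= B)%N.

Definition word_encoder (S : finType) (f : S -> K) (s : {ffun 'I_l -> S}) : {ffun 'I_l -> U} :=
  c (msg [ffun i => f (s i)]).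
Definition agree (s1 : {ffun 'I_l -> S1}) (s2 : {ffun 'I_l -> S2}) :=
  [forall i, f1 (s1 i) == f2 (s2 i)].
Definition common_word (s1 : {ffun 'I_l -> S1}) (s2 : {ffun 'I_l -> S2}) : {ffun 'I_l -> K} :=
  [ffun i => Ka a f1 f2 (s1 i, s2 i)].
(** Its negation splits into the three failures to be bounded by [xi], [tau] and [gfun]. *)
Definition decoded s1 s2 y :=
  [&& agree s1 s2, common_word s1 s2 \in good & d y == msg (common_word s1 s2)].

Local Notation e1 := (word_encoder f1).
Local Notation e2 := (word_encoder f2).
Local Notation mean := (block_mean W Wc pV1 pV2 pX1 pX2 e1 e2).
Local Notation source := (@block_source R l S1 S2 W).
Local Notation strat1 := (@block_strategy R l U V1 X1 S1 pV1 pX1 e1).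
Local Notation strat2 := (@block_strategy R l U V2 X2 S2 pV2 pX2 e2).
Local Notation chan := (@block_channel R l X1 X2 Y Wc).
Local Notation input1 := (@block_input l V1 X1).
Local Notation input2 := (@block_input l V2 X2).
Local Notation supp := (on_support source strat1 strat2 input1 input2 chan).

Let W0 s : 0 <= W s. Proof. by case: HW. Qed.
Let P0 := chanpmf_ge0 HWc HpV1 HpV2 HpX1 HpX2 HpU.

Lemma agree_common s1 s2 : agree s1 s2 ->
  [ffun i => f1 (s1 i)] = common_word s1 s2 /\ [ffun i => f2 (s2 i)] = common_word s1 s2.
Proof.
move=> /forallP h; split; apply/ffunP => i; rewrite !ffunE /Ka /=; case: (a) => //.
  exact/eqP.
by apply/esym/eqP.
Qed.

Lemma agree_encoder s1 s2 : agree s1 s2 -> e1 s1 = e2 s2.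
Proof. by rewrite /word_encoder => /agree_common [-> ->]. Qed.

Variable phi : R.
Hypotheses (phi_bd : 0 <= phi < 1 / 2).
Hypothesis decoded_phi : mean (fun s1 _ s2 _ y => (~~ decoded s1 s2 y)%:R) <= phi.

Let phi01 : 0 <= phi <= 1. Proof. by move/andP: phi_bd => [? ?]; apply/andP; split; lra. Qed.

Let agree_phi : mean (fun s1 _ s2 _ _ => (~~ agree s1 s2)%:R) <= phi.
Proof.
apply: le_trans decoded_phi; apply: mac_mean_le.
- exact: block_source_ge0.
- by move=> *; apply: block_strategy_ge0.
- by move=> *; apply: block_strategy_ge0.
- by move=> *; apply: block_channel_ge0.
by move=> s1 t1 s2 t2 y _ _ _ _; rewrite ler_nat /decoded; case: (agree s1 s2).
Qed.

Let cs1 s1 s2 := cprob W fst (fun s => (s.2, Ka a f1 f2 s)) s1 (s2, Ka a f1 f2 (s1, s2)).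
Let cs2 s1 s2 := cprob W snd (fun s => (s.1, Ka a f1 f2 s)) s2 (s1, Ka a f1 f2 (s1, s2)).
Let cs3 s1 s2 := cprob W (fun s => s) (Ka a f1 f2) (s1, s2) (Ka a f1 f2 (s1, s2)).
Let cv1 u (t1 : V1 * X1) (t2 : V2 * X2) y :=
  cprob P cV1 (fun w => (cY w, (cU w, cV2 w))) t1.1 (y, (u, t2.1)).
Let cv2 u (t1 : V1 * X1) (t2 : V2 * X2) y :=
  cprob P cV2 (fun w => (cY w, (cU w, cV1 w))) t2.1 (y, (u, t1.1)).
Let cv3 u (t1 : V1 * X1) (t2 : V2 * X2) y :=
  cprob P (fun w => (cV1 w, cV2 w)) (fun w => (cY w, cU w)) (t1.1, t2.1) (y, u).

Let inv1 (t : {ffun 'I_l -> V1 * X1}) : R := \prod_i (pV1 (t i).1)^-1.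
Let inv2 (t : {ffun 'I_l -> V2 * X2}) : R := \prod_i (pV2 (t i).1)^-1.

(** The test [f1 = f2] makes the common letter a function of [s2], so the source part stays
    subnormalised in [s1] even when [a] selects the first source. The inner codeword is computed
    from [s2], without inner decoding. *)
Let g1 (s1 : {ffun 'I_l -> S1}) (t1 : {ffun 'I_l -> V1 * X1}) (s2 : {ffun 'I_l -> S2})
    (t2 : {ffun 'I_l -> V2 * X2}) (y : {ffun 'I_l -> Y}) : R :=
  (\prod_i ((f1 (s1 i) == f2 (s2 i))%:R * cs1 (s1 i) (s2 i))) *
  \prod_i cv1 (e2 s2 i) (t1 i) (t2 i) (y i).
Let g2 (s1 : {ffun 'I_l -> S1}) (t1 : {ffun 'I_l -> V1 * X1}) (s2 : {ffun 'I_l -> S2})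
    (t2 : {ffun 'I_l -> V2 * X2}) (y : {ffun 'I_l -> Y}) : R :=
  (\prod_i ((f1 (s1 i) == f2 (s2 i))%:R * cs2 (s1 i) (s2 i))) *
  \prod_i cv2 (e1 s1 i) (t1 i) (t2 i) (y i).
Let A3 y s1 s2 : R :=
  ((common_word s1 s2 \in good) && (d y == msg (common_word s1 s2)))%:R / B%:R *
  \prod_i cs3 (s1 i) (s2 i).
(** Both messages are under test, so the inner codeword comes from the inner decoder; on a decoded
    block it is the transmitted one. *)
Let g3 (s1 : {ffun 'I_l -> S1}) (t1 : {ffun 'I_l -> V1 * X1}) (s2 : {ffun 'I_l -> S2})
    (t2 : {ffun 'I_l -> V2 * X2}) (y : {ffun 'I_l -> Y}) : R :=
  A3 y s1 s2 * \prod_i cv3 (c (d y) i) (t1 i) (t2 i) (y i).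

Let N1 : R := ((#|S1| * #|V1|) ^ l)%:R.
Let N2 : R := ((#|S2| * #|V2|) ^ l)%:R.
Let N3 : R := (((#|S1| * #|S2|) * (#|V1| * #|V2|)) ^ l)%:R.
Let q1 s1 t1 s2 t2 y := (1 - phi) * g1 s1 t1 s2 t2 y + phi / N1.
Let q2 s1 t1 s2 t2 y := (1 - phi) * g2 s1 t1 s2 t2 y + phi / N2.
Let q3 s1 t1 s2 t2 y := (1 - phi) * g3 s1 t1 s2 t2 y + phi / N3.

Let S_gt0 : (0 < #|S1|)%N /\ (0 < #|S2|)%N.
Proof.
have := pmf_card_gt0 HW; rewrite card_prod muln_gt0 => /andP[]; by [].
Qed.
Let V1_gt0 := pmf_card_gt0 HpV1.
Let V2_gt0 := pmf_card_gt0 HpV2.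

Let g1_ge0 s1 t1 s2 t2 y : 0 <= g1 s1 t1 s2 t2 y.
Proof.
apply: mulr_ge0; apply: prodr_ge0 => i _; last exact: cprob_ge0.
by apply: mulr_ge0 => //; apply: cprob_ge0.
Qed.
Let g2_ge0 s1 t1 s2 t2 y : 0 <= g2 s1 t1 s2 t2 y.
Proof.
apply: mulr_ge0; apply: prodr_ge0 => i _; last exact: cprob_ge0.
by apply: mulr_ge0 => //; apply: cprob_ge0.
Qed.
Let A3_ge0 y s1 s2 : 0 <= A3 y s1 s2.
Proof.
apply: mulr_ge0; first by rewrite divr_ge0.
by apply: prodr_ge0 => i _; apply: cprob_ge0.
Qed.
Let g3_ge0 s1 t1 s2 t2 y : 0 <= g3 s1 t1 s2 t2 y.
Proof.
apply: mulr_ge0; first exact: A3_ge0.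
by apply: prodr_ge0 => i _; apply: cprob_ge0.
Qed.

Let q1_sum s2 t2 y : \sum_s1 \sum_t1 strat1 s1 t1 * (q1 s1 t1 s2 t2 y * inv1 t1) <= 1.
Proof.
have [S10 S20] := S_gt0.
apply: (@one_side_sum R l U V1 X1 pV1 pX1 HpV1 HpX1 S1 e1 phi
  (fun i s => (f1 s == f2 (s2 i))%:R * cs1 s (s2 i))
  (fun i v => cprob P cV1 (fun w => (cY w, (cU w, cV2 w))) v (y i, (e2 s2 i, (t2 i).1)))) => //.
- by move=> i s; apply: mulr_ge0 => //; apply: cprob_ge0.
- by move=> i v; apply: cprob_ge0.
- move=> i; apply: le_trans (cprob_sum_le1 W fst (fun s => (s.2, Ka a f1 f2 s)) (s2 i, f2 (s2 i))).
  apply: ler_sum => s _; rewrite /cs1 /Ka /=; case: eqP => [h|_]; last by rewrite mul0r cprob_ge0.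
  by rewrite mul1r h; case: (a).
- by move=> i; apply: cprob_sum_le1.
Qed.

Let q2_sum s1 t1 y : \sum_s2 \sum_t2 strat2 s2 t2 * (q2 s1 t1 s2 t2 y * inv2 t2) <= 1.
Proof.
have [S10 S20] := S_gt0.
apply: (@one_side_sum R l U V2 X2 pV2 pX2 HpV2 HpX2 S2 e2 phi
  (fun i s => (f1 (s1 i) == f2 s)%:R * cs2 (s1 i) s)
  (fun i v => cprob P cV2 (fun w => (cY w, (cU w, cV1 w))) v (y i, (e1 s1 i, (t1 i).1)))) => //.
- by move=> i s; apply: mulr_ge0 => //; apply: cprob_ge0.
- by move=> i v; apply: cprob_ge0.
- move=> i; apply: le_trans (cprob_sum_le1 W snd (fun s => (s.1, Ka a f1 f2 s)) (s1 i, f1 (s1 i))).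
  apply: ler_sum => s _; rewrite /cs2 /Ka /=; case: eqP => [h|_]; last by rewrite mul0r cprob_ge0.
  by rewrite mul1r -h; case: (a).
- by move=> i; apply: cprob_sum_le1.
Qed.

(** The at most [B] words [k] of the bin cancel [1 / B]; for each [k] the source pairs with this
    common word have conditional mass at most 1, letter by letter. *)
Let A3_sum y : \sum_s1 \sum_s2 A3 y s1 s2 <= 1.
Proof.
pose bin := [set k in good | msg k == d y].
pose F k (s1 : {ffun 'I_l -> S1}) (s2 : {ffun 'I_l -> S2}) : R :=
  (common_word s1 s2 == k)%:R * \prod_i cs3 (s1 i) (s2 i).
have E s1 s2 : A3 y s1 s2 = B%:R^-1 * \sum_(k in bin) F k s1 s2.
  have -> : \sum_(k in bin) F k s1 s2 =
      (common_word s1 s2 \in bin)%:R * \prod_i cs3 (s1 i) (s2 i).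
    rewrite -mulr_suml; congr (_ * _).
    have [hb|hb] := boolP (common_word s1 s2 \in bin); last first.
      by rewrite big1 // => k hk; case: eqP => // e; move: hb; rewrite e hk.
    rewrite (bigD1 (common_word s1 s2)) //= eqxx big1 ?addr0 // => k /andP[_ /negbTE].
    by rewrite eq_sym => ->.
  by rewrite /A3 inE [d y == _]eq_sym mulrA [B%:R^-1 * _]mulrC.
have F1 k : \sum_s1 \sum_s2 F k s1 s2 <= 1.
  pose h i s := if Ka a f1 f2 s == k i then cprob W (fun s => s) (Ka a f1 f2) s (k i) else 0.
  rewrite (_ : \sum_s1 _ = \prod_i \sum_s1 \sum_s2 h i (s1, s2)).
    apply: prodr_ile1 => i _; apply/andP; split.
      by do 2! (apply: sumr_ge0 => ? _); rewrite /h; case: ifP => _ //; rewrite cprob_ge0.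
    rewrite -sum_pairE; apply: le_trans (cprob_sum_le1 W (fun s => s) (Ka a f1 f2) (k i)).
    by apply: ler_sum => s _; rewrite /h; case: ifP => _ //; rewrite cprob_ge0.
  rewrite -(sum_prod_ffun (fun i s1 => \sum_s2 h i (s1, s2))); apply: eq_bigr => s1 _.
  rewrite -(sum_prod_ffun (fun i s2 => h i (s1 i, s2))); apply: eq_bigr => s2 _.
  rewrite /F; case: eqP => [e|hne].
    by rewrite mul1r; apply: eq_bigr => i _; rewrite /h -e ffunE eqxx.
  rewrite mul0r; have [i hi] : exists i, Ka a f1 f2 (s1 i, s2 i) != k i.
    apply/existsP; rewrite -negb_forall; apply/negP => /forallP h'; apply: hne.
    by apply/ffunP => i; rewrite ffunE; apply/eqP.
  by rewrite (bigD1 i) //= /h (negbTE hi) mul0r.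
under eq_bigr do under eq_bigr do rewrite E.
under eq_bigr do rewrite -mulr_sumr exchange_big.
rewrite -mulr_sumr exchange_big /= mulrC ler_pdivrMr ?ltr0n // mul1r.
apply: (@le_trans _ _ (\sum_(k in bin) 1)); first by apply: ler_sum => k _; apply: F1.
by rewrite sumr_const ler_nat; apply: bin_le.
Qed.

Let q3_sum y : \sum_s1 \sum_s2 \sum_t1 \sum_t2 strat1 s1 t1 * (strat2 s2 t2 *
  (q3 s1 t1 s2 t2 y * (inv1 t1 * inv2 t2))) <= 1.
Proof.
have [S10 S20] := S_gt0.
apply: (@two_sides_sum R l U V1 V2 X1 X2 S1 S2 pV1 pV2 pX1 pX2 HpV1 HpV2 HpX1 HpX2 e1 e2 phi
  (A3 y) (fun i v1 v2 => cprob P (fun w => (cV1 w, cV2 w)) (fun w => (cY w, cU w)) (v1, v2)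
    (y i, c (d y) i))) => //.
- by move=> i v1 v2; apply: cprob_ge0.
- by move=> i; rewrite -(sum_pairE (fun v => cprob P _ _ v _)); apply: cprob_sum_le1.
Qed.

Let Q0 := block_source_ge0 (l := l) HW.
Let Q1 := block_source_sum l HW.
Let st10 s t := @block_strategy_ge0 R l U V1 X1 S1 pV1 pX1 e1 s t HpV1 HpX1.
Let st11 s := @block_strategy_sum R l U V1 X1 S1 pV1 pX1 e1 s HpV1 HpX1.
Let st20 s t := @block_strategy_ge0 R l U V2 X2 S2 pV2 pX2 e2 s t HpV2 HpX2.
Let st21 s := @block_strategy_sum R l U V2 X2 S2 pV2 pX2 e2 s HpV2 HpX2.
Let ch0 := block_channel_ge0 (l := l) HWc.
Let ch1 := block_channel_sum (l := l) HWc.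

(** The mean log-ratio splits into the kernel cost and the mean of [F], which is single-letter for
    all inner codewords because the law of the auxiliary letters does not depend on them. *)
Let drift_gt0 (q r : {ffun 'I_l -> S1} -> {ffun 'I_l -> V1 * X1} ->
    {ffun 'I_l -> S2} -> {ffun 'I_l -> V2 * X2} -> {ffun 'I_l -> Y} -> R) (F : V1 -> V2 -> R) :
  supp (fun s1 t1 s2 t2 y => 0 < q s1 t1 s2 t2 y) ->
  supp (fun s1 t1 s2 t2 y => 0 < r s1 t1 s2 t2 y /\
    ln (r s1 t1 s2 t2 y) = \sum_i F (t1 i).1 (t2 i).1) ->
  mean (fun s1 t1 s2 t2 y => - ln (q s1 t1 s2 t2 y)) <
    l%:R * \sum_v1 pV1 v1 * \sum_v2 pV2 v2 * F v1 v2 ->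
  0 < mean (fun s1 t1 s2 t2 y => ln (q s1 t1 s2 t2 y * r s1 t1 s2 t2 y)).
Proof.
move=> q0 r0 h.
apply: (@lt_le_trans _ _ (mean (fun s1 t1 s2 t2 y => -1 * - ln (q s1 t1 s2 t2 y) +
    \sum_i F (t1 i).1 (t2 i).1))).
  rewrite /block_mean mac_meanD mac_meanZ mulN1r addrC subr_gt0; apply: lt_le_trans h _.
  by rewrite -(block_mean_strategies HW HWc HpV1 HpV2 HpX1 HpX2 e1 e2).
apply: mac_mean_le => // s1 t1 s2 t2 y h0 h1 h2 h3.
have qq := q0 _ _ _ _ _ h0 h1 h2 h3; have [rr <-] := r0 _ _ _ _ _ h0 h1 h2 h3.
by rewrite mulN1r opprK lnM ?posrE.
Qed.

Let N_ge1 (n : nat) : (0 < n)%N -> (1 : R) <= (n ^ l)%:R.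
Proof. by move=> n0; rewrite ler1n expn_gt0 n0. Qed.

Let ln_card (n m : nat) : (0 < n)%N -> (0 < m)%N ->
  ln (((n * m) ^ l)%:R : R) = l%:R * (ln (n%:R : R) + ln (m%:R : R)).
Proof.
by move=> n0 m0; rewrite natrX lnXn ?ltr0n ?muln_gt0 ?n0 // natrM lnM ?posrE ?ltr0n // mulr_natl.
Qed.

Let inv1_supp : supp (fun _ t1 _ _ _ => 0 < inv1 t1 /\ ln (inv1 t1) = \sum_i - ln (pV1 (t1 i).1)).
Proof.
move=> s1 t1 s2 t2 y h0 h1 h2 h3.
have h := block_support_strategies HpV1 HpV2 HpX1 HpX2 h0 h1 h2 h3.
split; first by apply: prodr_gt0 => i _; rewrite invr_gt0; case: (h i).
rewrite /inv1 ln_prod => [|i]; last by rewrite invr_gt0; case: (h i).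
by apply: eq_bigr => i _; rewrite lnV // posrE; case: (h i).
Qed.

Let inv2_supp : supp (fun _ _ _ t2 _ => 0 < inv2 t2 /\ ln (inv2 t2) = \sum_i - ln (pV2 (t2 i).1)).
Proof.
move=> s1 t1 s2 t2 y h0 h1 h2 h3.
have h := block_support_strategies HpV1 HpV2 HpX1 HpX2 h0 h1 h2 h3.
split; first by apply: prodr_gt0 => i _; rewrite invr_gt0; case: (h i).
rewrite /inv2 ln_prod => [|i]; last by rewrite invr_gt0; case: (h i).
by apply: eq_bigr => i _; rewrite lnV // posrE; case: (h i).
Qed.

Variable beta : R.
Hypothesis B_beta : ln (B%:R : R) <= l%:R * beta.
Hypothesis rate1 : condEnt W fst (fun s => (s.2, Ka a f1 f2 s)) + Ll l phi #|S1|%:R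
  < condMI P cV1 cY (fun w => (cU w, cV2 w)) - L1 phi #|V1|%:R.
Hypothesis rate2 : condEnt W snd (fun s => (s.1, Ka a f1 f2 s)) + Ll l phi #|S2|%:R
  < condMI P cV2 cY (fun w => (cU w, cV1 w)) - L1 phi #|V2|%:R.
Hypothesis rate3 : beta + condEnt W (fun s => s) (Ka a f1 f2) + Ll l phi (#|S1| * #|S2|)%:R
  < condMI P (fun w => (cV1 w, cV2 w)) cY cU - L1 phi (#|V1| * #|V2|)%:R.

Let lR_gt0 : 0 < l%:R :> R. Proof. by rewrite ltr0n. Qed.

Let hb_ge0 : 0 <= hb phi.
Proof.
move/andP: phi_bd => [p0 p1]; rewrite /hb !xlnxE -opprD oppr_ge0.
by rewrite -[leRHS]addr0 lerD // mulr_ge0_le0 ?ln_le0 //; lra.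
Qed.

(** Here [x] and [y] are log-cardinalities and [z] is [beta]. Multiplied by [l], the term from [Ll]
    becomes [hb phi + l * phi * x], the source share of the mixture cost, and the term from [L1]
    covers the auxiliary share [l * phi * y]. *)
Let budget (H E I x y z : R) :
  z + H + (l%:R^-1 * hb phi + phi * x) < E - I - (1^-1 * hb phi + phi * y) ->
  hb phi + phi * (l%:R * (x + y)) + l%:R * z + l%:R * (H + I) < l%:R * E.
Proof.
rewrite -(ltr_pM2l lR_gt0) => h.
have e : l%:R * (z + H + (l%:R^-1 * hb phi + phi * x)) =
    l%:R * z + l%:R * H + hb phi + phi * (l%:R * x) by field; rewrite gt_eqF.
have h1 : 0 <= l%:R * hb phi by rewrite mulr_ge0 // ltW.
have e2 : l%:R * (E - I - (1^-1 * hb phi + phi * y)) =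
    l%:R * E - l%:R * I - l%:R * hb phi - phi * (l%:R * y) by rewrite invr1; ring.
have -> : hb phi + phi * (l%:R * (x + y)) + l%:R * z + l%:R * (H + I) =
    l%:R * z + l%:R * H + hb phi + phi * (l%:R * x) + (phi * (l%:R * y) + l%:R * I) by ring.
rewrite e e2 in h; lra.
Qed.

Let budget0 (H E I x y : R) :
  H + (l%:R^-1 * hb phi + phi * x) < E - I - (1^-1 * hb phi + phi * y) ->
  hb phi + phi * (l%:R * (x + y)) + 0 + l%:R * (H + I) < l%:R * E.
Proof. by move=> h; have := @budget H E I x y 0; rewrite add0r mulr0; apply. Qed.

(** Blocks are the superletters, and the ratios are the three mixtures divided by the drawing
    probabilities of the auxiliary words under test. *)
Lemma block_coding (C : nat) (eps : R) : 0 < eps ->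
  exists m0 : nat, forall m, (m0 <= m)%N -> forall (B1 B2 : finType) (Q' : B1 -> B2 -> R),
    (forall b1 b2, 0 <= Q' b1 b2) -> \sum_b1 \sum_b2 Q' b1 b2 = 1 ->
    (#|B1| <= C)%N -> (#|B2| <= C)%N -> (#|B1| * #|B2| <= C)%N ->
    achievable (fun (a1 : {ffun 'I_m -> {ffun 'I_l -> S1}} * B1)
                    (a2 : {ffun 'I_m -> {ffun 'I_l -> S2}} * B2) =>
                  (\prod_i source (a1.1 i) (a2.1 i)) * Q' a1.2 a2.2)
      (fun (x1 : {ffun 'I_m -> {ffun 'I_l -> X1}}) (x2 : {ffun 'I_m -> {ffun 'I_l -> X2}})
           (y : {ffun 'I_m -> {ffun 'I_l -> Y}}) => \prod_i chan (x1 i) (x2 i) (y i)) eps.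
Proof.
have [S10 S20] := S_gt0; have [p0 p1] := andP phi01.
have inv1_ge0 t : 0 <= inv1 t.
  by apply: prodr_ge0 => i _; rewrite invr_ge0; case: HpV1.
have inv2_ge0 t : 0 <= inv2 t.
  by apply: prodr_ge0 => i _; rewrite invr_ge0; case: HpV2.
have q_ge0 (g N : R) : 0 <= g -> 0 <= N -> 0 <= (1 - phi) * g + phi / N.
  by move=> g0 N0; rewrite addr_ge0 ?divr_ge0 // mulr_ge0 // subr_ge0.
have W0' s : 0 < W s -> forall (T T' : finType) (X : S1 * S2 -> T) (Z : S1 * S2 -> T'),
    0 < cprob W X Z (X s) (Z s) by move=> h *; apply: cprob_gt0.
have agree_prod s1 s2 : agree s1 s2 -> forall i, (f1 (s1 i) == f2 (s2 i))%:R = 1 :> R.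
  by move=> /forallP h i; rewrite h.
have g1E s1 t1 s2 t2 y : agree s1 s2 -> g1 s1 t1 s2 t2 y =
    1^-1 * \prod_i (cs1 (s1 i) (s2 i) * cv1 (e1 s1 i) (t1 i) (t2 i) (y i)).
  move=> h; rewrite invr1 mul1r big_split /= (agree_encoder h) /g1; congr (_ * _).
  by apply: eq_bigr => i _; rewrite (agree_prod _ _ h) mul1r.
have g2E s1 t1 s2 t2 y : agree s1 s2 -> g2 s1 t1 s2 t2 y =
    1^-1 * \prod_i (cs2 (s1 i) (s2 i) * cv2 (e1 s1 i) (t1 i) (t2 i) (y i)).
  move=> h; rewrite invr1 mul1r big_split /= /g2; congr (_ * _).
  by apply: eq_bigr => i _; rewrite (agree_prod _ _ h) mul1r.
have g3E s1 t1 s2 t2 y : decoded s1 s2 y -> g3 s1 t1 s2 t2 y =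
    (B%:R)^-1 * \prod_i (cs3 (s1 i) (s2 i) * cv3 (e1 s1 i) (t1 i) (t2 i) (y i)).
  move=> /and3P[h hg hd]; rewrite big_split /= /g3 /A3 hg hd /= -!mulrA mul1r.
  rewrite (eqP hd); congr (_ * (_ * _)); apply: eq_bigr => i _.
  by rewrite /word_encoder; have [-> _] := agree_common h.
have dec_agree s1 s2 y : decoded s1 s2 y -> agree s1 s2 by move=> /and3P[].
have B1 : 1 <= B%:R :> R by rewrite ler1n.
have s1sum u : \sum_v1 pV1 v1 * \sum_v2 pV2 v2 * u = u :> R.
  by rewrite -!mulr_suml; case: HpV1 => _ ->; case: HpV2 => _ ->; rewrite !mul1r.
have cmean (cv : U -> V1 * X1 -> V2 * X2 -> Y -> R) (F : U * V1 * V2 * X1 * X2 * Y -> R) :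
    (forall u t1 t2 y, cv u t1 t2 y = F (u, t1.1, t2.1, t1.2, t2.2, y)) ->
    \sum_u pU u * letter_mean u u (fun t1 t2 y => - ln (cv u t1 t2 y)) =
    \sum_w P w * - ln (F w).
  move=> h; rewrite chanpmf_mean; apply: eq_bigr => u _; congr (_ * _).
  apply: eq_bigr => t1 _; congr (_ * _); apply: eq_bigr => t2 _; congr (_ * _).
  by apply: eq_bigr => y _; rewrite h.
have occ1 s1 u : l%:R * pU u = (occ (e1 s1) u)%:R by apply: c_occ.
have MC N b G g cs cv := @block_mixture_cost R l S1 S2 V1 V2 X1 X2 Y U W Wc pV1 pV2 pX1 pX2
  HW HWc HpV1 HpV2 HpX1 HpX2 pU e1 e2 l_gt0 occ1 agree agree_encoder phi N b G g cs cv phi_bd.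
have MG N b G g cs cv := @block_mixture_gt0 R l S1 S2 V1 V2 X1 X2 Y U W Wc pV1 pV2 pX1 pX2
  HW HWc HpV1 HpV2 HpX1 HpX2 pU e1 e2 l_gt0 occ1 agree agree_encoder phi N b G g cs cv phi_bd.
have n1 : 1 <= N1 by apply: N_ge1; rewrite muln_gt0 S10.
have n2 : 1 <= N2 by apply: N_ge1; rewrite muln_gt0 S20.
have n3 : 1 <= N3 by apply: N_ge1; rewrite !muln_gt0 S10 S20 V1_gt0.
(* For the one-sided kernels a correct block is one where the words agree; [agree_phi] bounds its
   failure by the same [phi]. *)
pose G1 (s1 : {ffun 'I_l -> S1}) (t1 : {ffun 'I_l -> V1 * X1}) (s2 : {ffun 'I_l -> S2})
  (t2 : {ffun 'I_l -> V2 * X2}) (y : {ffun 'I_l -> Y}) := agree s1 s2.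
pose G3 (s1 : {ffun 'I_l -> S1}) (t1 : {ffun 'I_l -> V1 * X1}) (s2 : {ffun 'I_l -> S2})
  (t2 : {ffun 'I_l -> V2 * X2}) (y : {ffun 'I_l -> Y}) := decoded s1 s2 y.
have cs1_gt0 s1 s2 : 0 < W (s1, s2) -> 0 < cs1 s1 s2 by move/W0' => h; apply: (h _ _ fst).
have cs2_gt0 s1 s2 : 0 < W (s1, s2) -> 0 < cs2 s1 s2 by move/W0' => h; apply: (h _ _ snd).
have cs3_gt0 s1 s2 : 0 < W (s1, s2) -> 0 < cs3 s1 s2.
  by move/W0' => h; apply: (h _ _ (fun s => s) (Ka a f1 f2)).
have cv1_gt0 u t1 t2 y : 0 < P (u, t1.1, t2.1, t1.2, t2.2, y) -> 0 < cv1 u t1 t2 y.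
  exact: (cprob_gt0 cV1 (fun w => (cY w, (cU w, cV2 w))) P0).
have cv2_gt0 u t1 t2 y : 0 < P (u, t1.1, t2.1, t1.2, t2.2, y) -> 0 < cv2 u t1 t2 y.
  exact: (cprob_gt0 cV2 (fun w => (cY w, (cU w, cV1 w))) P0).
have cv3_gt0 u t1 t2 y : 0 < P (u, t1.1, t2.1, t1.2, t2.2, y) -> 0 < cv3 u t1 t2 y.
  exact: (cprob_gt0 (fun w => (cV1 w, cV2 w)) (fun w => (cY w, cU w)) P0).
have q1_gt0 := MG N1 1 G1 g1 cs1 cv1 n1 (lexx 1) g1_ge0 agree_phi
  (fun _ _ _ _ _ h => h) (fun _ _ _ _ _ h => g1E _ _ _ _ _ h) cs1_gt0 cv1_gt0.
have q2_gt0 := MG N2 1 G1 g2 cs2 cv2 n2 (lexx 1) g2_ge0 agree_phi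
  (fun _ _ _ _ _ h => h) (fun _ _ _ _ _ h => g2E _ _ _ _ _ h) cs2_gt0 cv2_gt0.
have q3_gt0 := MG N3 B%:R G3 g3 cs3 cv3 n3 B1 g3_ge0 decoded_phi
  (fun _ _ _ _ _ h => dec_agree _ _ _ h) (fun _ _ _ _ _ h => g3E _ _ _ _ _ h) cs3_gt0 cv3_gt0.
have cs1_le1 s1 s2 : cs1 s1 s2 <= 1 by apply: cprob_le1.
have cs2_le1 s1 s2 : cs2 s1 s2 <= 1 by apply: cprob_le1.
have cs3_le1 s1 s2 : cs3 s1 s2 <= 1 by apply: cprob_le1.
have cv1_le1 u t1 t2 y : cv1 u t1 t2 y <= 1 by apply: cprob_le1.
have cv2_le1 u t1 t2 y : cv2 u t1 t2 y <= 1 by apply: cprob_le1.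
have cv3_le1 u t1 t2 y : cv3 u t1 t2 y <= 1 by apply: cprob_le1.
have b1 := MC N1 1 G1 g1 cs1 cv1 n1 (lexx 1) g1_ge0 agree_phi
  (fun _ _ _ _ _ h => h) (fun _ _ _ _ _ h => g1E _ _ _ _ _ h) cs1_le1 cv1_le1 cs1_gt0 cv1_gt0.
have b2 := MC N2 1 G1 g2 cs2 cv2 n2 (lexx 1) g2_ge0 agree_phi
  (fun _ _ _ _ _ h => h) (fun _ _ _ _ _ h => g2E _ _ _ _ _ h) cs2_le1 cv2_le1 cs2_gt0 cv2_gt0.
have b3 := MC N3 B%:R G3 g3 cs3 cv3 n3 B1 g3_ge0 decoded_phi
  (fun _ _ _ _ _ h => dec_agree _ _ _ h) (fun _ _ _ _ _ h => g3E _ _ _ _ _ h)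
  cs3_le1 cv3_le1 cs3_gt0 cv3_gt0.
have h1 : \sum_s W s * - ln (cs1 s.1 s.2) = condEnt W fst (fun s => (s.2, Ka a f1 f2 s)).
  by rewrite condEntE //; apply: eq_bigr => -[].
have h2 : \sum_s W s * - ln (cs2 s.1 s.2) = condEnt W snd (fun s => (s.1, Ka a f1 f2 s)).
  by rewrite condEntE //; apply: eq_bigr => -[].
have h3 : \sum_s W s * - ln (cs3 s.1 s.2) = condEnt W (fun s => s) (Ka a f1 f2).
  by rewrite condEntE //; apply: eq_bigr => -[].
have i1 : \sum_u pU u * letter_mean u u (fun t1 t2 y => - ln (cv1 u t1 t2 y)) =
    condEnt P cV1 (fun w => (cY w, (cU w, cV2 w))).
  by rewrite condEntE //; apply: cmean.
have i2 : \sum_u pU u * letter_mean u u (fun t1 t2 y => - ln (cv2 u t1 t2 y)) =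
    condEnt P cV2 (fun w => (cY w, (cU w, cV1 w))).
  by rewrite condEntE //; apply: cmean.
have i3 : \sum_u pU u * letter_mean u u (fun t1 t2 y => - ln (cv3 u t1 t2 y)) =
    condEnt P (fun w => (cV1 w, cV2 w)) (fun w => (cY w, cU w)).
  by rewrite condEntE //; apply: cmean.
have r1 := rate1; have r2 := rate2; have r3 := rate3.
rewrite /condMI (condEnt_V1 HWc HpV1 HpV2 HpX1 HpX2 HpU) /L1 /Ll in r1.
rewrite /condMI (condEnt_V2 HWc HpV1 HpV2 HpX1 HpX2 HpU) /L1 /Ll in r2.
rewrite /condMI (condEnt_V12 HWc HpV1 HpV2 HpX1 HpX2 HpU) /L1 /Ll in r3.
rewrite h1 i1 /N1 ln_card // ln1 in b1.
rewrite h2 i2 /N2 ln_card // ln1 in b2.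
rewrite h3 i3 /N3 ln_card ?muln_gt0 ?S10 ?S20 ?V1_gt0 // in b3.
have ent (T : finType) (p : {ffun T -> R}) : \sum_x p x * - ln (p x) = entropy p.
  by rewrite /entropy -sumrN; apply: eq_bigr => x _; rewrite xlnxE mulrN.
have E1 : \sum_v1 pV1 v1 * \sum_v2 pV2 v2 * - ln (pV1 v1) = entropy pV1.
  rewrite -ent; apply: eq_bigr => v1 _; rewrite -mulr_suml.
  by case: HpV2 => _ ->; rewrite mul1r.
have E2 : \sum_v1 pV1 v1 * \sum_v2 pV2 v2 * - ln (pV2 v2) = entropy pV2.
  by rewrite -mulr_suml ent; case: HpV1 => _ ->; rewrite mul1r.
apply: (@superletter_coding R _ _ _ _ _ _ _ source strat1 strat2 input1 input2 chan
  Q0 Q1 st10 st11 st20 st21 ch0 ch1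
  (fun s1 t1 s2 t2 y => q1 s1 t1 s2 t2 y * inv1 t1)
  (fun s1 t1 s2 t2 y => q2 s1 t1 s2 t2 y * inv2 t2)
  (fun s1 t1 s2 t2 y => q3 s1 t1 s2 t2 y * (inv1 t1 * inv2 t2))).
- by move=> *; rewrite mulr_ge0 // q_ge0 // le_trans.
- by move=> *; rewrite mulr_ge0 // q_ge0 // le_trans.
- by move=> *; rewrite mulr_ge0 ?mulr_ge0 // q_ge0 // le_trans.
- move=> s1 t1 s2 t2 y k0 k1 k2 k3; rewrite mulr_gt0 //; first exact: q1_gt0.
  by case: (inv1_supp k0 k1 k2 k3).
- move=> s1 t1 s2 t2 y k0 k1 k2 k3; rewrite mulr_gt0 //; first exact: q2_gt0.
  by case: (inv2_supp k0 k1 k2 k3).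
- move=> s1 t1 s2 t2 y k0 k1 k2 k3; rewrite mulr_gt0 //; first exact: q3_gt0.
  by case: (inv1_supp k0 k1 k2 k3) => ? _; case: (inv2_supp k0 k1 k2 k3) => ? _; rewrite mulr_gt0.
- by move=> *; apply: q1_sum.
- by move=> *; apply: q2_sum.
- by move=> *; apply: q3_sum.
- apply: (drift_gt0 q1_gt0 (r := fun _ t1 _ _ _ => inv1 t1) (F := fun v1 _ => - ln (pV1 v1))).
    exact: inv1_supp.
  apply: le_lt_trans b1 _; rewrite E1; exact: budget0 r1.
- apply: (drift_gt0 q2_gt0 (r := fun _ _ _ t2 _ => inv2 t2) (F := fun _ v2 => - ln (pV2 v2))).
    exact: inv2_supp.
  apply: le_lt_trans b2 _; rewrite E2; exact: budget0 r2.
- apply: (drift_gt0 q3_gt0 (r := fun _ t1 _ t2 _ => inv1 t1 * inv2 t2)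
    (F := fun v1 v2 => - ln (pV1 v1) - ln (pV2 v2))).
    move=> s1 t1 s2 t2 y k0 k1 k2 k3.
    have [a1 a2] := inv1_supp k0 k1 k2 k3; have [a3 a4] := inv2_supp k0 k1 k2 k3.
    by rewrite mulr_gt0 // lnM ?posrE // a2 a4 -big_split.
  have -> : \sum_v1 pV1 v1 * \sum_v2 pV2 v2 * (- ln (pV1 v1) - ln (pV2 v2)) =
      entropy pV1 + entropy pV2.
    rewrite -E1 -E2 -big_split /=; apply: eq_bigr => v1 _; rewrite -mulrDr; congr (_ * _).
    by rewrite -big_split /=; apply: eq_bigr => v2 _; rewrite -mulrDr.
  apply: le_lt_trans b3 _.
  apply: le_lt_trans (budget r3); rewrite lerD2r lerD2l.
  exact: B_beta.
Qed.

End BlockCoding.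

(** * From blocks to arbitrary lengths *)

Section Regroup.
Variables (n m l r : nat) (h : 'I_n -> 'I_m * 'I_l + 'I_r) (h' : 'I_m * 'I_l + 'I_r -> 'I_n).
Hypotheses (hK : cancel h h') (h'K : cancel h' h).

Definition regroup (T : finType) (s : {ffun 'I_n -> T}) :
    {ffun 'I_m -> {ffun 'I_l -> T}} * {ffun 'I_r -> T} :=
  ([ffun b => [ffun t => s (h' (inl (b, t)))]], [ffun t => s (h' (inr t))]).

Definition ungroup (T : finType) (p : {ffun 'I_m -> {ffun 'I_l -> T}} * {ffun 'I_r -> T}) :
    {ffun 'I_n -> T} :=
  [ffun i => match h i with inl bt => p.1 bt.1 bt.2 | inr t => p.2 t end].

Lemma regroupK (T : finType) : cancel (@regroup T) (@ungroup T).
Proof.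
move=> s; apply/ffunP => i; rewrite ffunE -[in RHS](hK i).
by case: (h i) => [[b t]|t]; rewrite !ffunE.
Qed.

Lemma ungroupK (T : finType) : cancel (@ungroup T) (@regroup T).
Proof.
move=> [p q]; congr (_, _).
  by apply/ffunP => b; apply/ffunP => t; rewrite !ffunE h'K.
by apply/ffunP => t; rewrite !ffunE h'K.
Qed.

Lemma sum_ungroup (R : nmodType) (T : finType) (P : pred {ffun 'I_n -> T})
    (F : {ffun 'I_n -> T} -> R) :
  \sum_(s | P s) F s = \sum_(p | P (ungroup p)) F (ungroup p).
Proof. by apply: reindex; exists (@regroup T) => x _; [apply: ungroupK|apply: regroupK]. Qed.

Lemma prod_regroup (R : comPzSemiRingType) (F : 'I_n -> R) :
  \prod_i F i = (\prod_b \prod_t F (h' (inl (b, t)))) * \prod_t F (h' (inr t)).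
Proof.
rewrite (reindex h'); last by exists h => x _; [apply: h'K|apply: hK].
rewrite big_sumType /=; congr (_ * _); rewrite pair_bigA.
by apply: eq_bigr => -[].
Qed.

Lemma ungroup_inl (T : finType) (p : {ffun 'I_m -> {ffun 'I_l -> T}} * {ffun 'I_r -> T}) b t :
  ungroup p (h' (inl (b, t))) = p.1 b t.
Proof. by rewrite ffunE h'K. Qed.

Lemma ungroup_inr (T : finType) (p : {ffun 'I_m -> {ffun 'I_l -> T}} * {ffun 'I_r -> T}) t :
  ungroup p (h' (inr t)) = p.2 t.
Proof. by rewrite ffunE h'K. Qed.

End Regroup.

(** The left-over source letters are part of the messages carried by the full blocks; in the last
    [n %% l] channel uses the constants [x1] and [x2] are sent and the outputs ignored. *)
Lemma blocks_transmissible (R : realType) (l : nat) (S1 S2 X1 X2 Y : finType)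
    (W : {ffun S1 * S2 -> R}) (Wc : X1 -> X2 -> {ffun Y -> R}) (x1 : X1) (x2 : X2) :
  (0 < l)%N -> is_pmf W -> (forall x1 x2, is_pmf (Wc x1 x2)) ->
  (forall (C : nat) (eps : R), 0 < eps ->
    exists m0 : nat, forall m, (m0 <= m)%N -> forall (B1 B2 : finType) (Q' : B1 -> B2 -> R),
    (forall b1 b2, 0 <= Q' b1 b2) -> \sum_b1 \sum_b2 Q' b1 b2 = 1 ->
    (#|B1| <= C)%N -> (#|B2| <= C)%N -> (#|B1| * #|B2| <= C)%N ->
    achievable (fun (a1 : {ffun 'I_m -> {ffun 'I_l -> S1}} * B1)
                    (a2 : {ffun 'I_m -> {ffun 'I_l -> S2}} * B2) =>
                  (\prod_i block_source W (a1.1 i) (a2.1 i)) * Q' a1.2 a2.2)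
      (fun (x1 : {ffun 'I_m -> {ffun 'I_l -> X1}}) (x2 : {ffun 'I_m -> {ffun 'I_l -> X2}})
           (y : {ffun 'I_m -> {ffun 'I_l -> Y}}) =>
         \prod_i block_channel Wc (x1 i) (x2 i) (y i)) eps) ->
  transmissible W Wc.
Proof.
move=> l0 HW HWc hcode eps eps0.
have := pmf_card_gt0 HW; rewrite card_prod muln_gt0 => /andP[S10 S20].
(* This bounds the number of left-over pairs for every remainder below [l], and also each left-over
   alphabet, as the other source alphabet is nonempty. *)
have [m0 hm0] := hcode ((#|S1| * #|S2|) ^ l)%N eps eps0.
exists (m0 * l)%N => n hn; pose m := (n %/ l)%N; pose r := (n %% l)%N.
have rl : (r < l)%N by rewrite ltn_mod.
have card_n : #|(('I_m * 'I_l) + 'I_r)%type : finType| = n.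
  by rewrite card_sum card_prod !card_ord -divn_eq.
pose h (i : 'I_n) : 'I_m * 'I_l + 'I_r := enum_val (cast_ord (esym card_n) i).
pose h' (x : 'I_m * 'I_l + 'I_r) : 'I_n := cast_ord card_n (enum_rank x).
have hK : cancel h h' by move=> i; rewrite /h /h' enum_valK cast_ordKV.
have h'K : cancel h' h by move=> x; rewrite /h /h' cast_ordK enum_rankK.
pose Q' (b1 : {ffun 'I_r -> S1}) (b2 : {ffun 'I_r -> S2}) : R := block_source W b1 b2.
have pow_le k : (0 < k)%N -> (k ^ r <= k ^ l)%N by move=> k0; rewrite leq_pexp2l // ltnW.
have [||||||e1 [e2 [d hd]]] := hm0 m _ _ _ Q'.
- by rewrite /m leq_divRL.
- by move=> b1 b2; apply: block_source_ge0.
- exact: block_source_sum.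
- rewrite card_ffun card_ord expnMn; apply: leq_trans (pow_le _ S10) _.
  by rewrite leq_pmulr // expn_gt0 S20.
- rewrite card_ffun card_ord expnMn; apply: leq_trans (pow_le _ S20) _.
  by rewrite leq_pmull // expn_gt0 S10.
- by rewrite !card_ffun !card_ord -expnMn pow_le // muln_gt0 S10.
exists (fun s => ungroup h (e1 (regroup h' s), [ffun=> x1])),
  (fun s => ungroup h (e2 (regroup h' s), [ffun=> x2])),
  (fun y => (ungroup h (d (regroup h' y).1).1, ungroup h (d (regroup h' y).1).2)).
apply: le_trans hd; rewrite le_eqVlt; apply/orP; left; apply/eqP.
rewrite /err_prob (sum_ungroup hK h'K); apply: eq_bigr => p1 _.
rewrite (sum_ungroup hK h'K); apply: eq_bigr => p2 _.
rewrite (prod_regroup hK h'K) !(ungroupK h'K); congr (_ * _).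
  congr (_ * _).
    apply: eq_bigr => b _; apply: eq_bigr => t _.
    by rewrite !(ungroup_inl h'K).
  by apply: eq_bigr => t _; rewrite !(ungroup_inr h'K).
rewrite (sum_ungroup hK h'K).
rewrite (eq_bigl (fun q : {ffun 'I_m -> {ffun 'I_l -> Y}} * {ffun 'I_r -> Y} =>
    (d q.1 != (p1, p2)) && true)); last first.
  move=> q; rewrite (ungroupK h'K) andbT; congr (~~ _); apply/eqP/eqP => [[]|->//].
  move=> /(can_inj (@ungroupK _ _ _ _ _ _ h'K _)) u1 /(can_inj (@ungroupK _ _ _ _ _ _ h'K _)) u2.
  by case: (d q.1) u1 u2 => ? ? /= -> ->.
rewrite (eq_bigr (fun q : {ffun 'I_m -> {ffun 'I_l -> Y}} * {ffun 'I_r -> Y} =>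
    (\prod_b block_channel Wc (e1 p1 b) (e2 p2 b) (q.1 b)) * \prod_t Wc x1 x2 (q.2 t))); last first.
  move=> q _; rewrite (prod_regroup hK h'K); congr (_ * _).
    by apply: eq_bigr => b _; apply: eq_bigr => t _; rewrite !(ungroup_inl h'K).
  by apply: eq_bigr => t _; rewrite !(ungroup_inr h'K) !ffunE.
rewrite -(pair_big (fun q1 => d q1 != (p1, p2)) predT (fun q1 (q2 : {ffun 'I_r -> Y}) =>
  (\prod_b block_channel Wc (e1 p1 b) (e2 p2 b) (q1 b)) * \prod_t Wc x1 x2 (q2 t))) /=.
apply: eq_bigr => q1 _; rewrite -mulr_sumr (sum_prod_ffun (fun _ y => Wc x1 x2 y)).
by rewrite [X in _ * X]big1 ?mulr1 // => i _; case: (HWc x1 x2).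
Qed.

(** * Inner code parameters and failure probability *)

Section Lstar.
Variables (R : realType) (A B : finType) (rho : R).
Hypothesis rho_gt0 : 0 < rho.

Let c := (2 * #|A| + 2 * #|A| * #|B|)%N.
Let E := expR (rho / 2).

Let condE n : lstar_cond A B rho n = (2 * n.+1%:R ^+ c <= E ^+ n).
Proof. by rewrite /lstar_cond -/c -mulrA expRM_natl. Qed.

(** The term of order [c + 1] of the exponential series exceeds [2 * (2 * n) ^ c] as soon as
    [n >= K], and [n + 1 <= 2 * n]. *)
Lemma exists_lstar_cond : exists n, lstar_cond A B rho n.
Proof.
pose K : R := 2 ^+ c.+1 * (c.+1)`!%:R / (rho / 2) ^+ c.+1.
have x0 : 0 < rho / 2 by rewrite divr_gt0.
have K0 : 0 <= K by rewrite divr_ge0 ?mulr_ge0 ?exprn_ge0 // ltW.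
pose n := (Num.bound K).+1; exists n.
have Kn : K <= n%:R.
  by apply: le_trans (ltW (archi_boundP K0)) _; rewrite ler_nat.
rewrite condE /E -expRM_natl.
apply: le_trans (expR_ge1Dxn c _); last by rewrite mulr_ge0 // ltW.
apply: ler_wpDl => //; rewrite ler_pdivlMr ?ltr0n ?fact_gt0 //.
rewrite exprMn; set X := (rho / 2) ^+ c.+1; set F := (c.+1)`!%:R.
have {}Kn : 2 ^+ c.+1 * F <= n%:R * X by move: Kn; rewrite ler_pdivrMr ?exprn_gt0.
have h1 : n.+1%:R ^+ c <= 2 ^+ c * n%:R ^+ c :> R.
  by rewrite -exprMn lerXn2r ?nnegrE ?mulr_ge0 // -natrM ler_nat /n; lia.
have nc0 : 0 <= n%:R ^+ c :> R by rewrite exprn_ge0.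
have -> : n%:R ^+ c.+1 * X = n%:R ^+ c * (n%:R * X) by rewrite exprS; ring.
apply: le_trans (ler_wpM2l nc0 Kn).
have -> : n%:R ^+ c * (2 ^+ c.+1 * F) = 2 * (2 ^+ c * n%:R ^+ c) * F by rewrite exprS; ring.
by rewrite ler_wpM2r ?ler0n // ler_wpM2l.
Qed.

(** The minimum gives the condition at one length only. Failure at [k] and success at [k + 1] bound
    [((k + 2) / (k + 1)) ^ c] by the growth factor [E]; this ratio decreases with the length, so the
    condition propagates upwards. *)
Lemma lstar_condP l : (lstar A B rho <= l)%N -> lstar_cond A B rho l.
Proof.
rewrite /lstar; case: pselect => [ex|/(_ exists_lstar_cond)//].
case: ex_minnP => k hk kmin.
(* At 0 the condition reads [2 <= 1], so the minimum has a predecessor. *)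
case: k hk kmin => [|k] hk kmin.
  by move: hk; rewrite condE expr1n expr0 mulr1 => h; exfalso; move: h; apply/negP;
    rewrite -ltNge; lra.
have step : k.+2%:R ^+ c <= E * k.+1%:R ^+ c.
  have : ~~ lstar_cond A B rho k by apply/negP => /kmin; rewrite ltnn.
  rewrite condE -ltNge => h1; move: hk; rewrite condE exprS => h2.
  have E0 : 0 < E by apply: expR_gt0.
  by have := ler_wpM2l (ltW E0) (ltW h1); lra.
elim: l => // l IH; rewrite leq_eqVlt => /orP[/eqP <- //|]; rewrite ltnS => kl.
have := IH kl; rewrite !condE exprS => h.
apply: (@le_trans _ _ (E * (2 * l.+1%:R ^+ c))); last by rewrite ler_wpM2l // expR_ge0.
rewrite mulrCA ler_wpM2l //.
have k0 : 0 < k.+1%:R ^+ c :> R by rewrite exprn_gt0.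
rewrite -(ler_pM2r k0) -exprMn.
apply: (@le_trans _ _ ((k.+2%:R * l.+1%:R) ^+ c)).
  rewrite lerXn2r ?nnegrE ?mulr_ge0 // -!natrM ler_nat; nia.
by rewrite exprMn mulrAC; apply: ler_wpM2r => //; rewrite exprn_ge0.
Qed.

Lemma lstar_cond_gt0 l : lstar_cond A B rho l -> (0 < l)%N.
Proof. by case: l => //; rewrite condE expr1n expr0 mulr1 => h; exfalso; lra. Qed.

End Lstar.

Section Binning.
Variables (K : finType) (good : {set K}) (B : nat).
Hypothesis B_gt0 : (0 < B)%N.

(** Bins are consecutive runs of length [B] in an enumeration of [good]; the last position
    [#|good|.-1] gives the last bin. Words outside [good] land in some bin and count as failures in
    [decoded]. *)
Definition bin_index (k : K) : 'I_(#|good|.-1 %/ B).+1 := inord (index k (enum good) %/ B).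

(** Inside a bin the quotient of the position is fixed, so its remainder modulo [B] identifies the
    word. *)
Lemma bin_index_card m : (#|[set k in good | bin_index k == m]| <= B)%N.
Proof.
have val_bin k : k \in good -> val (bin_index k) = (index k (enum good) %/ B)%N.
  move=> kg; rewrite /bin_index /= inordK // ltnS leq_div2r //.
  have := kg; rewrite -mem_enum -index_mem -cardE; by case: #|good|.
pose f (k : K) : 'I_B := Ordinal (ltn_pmod (index k (enum good)) B_gt0).
rewrite -[X in (_ <= X)%N]card_ord -(@card_in_imset _ _ f); first exact: max_card.
move=> k k'; rewrite !inE => /andP[kg /eqP km] /andP[kg' /eqP km'] /(congr1 val) /= hm.
have hd : (index k (enum good) %/ B = index k' (enum good) %/ B)%N.
  by rewrite -!val_bin // km km'.
have hi : index k (enum good) = index k' (enum good).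
  by rewrite [LHS](divn_eq _ B) hd hm -divn_eq.
by rewrite -[k](nth_index k (s := enum good)) ?mem_enum // hi nth_index // mem_enum.
Qed.

End Binning.

(** * Probability that a block fails *)

Section Decoding.
Variables (R : realType) (l : nat) (S1 S2 V1 V2 X1 X2 Y U : finType).
Variables (W : {ffun S1 * S2 -> R}) (Wc : X1 -> X2 -> {ffun Y -> R}).
Variables (pV1 : {ffun V1 -> R}) (pV2 : {ffun V2 -> R}).
Variables (pX1 : U -> V1 -> {ffun X1 -> R}) (pX2 : U -> V2 -> {ffun X2 -> R}).
Hypotheses (HW : is_pmf W) (HWc : forall x1 x2, is_pmf (Wc x1 x2)).
Hypotheses (HpV1 : is_pmf pV1) (HpV2 : is_pmf pV2).
Hypotheses (HpX1 : forall u v, is_pmf (pX1 u v)) (HpX2 : forall u v, is_pmf (pX2 u v)).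

Variable pU : {ffun U -> R}.
Hypothesis HpU : is_pmf pU.
Local Notation letter_mean := (letter_mean Wc pV1 pV2 pX1 pX2).
Local Notation word_mean := (@word_mean R l V1 V2 X1 X2 Y U Wc pV1 pV2 pX1 pX2).
Local Notation P := (chanpmf pU pV1 pV2 pX1 pX2 Wc).
Variables (K M : finType) (f1 : S1 -> K) (f2 : S2 -> K) (a : bool).
Variables (c : M -> {ffun 'I_l -> U}) (msg : {ffun 'I_l -> K} -> M).
Variables (d : {ffun 'I_l -> Y} -> M) (good : {set {ffun 'I_l -> K}}).
Hypothesis l_gt0 : (0 < l)%N.
Hypothesis c_occ : forall m u, l%:R * pU u = (occ (c m) u)%:R.

Local Notation pK := (dist W (Ka a f1 f2)).

Lemma dist_pmf : is_pmf pK.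
Proof.
split=> [k|]; first by apply: dist_ge0; case: HW.
have := sum_dist W (Ka a f1 f2) (fun=> 1).
by under eq_bigr do rewrite mulr1; move=> ->; under eq_bigr do rewrite mulr1; case: HW.
Qed.

Lemma word_mean_le1 u v (F : {ffun 'I_l -> Y} -> R) : (forall y, F y <= 1) ->
  word_mean u v (fun _ _ y => F y) <= 1.
Proof.
move=> F1; have <- : word_mean u v (fun _ _ _ => \prod_(i < l) 1) = 1.
  rewrite (word_mean_prod Wc pV1 pV2 pX1 pX2 u v (fun _ _ _ _ => 1)) big1 // => i _.
  rewrite (letter_mean_strategies pV1 pV2 HWc HpX1 HpX2 _ _ (fun _ _ => 1)).
  case: HpV1 => _ h1; case: HpV2 => _ h2.
  by rewrite (eq_bigr (fun v1 => pV1 v1)) // => v1 _; rewrite -mulr_suml h2 mul1r mulr1.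
apply: ler_sum => t1 _; apply: ler_wpM2l.
  by apply: prodr_ge0 => i _; apply: strategy_ge0.
apply: ler_sum => t2 _; apply: ler_wpM2l.
  by apply: prodr_ge0 => i _; apply: strategy_ge0.
apply: ler_sum => y _; apply: ler_wpM2l; last by rewrite [leRHS]big1.
by apply: prodr_ge0 => i _; case: (HWc (t1 i).2 (t2 i).2).
Qed.

Lemma source_pushforward (G : {ffun 'I_l -> K} -> R) :
  \sum_s1 \sum_s2 block_source W s1 s2 * G (common_word f1 f2 a s1 s2) =
  \sum_(k : {ffun 'I_l -> K}) (\prod_i pK (k i)) * G k.
Proof.
have E s1 s2 : G (common_word f1 f2 a s1 s2) =
    \sum_(k : {ffun 'I_l -> K}) G k * \prod_i (Ka a f1 f2 (s1 i, s2 i) == k i)%:R.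
  rewrite (bigD1 (common_word f1 f2 a s1 s2)) //= [X in _ * X]big1 ?mulr1; last first.
    by move=> i _; rewrite ffunE eqxx.
  rewrite big1 ?addr0 // => k hk.
  have [i /negbTE hi] : exists i, Ka a f1 f2 (s1 i, s2 i) != k i.
    apply/existsP; rewrite -negb_forall; apply: contra hk => /forallP h'.
    by apply/eqP/ffunP => i; rewrite ffunE; apply/esym/eqP.
  by rewrite (bigD1 i) //= hi mul0r mulr0.
under eq_bigr do under eq_bigr do rewrite E mulr_sumr.
under eq_bigr do rewrite exchange_big.
rewrite exchange_big; apply: eq_bigr => k _.
under eq_bigr do under eq_bigr do rewrite mulrCA.
under eq_bigr do rewrite -mulr_sumr.
rewrite -mulr_sumr mulrC; congr (_ * _).
rewrite (source_prod W (fun i s1 s2 => (Ka a f1 f2 (s1, s2) == k i)%:R)).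
by apply: eq_bigr => i _; rewrite distE; apply: eq_bigr => -[].
Qed.

Lemma disagree_prob :
  \sum_s1 \sum_s2 block_source W s1 s2 * (~~ @agree l S1 S2 K f1 f2 s1 s2)%:R = xi l W f1 f2.
Proof.
transitivity (\sum_s1 \sum_s2 (block_source W s1 s2 -
    block_source W s1 s2 * \prod_(i < l) (f1 (s1 i) == f2 (s2 i))%:R)).
  apply: eq_bigr => s1 _; apply: eq_bigr => s2 _; rewrite -{2}[block_source _ _ _]mulr1 -mulrBr.
  congr (_ * _); case: (boolP (agree _ _ _ _)) => [/forallP h|]; rewrite /=.
    by rewrite big1 ?subrr // => i _; rewrite h.
  by rewrite negb_forall => /existsP[i /negbTE hi]; rewrite (bigD1 i) //= hi mul0r subr0.
under eq_bigr do rewrite sumrB.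
rewrite sumrB block_source_sum // /xi.
rewrite (source_prod W (fun (i : 'I_l) s1 s2 => (f1 s1 == f2 s2)%:R)) prodr_const card_ord.
congr (_ - _ ^+ _); case: HW => _ {2}<-.
rewrite [X in X - _](bigID (fun s => f1 s.1 != f2 s.2)) /= addrAC subrr add0r.
by rewrite [RHS]big_mkcond; apply: eq_bigr => s _; case: eqP; rewrite ?mulr1 ?mulr0.
Qed.

(** Union bound. On agreeing typical words both encoders send the codeword of one bin, so the output
    has the law for which [inner_code] was built, and a bin weighs as much as its words. *)
Lemma decoding_failure (g : R) :
  \sum_m (\sum_(k : {ffun 'I_l -> K} | msg k == m) \prod_i pK (k i)) *
    (\sum_(y : {ffun 'I_l -> Y} | d y != m) \prod_i condpmf P cU cY (c m i) (y i)) <= g ->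
  block_mean W Wc pV1 pV2 pX1 pX2 (word_encoder c msg f1) (word_encoder c msg f2)
    (fun s1 _ s2 _ y => (~~ decoded f1 f2 a msg d good s1 s2 y)%:R) <=
  g + xi l W f1 f2 + \sum_(k : {ffun 'I_l -> K} | k \notin good) \prod_i pK (k i).
Proof.
move=> hg.
pose err m := \sum_(y : {ffun 'I_l -> Y} | d y != m) \prod_i condpmf P cU cY (c m i) (y i).
have c_gt0 m i : 0 < pU (c m i).
  have : 0 < l%:R * pU (c m i) by rewrite (c_occ m) ltr0n occ_gt0.
  by rewrite pmulr_rgt0 // ltr0n.
have err0 m : 0 <= err m.
  by apply: sumr_ge0 => y _; apply: prodr_ge0 => i _; apply: condpmf_ge0.
apply: (@le_trans _ _ (\sum_s1 \sum_s2 (block_source W s1 s2 * (~~ agree f1 f2 s1 s2)%:R +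
   (block_source W s1 s2 * (common_word f1 f2 a s1 s2 \notin good)%:R +
    block_source W s1 s2 * err (msg (common_word f1 f2 a s1 s2)))))).
  rewrite block_meanE; apply: ler_sum => s1 _; apply: ler_sum => s2 _.
  rewrite -!mulrDr; apply: ler_wpM2l; first exact: block_source_ge0.
  have w1 : word_mean (word_encoder c msg f1 s1) (word_encoder c msg f2 s2)
      (fun _ _ y => (~~ decoded f1 f2 a msg d good s1 s2 y)%:R) <= 1.
    by apply: word_mean_le1 => y; case: (decoded _ _ _ _ _ _ _ _ _).
  case: (boolP (agree f1 f2 s1 s2)) => hA /=; last first.
    by apply: le_trans w1 _; rewrite lerDl addr_ge0.
  case: (boolP (common_word f1 f2 a s1 s2 \in good)) => hG /=; last first.
    by apply: le_trans w1 _; rewrite add0r lerDl.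
  rewrite !add0r -(agree_encoder a c msg hA) /word_encoder; have [-> _] := agree_common a hA.
  rewrite word_mean_output /err [leRHS]big_mkcond /=; apply: ler_sum => y _.
  rewrite /decoded hA hG /=; case: eqP => _ /=; first by rewrite mulr0.
  rewrite mulr1 le_eqVlt; apply/orP; left; apply/eqP; apply: eq_bigr => i _.
  by rewrite condpmf_letter.
under eq_bigr do rewrite !big_split /=.
rewrite !big_split /= disagree_prob.
rewrite (source_pushforward (fun k => (k \notin good)%:R)).
rewrite (source_pushforward (fun k => err (msg k))).
rewrite (_ : \sum_k _ * err (msg k) = \sum_m (\sum_(k : {ffun 'I_l ->
  K} | msg k == m) \prod_i pK (k i)) * err m).
  rewrite (_ : \sum_k _ * (_ \notin _)%:R = \sum_(k : {ffun 'I_l ->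
    K} | k \notin good) \prod_i pK (k i)).
    by rewrite -/err in hg; lra.
  by rewrite [RHS]big_mkcond; apply: eq_bigr => k _; case: (_ \in _); rewrite ?mulr1 ?mulr0.
rewrite (partition_big msg predT) //=; apply: eq_bigr => m _; rewrite mulr_suml.
by apply: eq_bigr => k /eqP ->.
Qed.

End Decoding.

(** * Choice of the bins and of the inner code *)

Unset Implicit Arguments.
Theorem theorem13 (R : realType) (S1 S2 X1 X2 Y : finType)
  (W : {ffun S1 * S2 -> R}) (Wc : X1 -> X2 -> {ffun Y -> R})
  (HW : is_pmf W) (HWc : forall x1 x2, is_pmf (Wc x1 x2))
  (K U V1 V2 : finType) (f1 : S1 -> K) (f2 : S2 -> K)
  (alpha beta rho delta : R)
  (Halpha : 0 <= alpha) (Hbeta : 0 <= beta) (Hrho : 0 < rho) (Hdelta : 0 < delta)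
  (l : nat) (Hl : (lstar U Y rho <= l)%N)
  (pU : {ffun U -> R}) (pV1 : {ffun V1 -> R}) (pV2 : {ffun V2 -> R})
  (pX1 : U -> V1 -> {ffun X1 -> R}) (pX2 : U -> V2 -> {ffun X2 -> R})
  (HpU : is_pmf pU) (HpV1 : is_pmf pV1) (HpV2 : is_pmf pV2)
  (HpX1 : forall u v, is_pmf (pX1 u v)) (HpX2 : forall u v, is_pmf (pX2 u v))
  (HpUtype : is_type l pU)
  (a : bool) :
  let P := chanpmf pU pV1 pV2 pX1 pX2 Wc in
  let phi := gfun (alpha + rho) l pU (condpmf P cU cY)
             + xi l W f1 f2 + tau l delta (dist W (Ka a f1 f2)) in
  (1 + delta) * Ent W (Ka a f1 f2) < alpha + beta ->
  condEnt W fst (fun s => (s.2, Ka a f1 f2 s)) + Ll l phi #|S1|%:R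
    < condMI P cV1 cY (fun w => (cU w, cV2 w)) - L1 phi #|V1|%:R ->
  condEnt W snd (fun s => (s.1, Ka a f1 f2 s)) + Ll l phi #|S2|%:R
    < condMI P cV2 cY (fun w => (cU w, cV1 w)) - L1 phi #|V2|%:R ->
  beta + condEnt W (fun s => s) (Ka a f1 f2) + Ll l phi (#|S1| * #|S2|)%:R
    < condMI P (fun w => (cV1 w, cV2 w)) cY cU - L1 phi (#|V1| * #|V2|)%:R ->
  0 <= phi < 1 / 2 ->
  transmissible W Wc.
Proof.
move=> P phi rate0 rate1 rate2 rate3 phi_bd.
have cond := lstar_condP Hrho Hl; have l0 := lstar_cond_gt0 cond.
have [u _] : exists u : U, True.
  by have /card_gt0P[u _] := pmf_card_gt0 HpU; exists u.
have /card_gt0P[v1 _] := pmf_card_gt0 HpV1; have /card_gt0P[v2 _] := pmf_card_gt0 HpV2.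
(* [x1] and [x2] serve as padding inputs after the last full block. *)
have /card_gt0P[x1 _] := pmf_card_gt0 (HpX1 u v1);
  have /card_gt0P[x2 _] := pmf_card_gt0 (HpX2 u v2).
pose pK := dist W (Ka a f1 f2).
have HpK : is_pmf pK := dist_pmf HW f1 f2 a.
pose good := @typical R K pK l delta.
(* The bin size is the integer part of [x]: its logarithm stays below [l * beta], and [beta >= 0]
   makes it positive, whence [x <= 2 * B] below. *)
pose x := expR (l%:R * beta).
have x_ge1 : 1 <= x by rewrite /x -[leLHS]expR0 ler_expR mulr_ge0.
have [B [Bx xB]] : exists B : nat, B%:R <= x /\ x < B.+1%:R.
  by exists (Num.truncn x); apply/andP; apply: truncn_itv; apply: le_trans x_ge1.
have B0 : (0 < B)%N.
  by rewrite lt0n; apply/eqP => h; move: xB; rewrite h ltNge x_ge1.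
have lR0 : 0 < l%:R :> R by rewrite ltr0n.
have B_beta : ln B%:R <= l%:R * beta.
  by rewrite -[leRHS]expRK ler_ln ?posrE ?expR_gt0 ?ltr0n.
pose M := (('I_(#|good|.-1 %/ B).+1) : finType).
pose msg : {ffun 'I_l -> K} -> M := @bin_index _ good B.
pose w (m : M) := \sum_(k : {ffun 'I_l -> K} | msg k == m) \prod_i pK (k i).
have pK0 k : 0 <= pK k by case: HpK.
have w0 m : 0 <= w m by apply: sumr_ge0 => k _; apply: prodr_ge0.
have w1 : \sum_m w m <= 1.
  have -> : \sum_m w m = \sum_(k : {ffun 'I_l -> K}) \prod_i pK (k i).
    by rewrite (partition_big msg predT).
  rewrite (sum_prod_ffun (fun _ b => pK b)) big1 //.
  by move=> i _; case: HpK.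
(* All bins but the last hold [B] typical words, so by the first rate condition there are at most
   [expR (l * alpha)] of them, up to the factor 2 from rounding; [lstar] lets [rho] absorb this
   factor and the polynomial. *)
have size_bound : (#|M|.-1)%:R * l.+1%:R ^+ (#|U| + #|U| * #|Y|) <=
    expR (l%:R * (alpha + rho)).
  rewrite card_ord /=.
  have h1 : ((#|good|.-1 %/ B) * B)%:R <= expR (l%:R * (alpha + beta)).
    apply: (@le_trans _ _ #|good|%:R).
      by rewrite ler_nat; apply: leq_trans (leq_trunc_div _ _) (leq_pred _).
    apply: le_trans (card_typical l delta HpK) _.
    by rewrite ler_expR ler_wpM2l //; apply: ltW.
  have h2 : (#|good|.-1 %/ B)%:R <= 2 * expR (l%:R * alpha).
    have B2 : x <= 2 * B%:R.
      apply: le_trans (ltW xB) _; by rewrite -natrM ler_nat mul2n -addnn -addn1 leq_add2l.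
    rewrite natrM mulrDr expRD -/x in h1.
    rewrite -(ler_pM2r (lt_le_trans ltr01 x_ge1)).
    apply: le_trans (ler_wpM2l (ler0n _ _) B2) _.
    by rewrite mulrCA -mulrA ler_wpM2l.
  have h3 : 2 * l.+1%:R ^+ (#|U| + #|U| * #|Y|) <= expR (l%:R * rho).
    apply: le_trans (_ : expR (l%:R * rho / 2) <= _); last first.
      by rewrite ler_expR ler_pdivrMr // ler_peMr ?ler1n // mulr_ge0 // ltW.
    apply: le_trans cond; rewrite ler_wpM2l // ler_weXn2l ?ler1n //.
    by rewrite leq_add // ?leq_pmull // -mulnA leq_pmull.
  rewrite mulrDr expRD.
  apply: le_trans (ler_wpM2r (exprn_ge0 _ (ler0n _ _)) h2) _.
  by rewrite mulrAC mulrC ler_wpM2l ?expR_ge0.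
have cp0 := condpmf_ge0 HWc HpV1 HpV2 HpX1 HpX2 HpU.
have cp1 := condpmf_pmf HWc HpV1 HpV2 HpX1 HpX2 HpU.
have [c [d [c_occ hd]]] := inner_code (ord0 : M) l0 HpU HpUtype cp0 cp1 w0 w1 size_bound.
have dec := decoding_failure HW HWc HpV1 HpV2 HpX1 HpX2 HpU good l0 c_occ hd.
apply: (blocks_transmissible x1 x2 l0 HW HWc).
apply: (block_coding HW HWc HpV1 HpV2 HpX1 HpX2 HpU l0 B0 c_occ
  (bin_index_card (good := good) B0) phi_bd _ B_beta rate1 rate2 rate3).
(* It remains to dominate the inner error by [gfun] and the atypical mass by [tau]; [xi] already
   appears exactly. *)
apply: le_trans dec _; apply: lerD.
  by rewrite lerD2r /gfun ler_wpM2r ?expR_ge0 // ler_weXn2l ?ler1n // -mulnA leq_pmull.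
apply: le_trans (typical_mass l HpK (ltW Hdelta)) _.
by rewrite /tau ler_wpM2r ?expR_ge0 // ler_peMl // ler1n.
Qed.
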